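(* Let $\phi_0=0.061$. For all $\alpha,\beta\in(0,1]$, all $\phi\in[\phi_0,\pi]$ and all odd integers $n\ge 5$ (that is, $n=5,7,9,\ldots$), $$w_n(\alpha,\beta,-1)\ \ge\ \left|w_n(\alpha,\beta,e^{i\phi})\right|.$$
   Context: For a positive integer $n$ and $x\in\mathbb{C}$, $$w_n(\alpha,\beta,x)=\frac{1}{n!}\,\Gamma(n-\alpha)\,\Gamma(1+\alpha)\,\sin(\pi\alpha)\;{}_2F_1(\beta,-n;\alpha-n+1;x),$$ where ${}_2F_1(a,b;c;z)=\sum_{k\ge0}\frac{(a)_k(b)_k}{(c)_k\,k!}z^k$ is the Gauss hypergeometric function (here a polynomial in $x$) and $(a)_k=\Gamma(a+k)/\Gamma(a)$. At $\alpha=1$ the value is understood as the limit $\alpha\to1$, namely, for $n\ge2$, $$w_n(1,\beta,x)=\frac{\pi\,\Gamma(\beta+n-1)}{\Gamma(\beta)\,n!}\{n-(\beta+n-1)x\}x^{n-1}.$$ Relation with Maclaurin coefficients: if $\frac{(1+\omega z)^\alpha}{(1-z)^\beta}=\sum_{n\ge0}A_n(\alpha,\beta,\omega)z^n$ for $|z|<1=|\omega|$ (principal branches), then $A_n(\alpha,\beta,\omega)=\frac{(-1)^{n+1}}{\pi}\omega^n w_n(\alpha,\beta,-1/\omega)$. Hence, with $\omega=e^{i\theta}$ and $\phi=\pi-\theta$, for odd $n$ the stated inequality is equivalent to $|A_n(\alpha,\beta,e^{i\theta})|\le A_n(\alpha,\beta,1)$. *)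

(* Defs.v *)
From HB Require Import structures.
From mathcomp Require Import all_boot all_order all_algebra.
From mathcomp Require Import all_classical all_reals all_analysis.
From mathcomp Require Import complex.
Set Implicit Arguments.
Unset Strict Implicit.
Unset Printing Implicit Defensive.
Import Order.TTheory GRing.Theory Num.Theory.
Import numFieldTopology.Exports numFieldNormedType.Exports.
Local Open Scope classical_set_scope.
Local Open Scope ring_scope.
Local Open Scope complex_scope.

(* Euler's integral; it is used below only at arguments s > 0, where it
   converges. *)
Definition Gamma (R : realType) (s : R) : R :=
  \int[lebesgue_measure]_(t in `]0, +oo[) (t `^ (s - 1) * expR (- t)).

(* (a)_k = a (a + 1) ... (a + k - 1), which is Gamma(a + k) / Gamma(a) and
   extends it to a = -n, where Gamma has a pole. *)
Definition poch (K : pzRingType) (a : K) (k : nat) : K :=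
  \prod_(i < k) (a + i%:R).

(* R[i]^o is the copy of R[i] that carries the topology of the modulus. *)
Definition hyp2F1 (R : realType) (a b c z : R[i]) : R[i] :=
  limn (series (fun k : nat =>
    poch a k * poch b k / (poch c k * k`!%:R) * z ^+ k : R[i]^o)).

Lemma hyp2F1_poly (R : realType) (n : nat) (a c z : R[i]) :
  hyp2F1 a (- n%:R) c z =
  \sum_(k < n.+1) poch a k * poch (- n%:R) k / (poch c k * k`!%:R) * z ^+ k.
Proof.
apply: (@lim_near_cst R[i]^o) => //; near=> m.
have le_nm : (n.+1 <= m)%N by near: m; exact: nbhs_infty_ge.
rewrite /series /= (big_cat_nat _ le_nm) //= big_mkord.
rewrite [X in _ + X]big_nat_cond [X in _ + X]big1 ?addr0 // => k /andP[/andP[lt_nk _] _].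
have -> : poch (- n%:R : R[i]) k = 0.
  by rewrite /poch (bigD1 (Ordinal lt_nk)) //= addNr mul0r.
by rewrite mulr0 !mul0r.
Unshelve. all: by end_near.
Qed.

(* Meaningful for alpha in ]-1, n[ that is not an integer. *)
Definition w_formula (R : realType) (n : nat) (alpha beta : R) (x : R[i])
    : R[i] :=
  ((n`!%:R)^-1 * Gamma (n%:R - alpha) * Gamma (1 + alpha) * sin (pi * alpha))%:C
  * hyp2F1 beta%:C (- n%:R) (alpha - n%:R + 1)%:C x.

(* At alpha = 1 the sine and, for n >= 2, some of the (alpha - n + 1)_k vanish,
   so the formula is replaced by its limit. *)
Definition w (R : realType) (n : nat) (alpha beta : R) (x : R[i]) : R[i] :=
  if alpha == 1 then lim ((w_formula n a beta x : R[i]^o) @[a --> (1 : R)^'])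
  else w_formula n alpha beta x.

Definition cis (R : realType) (phi : R) : R[i] := cos phi +i* sin phi.

Definition phi0 (R : realType) : R := 61%:R / 1000%:R.
Arguments phi0 {R}.

(* Main.v *)
(* Put a = alpha, b = beta and let Q(z) be the sum over k <= n of
   (b)_k / k! * (-a)_(n-k) / (n-k)! * z^k.  Up to a nonpositive real factor that
   does not depend on x, w n a b x is Q(x), so the claim is |Q(z)| <= -Q(-1) for
   |z| = 1, z <> 1, and by continuity a, b < 1 may be assumed.
   Writing (b)_k / k! and (-a)_k / k! as beta integrals over the half-line and
   summing a geometric series gives, with S and T positive constants,
     -Q(z) = T int y^a (1+y)^(-n-1) [S int x^-b / (x + 1 - (1+y) z) dx] dy
        - z^n S int x^-b (1+x)^(-n-1) [T int y^(a-1) q / (y + q) dy] dx,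
   where q = 1 - (1+x) conj z.  The inner integrals have modulus
   |1 - (1+y) z|^(-b) and |q|^a, hence |Q(z)| <= U(|1 - z|), where
     U(p) = int (1+x)^(-n-1) [S x^-b D^a + T x^a D^-b] dx,
     D = sqrt (x^2 + (1+x) p^2),
   with equality at z = -1 because n is odd.  It remains to see that
   U(p) <= U(2).  After the substitution t = x / sqrt (1+x), U(2) - U(p) is the
   integral of a decreasing positive weight times a function that changes sign
   once, from + to -; so the weight can be dropped, and by homogeneity only the
   sign of S int y^-b [(y^2+1)^(a/2) - y^a] - T int y^a [y^-b - (y^2+1)^(-b/2)]
   matters.  Both terms are double integrals of x^-b y^a against transposed
   kernels, and they are compared by symmetrising. *)

Require Import Defs.
From mathcomp Require Import all_boot all_order all_algebra.
From mathcomp Require Import all_classical all_reals all_analysis.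
From mathcomp Require Import measurable_realfun complex.
From mathcomp Require Import ring lra.
Import Order.TTheory GRing.Theory Num.Theory.
Import numFieldTopology.Exports numFieldNormedType.Exports.
Set Implicit Arguments.
Unset Strict Implicit.
Unset Printing Implicit Defensive.
Local Open Scope classical_set_scope.
Local Open Scope ring_scope.

(** * Integrals on the half-line *)

(** The modulus is reached through real integrals only: [Re (w Q(z)) >= Q(-1)] is proved for every
    unimodular [w], and [w = - conj Q / |Q|] then gives the bound for [|Q|]. The inner integrals are
    Stieltjes transforms of powers at a complex point. No branch of a complex power is chosen: the
    integral I(r) of x^-s / (x + 1 - r z) is followed along r >= 0, where a linear differential
    equation shows that |I(r)| |1 - r z|^s is constant. Two divergences shape the rest. The term k =
    n of Q would need the integral of y^a / (1 + y), which is infinite; it is kept out of the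
    geometric sum and comes back from a partial fraction, which also produces the quotient q / (y +
    q). And without the weight the two terms of the majorant behave like y^(a-b) at infinity, which
    is not integrable; subtracting their value at P = 0 gives the integrable functions [gap1] and
    [gap2], and this value cancels when two values of P are compared. The single sign change comes
    from convexity: for t = D / x and after the factor x^(a-b), the integrand is S t^a + T t^-b, a
    convex function of ln t. *)

Section HalfLine.
Context {R : realType}.
Notation mu := (@lebesgue_measure R).
Implicit Types (f g : R -> R) (x y : R).

Definition hl : set R := `]0, +oo[.
Definition hlint f : R := \int[mu]_(x in hl) f x.
Definition hlintegrable f : Prop := mu.-integrable hl (EFin \o f).

Lemma measurable_hl : measurable hl.
Proof. exact: measurable_itv. Qed.
Hint Resolve measurable_hl : core.

Lemma hlE x : hl x = (0 < x) :> Prop.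
Proof. by rewrite /hl /= in_itv /= andbT. Qed.

Lemma mem_hl x : x \in hl -> 0 < x.
Proof. by rewrite inE hlE. Qed.

Lemma eq_hlint f g : (forall x, 0 < x -> f x = g x) -> hlint f = hlint g.
Proof. by move=> fg; apply: eq_Rintegral => x /mem_hl /fg. Qed.

Lemma eq_hlintegrable f g :
  (forall x, 0 < x -> f x = g x) -> hlintegrable f -> hlintegrable g.
Proof.
by move=> fg; apply: eq_integrable => // x /mem_hl /fg /= ->.
Qed.

Lemma hlintegrableD f g : hlintegrable f -> hlintegrable g ->
  hlintegrable (fun x => f x + g x).
Proof.
exact: integrableD.
Qed.

Lemma hlintegrableZ k f : hlintegrable f -> hlintegrable (fun x => k * f x).
Proof.
exact: integrableZl.
Qed.

Lemma hlintegrableB f g : hlintegrable f -> hlintegrable g ->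
  hlintegrable (fun x => f x - g x).
Proof.
move=> mf mg; apply: (@eq_hlintegrable (fun x => f x + (-1) * g x)).
  by move=> x _; rewrite mulN1r.
by apply: hlintegrableD => //; exact: hlintegrableZ.
Qed.

Lemma hlintD f g : hlintegrable f -> hlintegrable g ->
  hlint (fun x => f x + g x) = hlint f + hlint g.
Proof. exact: RintegralD. Qed.

Lemma hlintB f g : hlintegrable f -> hlintegrable g ->
  hlint (fun x => f x - g x) = hlint f - hlint g.
Proof. exact: RintegralB. Qed.

Lemma hlintZ k f : hlintegrable f -> hlint (fun x => k * f x) = k * hlint f.
Proof. exact: RintegralZl. Qed.

Lemma le_hlint f g : hlintegrable f -> hlintegrable g ->
  (forall x, 0 < x -> f x <= g x) -> hlint f <= hlint g.
Proof. by move=> mf mg fg; apply: le_Rintegral => // x; rewrite hlE => /fg. Qed.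

Lemma hlint_ge0 f : (forall x, 0 < x -> 0 <= f x) -> 0 <= hlint f.
Proof. by move=> f0; apply: Rintegral_ge0 => x; rewrite hlE => /f0. Qed.

Lemma hlintegrable_measurable f : hlintegrable f -> measurable_fun hl f.
Proof. by move=> /measurable_int /measurable_EFinP. Qed.

Lemma le_hlintegrable f g : measurable_fun hl f ->
  (forall x, 0 < x -> `|f x| <= g x) -> hlintegrable g -> hlintegrable f.
Proof.
move=> mf fg; apply: le_integrable => //; first exact/measurable_EFinP.
move=> x; rewrite hlE => x0 /=; rewrite lee_fin.
by rewrite (le_trans (fg _ x0)) // ler_norm.
Qed.

Lemma hlintegrableS (A : set R) f : measurable A -> A `<=` hl ->
  hlintegrable f -> mu.-integrable A (EFin \o f).
Proof. by move=> mA Ahl; apply: integrableS. Qed.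

Lemma hlint_fin f : hlintegrable f ->
  (\int[mu]_(x in hl) (f x)%:E)%E = (hlint f)%:E.
Proof. by move=> mf; rewrite /hlint /Rintegral fineK // integrable_fin_num. Qed.

Lemma ge0_hlintegrable f : measurable_fun hl f ->
  (forall x, 0 < x -> 0 <= f x) ->
  ((\int[mu]_(x in hl) (f x)%:E)%E < +oo)%E -> hlintegrable f.
Proof.
move=> mf f0 foo; apply/integrableP; split; first exact/measurable_EFinP.
apply: le_lt_trans foo; rewrite le_eqVlt; apply/orP; left; apply/eqP.
by apply: eq_integral => x /mem_hl /f0 f0x /=; rewrite ger0_norm.
Qed.

Lemma measurable_continuous_hl f :
  (forall x, 0 < x -> {for x, continuous f}) -> measurable_fun hl f.
Proof.
move=> cf; apply: open_continuous_measurable_fun; first exact: interval_open.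
by move=> x /mem_hl /cf.
Qed.

(** Monotone convergence. The endpoints are left general because a change of variables [F] exhausts
    the half-line by the intervals from [F (uinv n)] to [F (vnat n)]. *)
Lemma ge0_hl_exhaustion (u v : nat -> R) f : measurable_fun hl f ->
  (forall x, 0 < x -> 0 <= f x) ->
  (forall n, 0 < u n) -> nonincreasing_seq u -> nondecreasing_seq v ->
  (forall x, 0 < x -> exists n, u n <= x <= v n) ->
  (\int[mu]_(x in `[u n, v n]) (f x)%:E)%E @[n --> \oo] -->
  (\int[mu]_(x in hl) (f x)%:E)%E.
Proof.
move=> mf f0 u0 ndu ndv uv.
have sub n : `[u n, v n] `<=` hl.
  move=> x /=; rewrite hlE in_itv /= => /andP[ux _]; exact: lt_le_trans ux.
have -> : hl = \bigcup_n `[u n, v n]%classic.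
  apply/seteqP; split=> x.
    rewrite hlE => /uv [n uvn]; exists n => //=; by rewrite in_itv.
  by move=> [n _] /sub.
apply: ge0_nondecreasing_set_cvg_integral => //.
- move=> m n mn; rewrite subsetEset => x /=; rewrite !in_itv /= => /andP[a b].
  by rewrite (le_trans (ndu _ _ mn) a) (le_trans b (ndv _ _ mn)).
- by move=> i; apply/measurable_EFinP; apply: measurable_funS mf.
- by move=> i x /sub; rewrite hlE => /f0; rewrite lee_fin.
Qed.

(** The shift by 2 gives [uinv n < 1 < vnat n] already at [n = 0], so that no interval of the
    exhaustion degenerates. *)
Definition uinv (n : nat) : R := n.+2%:R^-1.
Definition vnat (n : nat) : R := n.+2%:R.

Lemma uinv_gt0 n : 0 < uinv n. Proof. by rewrite invr_gt0. Qed.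
Lemma uinv_vnat n : uinv n < vnat n.
Proof.
have h : (1 < n.+2%:R :> R) by rewrite ltr1n.
by rewrite (lt_trans _ h) // invf_lt1 // ltr0n.
Qed.
Lemma uinv_ni : nonincreasing_seq uinv.
Proof. by move=> m n mn; rewrite lef_pV2 ?posrE ?ltr0n // ler_nat. Qed.
Lemma vnat_nd : nondecreasing_seq vnat.
Proof. by move=> m n mn; rewrite ler_nat. Qed.
Lemma uinv_vnat_exhaust x : 0 < x -> exists n, uinv n <= x <= vnat n.
Proof.
move=> x0; set y := Num.max x x^-1.
have y0 : 0 <= y by rewrite le_max ltW.
have := archi_boundP y0; set n := Num.bound _ => yn.
have yn2 : y <= n.+2%:R by rewrite (le_trans (ltW yn)) // ler_nat -addn2 leq_addr.
move: yn2; rewrite ge_max => /andP[h1 h2]; exists n.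
by rewrite /uinv /vnat h1 andbT invf_ple ?posrE ?ltr0n.
Qed.

Lemma uinv_cvg0 : uinv n @[n --> \oo] --> (0 : R).
Proof.
have := @cvg_harmonic R; rewrite -(@cvg_shiftS R^o (@harmonic R)) => h.
exact: h.
Qed.

Lemma vnat_cvgy : vnat n @[n --> \oo] --> (+oo : set_system R).
Proof.
apply/cvgryPge => A; near=> n.
have An : A <= n%:R by near: n; exact: nbhs_infty_ger.
by apply: (le_trans An); rewrite /vnat ler_nat -addn2 leq_addr.
Unshelve. all: by end_near. Qed.

Lemma at_right_uinv (f : R -> R) (l : R) :
  f x @[x --> 0^'+] --> l -> f (uinv n) @[n --> \oo] --> l.
Proof.
move=> /cvg_at_rightP; apply; split; first exact: uinv_gt0.
exact: uinv_cvg0.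
Qed.

Lemma pinfty_vnat (f : R -> R) (l : R) :
  f x @[x --> +oo%R] --> l -> f (vnat n) @[n --> \oo] --> l.
Proof. by move=> fl; exact: cvg_comp vnat_cvgy fl. Qed.

Lemma ge0_hl_cvg f : measurable_fun hl f -> (forall x, 0 < x -> 0 <= f x) ->
  (\int[mu]_(x in `[uinv n, vnat n]) (f x)%:E)%E @[n --> \oo] -->
  (\int[mu]_(x in hl) (f x)%:E)%E.
Proof.
move=> mf f0; apply: ge0_hl_exhaustion => //.
- exact: uinv_gt0.
- exact: uinv_ni.
- exact: vnat_nd.
- exact: uinv_vnat_exhaust.
Qed.

Lemma hl_cvg f : hlintegrable f ->
  (\int[mu]_(x in `[uinv n, vnat n]) f x) @[n --> \oo] --> hlint f.
Proof.
move=> intf; have mf := hlintegrable_measurable intf.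
have sub n : `[uinv n, vnat n] `<=` hl.
  move=> x /=; rewrite hlE in_itv /= => /andP[ux _].
  exact: lt_le_trans (uinv_gt0 n) ux.
have intn : hlintegrable (fun x => `|f x|) by exact: integrable_norm.
have key g : hlintegrable g -> (forall x, 0 < x -> 0 <= g x) ->
    (\int[mu]_(x in `[uinv n, vnat n]) g x) @[n --> \oo] --> hlint g.
  move=> intg g0; apply/fine_cvg; rewrite -hlint_fin //.
  exact: ge0_hl_cvg (hlintegrable_measurable intg) g0.
(* A difference of two nonnegative integrable functions, to each of which monotone convergence
   applies. *)
have fE : f = fun x => (`|f x| + f x) - `|f x| by apply/funext => x; ring.
have intp : hlintegrable (fun x => `|f x| + f x) by exact: hlintegrableD.
rewrite {2}fE hlintB //.
rewrite [X in X @ _ --> _](_ : _ = fun n =>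
   \int[mu]_(x in `[uinv n, vnat n]) (`|f x| + f x) -
   \int[mu]_(x in `[uinv n, vnat n]) `|f x|).
  apply: cvgB; apply: key => // x _.
  by have := ler_norm (- f x); rewrite normrN; lra.
apply/funext => n; rewrite -RintegralB //=.
- by congr Rintegral; apply/funext => x; ring.
- exact: hlintegrableS intp.
- exact: hlintegrableS intn.
Qed.

Lemma FTC_itv f F a b : 0 < a -> a < b ->
  (forall x, 0 < x -> is_derive x 1 F (f x)) ->
  (forall x, 0 < x -> {for x, continuous f}) ->
  (\int[mu]_(x in `[a, b]) (f x)%:E = (F b - F a)%:E)%E.
Proof.
move=> a0 ab dF cf.
have cF x : 0 < x -> {for x, continuous F}.
  by move=> /dF dFx; apply/differentiable_continuous/derivable1_diffP; case: dFx.
rewrite EFinB; apply: continuous_FTC2 => //.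
- apply: continuous_in_subspaceT => x; rewrite inE /= in_itv /= => /andP[ax _].
  by apply: cf; exact: lt_le_trans ax.
- split.
  + by move=> x; rewrite in_itv /= => /andP[ax _]; have [] := dF x (lt_trans a0 ax).
  + by apply: cvg_at_right_filter; apply: cF.
  + by apply: cvg_at_left_filter; apply: cF; exact: lt_trans ab.
- move=> x; rewrite in_itv /= => /andP[ax _].
  by rewrite derive1E; have [_ ->] := dF x (lt_trans a0 ax).
Qed.

Lemma hl_FTC f F (l0 l1 : R) :
  (forall x, 0 < x -> is_derive x 1 F (f x)) ->
  (forall x, 0 < x -> {for x, continuous f}) ->
  hlintegrable f ->
  F x @[x --> 0^'+] --> l0 -> F x @[x --> +oo%R] --> l1 ->
  hlint f = l1 - l0.
Proof.
move=> dF cf intf F0 F1.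
have h := hl_cvg intf.
have h2 : (\int[mu]_(x in `[uinv n, vnat n]) f x) @[n --> \oo] --> (l1 - l0).
  rewrite (_ : (fun n => _) = fun n => (F (vnat n) - F (uinv n))).
    by apply: cvgB; [exact: pinfty_vnat|exact: at_right_uinv].
  apply/funext => n; rewrite /Rintegral (FTC_itv _ _ dF) //; first exact: uinv_gt0.
  exact: uinv_vnat.
exact: (cvg_unique _ h h2).
Qed.

End HalfLine.

(** * Change of variables on the half-line *)

Section Subst.
Context {R : realType}.
Notation mu := (@lebesgue_measure R).
Implicit Types (f g F : R -> R) (x y : R).

Lemma is_derive_continuous F (x d : R) : is_derive x 1 F d -> {for x, continuous F}.
Proof. by move=> [dF _]; apply/differentiable_continuous/derivable1_diffP. Qed.

Section nonnegative.
Variables (F F' G : R -> R).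
Hypothesis dF : forall x, 0 < x -> is_derive x 1 F (F' x).
Hypothesis F'_gt0 : forall x, 0 < x -> 0 < F' x.
Hypothesis cF' : forall x, 0 < x -> {for x, continuous F'}.
Hypothesis F0 : F x @[x --> 0^'+] --> (0 : R).
Hypothesis Fy : F x @[x --> +oo%R] --> (+oo : set_system R).
Hypothesis cG : forall x, 0 < x -> {for x, continuous G}.

Let cF x : 0 < x -> {for x, continuous F}.
Proof. by move=> /dF; exact: is_derive_continuous. Qed.

Let F_incr x y : 0 < x -> x < y -> F x < F y.
Proof.
move=> x0 xy.
have [] := @MVT R F F' x y xy.
- by move=> z; rewrite in_itv /= => /andP[xz _]; apply: dF; exact: lt_trans xz.
- apply: continuous_in_subspaceT => z; rewrite inE /= in_itv /= => /andP[xz _].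
  by apply: cF; exact: lt_le_trans xz.
move=> c; rewrite in_itv /= => /andP[xc _] FE.
by rewrite -subr_gt0 FE mulr_gt0 ?subr_gt0 // F'_gt0 // (lt_trans x0).
Qed.

Lemma subst_gt0 x : 0 < x -> 0 < F x.
Proof.
move=> x0; have x20 : 0 < x / 2 by rewrite divr_gt0.
have x2x : x / 2 < x by rewrite ltr_pdivrMr //; lra.
apply: le_lt_trans (F_incr x20 x2x).
apply: (cvgr_to_le F0); near=> z.
by apply/ltW/F_incr; near: z; [exact: nbhs_right_gt|exact: nbhs_right_lt].
Unshelve. all: by end_near. Qed.

Let F_exhaust y : 0 < y -> exists n, F (uinv n) <= y <= F (vnat n).
Proof.
move=> y0.
have h1 : \forall n \near \oo, F (uinv n) < y.
  exact: (cvgr_lt _ (at_right_uinv F0)).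
have h2 : \forall n \near \oo, y <= F (vnat n).
  have /cvgryPge := cvg_comp _ _ (@vnat_cvgy R) Fy; exact.
near \oo => n; exists n; apply/andP; split; last by near: n.
by apply: ltW; near: n.
Unshelve. all: by end_near. Qed.

Lemma itv_subst a b : 0 < a -> a < b ->
  (\int[mu]_(x in `[F a, F b]) (G x)%:E =
   \int[mu]_(x in `[a, b]) (G (F x) * F' x)%:E)%E.
Proof.
move=> a0 ab.
have F'E x : 0 < x -> F^`()%classic x = F' x.
  by move=> x0; rewrite derive1E; have [_ ->] := dF x0.
have cdF x : 0 < x -> {for x, continuous (F^`()%classic)}.
  move=> x0; have := cF' x0; rewrite /prop_for /continuous_at F'E //.
  apply: cvg_trans; apply: near_eq_cvg; near=> z; rewrite F'E //.
  by near: z; exact: lt_nbhsr.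
rewrite (@integration_by_substitution_increasing _ F G a b) ?ltW //.
- apply: eq_integral => x; rewrite inE /= in_itv /= => /andP[ax _].
  by rewrite !fctE F'E // (lt_le_trans a0).
- move=> x y; rewrite !in_itv /= => /andP[ax _] _; apply: F_incr.
  exact: lt_le_trans ax.
- by move=> x; rewrite in_itv /= => /andP[ax _]; apply: cdF; exact: lt_trans ax.
- apply/cvg_ex; exists (F^`()%classic a); apply: cvg_at_right_filter; exact: cdF.
- apply/cvg_ex; exists (F^`()%classic b); apply: cvg_at_left_filter; apply: cdF; exact: lt_trans ab.
- split.
  + by move=> x; rewrite in_itv /= => /andP[ax _]; have [] := dF (lt_trans a0 ax).
  + by apply: cvg_at_right_filter; apply: cF.
  + by apply: cvg_at_left_filter; apply: cF; exact: lt_trans ab.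
- apply: continuous_in_subspaceT => x; rewrite inE /= in_itv /= => /andP[ax _].
  by apply: cG; apply: lt_le_trans ax; exact: subst_gt0.
Unshelve. all: by end_near. Qed.

Lemma continuous_subst x : 0 < x -> {for x, continuous (fun x => G (F x) * F' x)}.
Proof.
move=> x0; apply: cvgM; last exact: cF'.
by apply: continuous_comp; [exact: cF|apply: cG; exact: subst_gt0].
Qed.

(** Both sides are limits of the same integrals over the intervals from [F (uinv n)] to
    [F (vnat n)]: these exhaust the half-line, and their preimages do so too. *)
Lemma ge0_hl_subst : (forall x, 0 < x -> 0 <= G x) ->
  (\int[mu]_(x in hl) (G x)%:E = \int[mu]_(x in hl) (G (F x) * F' x)%:E)%E.
Proof.
move=> G0.
have mG := measurable_continuous_hl cG.
have h1 : (\int[mu]_(x in `[F (uinv n), F (vnat n)]) (G x)%:E)%E @[n --> \oo] -->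
    (\int[mu]_(x in hl) (G x)%:E)%E.
  apply: ge0_hl_exhaustion => //.
  - by move=> n; apply: subst_gt0; exact: uinv_gt0.
  - move=> m n /(@uinv_ni R); rewrite le_eqVlt => /predU1P[->//|h].
    by apply/ltW/F_incr => //; exact: uinv_gt0.
  - move=> m n /(@vnat_nd R); rewrite le_eqVlt => /predU1P[->//|h].
    by apply/ltW/F_incr => //; apply: lt_trans (uinv_gt0 m) (uinv_vnat m).
have h2 : (\int[mu]_(x in `[F (uinv n), F (vnat n)]) (G x)%:E)%E @[n --> \oo] -->
    (\int[mu]_(x in hl) (G (F x) * F' x)%:E)%E.
  have -> : (fun n => \int[mu]_(x in `[F (uinv n), F (vnat n)]) (G x)%:E)%E =
      (fun n => \int[mu]_(x in `[uinv n, vnat n]) (G (F x) * F' x)%:E)%E.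
    by apply/funext => n; apply: itv_subst; [exact: uinv_gt0|exact: uinv_vnat].
  apply: ge0_hl_cvg; first exact: measurable_continuous_hl continuous_subst.
  move=> x x0; rewrite mulr_ge0 //; first by apply: G0; exact: subst_gt0.
  exact/ltW/F'_gt0.
exact: (cvg_unique _ h1 h2).
Qed.

End nonnegative.

Section signed.
Variables (F F' G : R -> R).
Hypothesis dF : forall x, 0 < x -> is_derive x 1 F (F' x).
Hypothesis F'_gt0 : forall x, 0 < x -> 0 < F' x.
Hypothesis cF' : forall x, 0 < x -> {for x, continuous F'}.
Hypothesis F0 : F x @[x --> 0^'+] --> (0 : R).
Hypothesis Fy : F x @[x --> +oo%R] --> (+oo : set_system R).
Hypothesis cG : forall x, 0 < x -> {for x, continuous G}.

(** The nonnegative case is applied to |G| + G and to |G|, both of which are continuous. *)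
Lemma hl_subst : hlintegrable G ->
  hlintegrable (fun x => G (F x) * F' x) /\
  hlint G = hlint (fun x => G (F x) * F' x).
Proof.
move=> intG.
have intn : hlintegrable (fun x => `|G x|) by exact: integrable_norm.
have cn x : 0 < x -> {for x, continuous (fun x => `|G x|)}.
  by move=> x0; apply: continuous_comp; [exact: cG|exact: norm_continuous].
have key g : (forall x, 0 < x -> {for x, continuous g}) ->
    (forall x, 0 < x -> 0 <= g x) -> hlintegrable g ->
    hlintegrable (fun x => g (F x) * F' x) /\
    hlint g = hlint (fun x => g (F x) * F' x).
  move=> cg g0 intg.
  have h := ge0_hl_subst dF F'_gt0 cF' F0 Fy cg g0.
  split; last by rewrite /hlint /Rintegral h.
  apply: ge0_hlintegrable.
  - by apply: measurable_continuous_hl => x x0; apply: (continuous_subst dF F'_gt0 cF' F0 cg).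
  - move=> x x0; apply: mulr_ge0; last exact/ltW/F'_gt0.
    by apply: g0; exact: (subst_gt0 dF F'_gt0 F0).
  - by rewrite -h hlint_fin // ltry.
have GE : G = fun x => (`|G x| + G x) - `|G x| by apply/funext => x; ring.
have [] := key _ cn _ intn => // i1 e1.
have intp : hlintegrable (fun x => `|G x| + G x) by exact: hlintegrableD.
have [] := key (fun x => `|G x| + G x) _ _ intp.
- by move=> x x0; apply: cvgD; [exact: cn|exact: cG].
- by move=> x _; have := ler_norm (- G x); rewrite normrN; lra.
move=> i2 e2.
have E x : G (F x) * F' x = (`|G (F x)| + G (F x)) * F' x - `|G (F x)| * F' x.
  by ring.
split.
  apply: (@eq_hlintegrable _ (fun x => (`|G (F x)| + G (F x)) * F' x - `|G (F x)| * F' x)) => //.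
  exact: hlintegrableB.
rewrite [in LHS]GE hlintB // e1 e2 -hlintB //.
by apply: eq_hlint.
Qed.
End signed.
End Subst.

(** * Fubini on the quadrant *)

Section Fubini.
Context {R : realType}.
Notation mu := (@lebesgue_measure R).
Notation T := (measurableTypeR R).
Implicit Types (H : R -> R -> R) (f g : R -> R) (x y : R).

(** Restriction by indicator factors, so that the theorems of Fubini and Tonelli can be used on the
    whole plane; the values of [H] off the quadrant do not matter. *)
Definition quadrant H (z : T * T) : R := \1_hl z.1 * \1_hl z.2 * H z.1 z.2.

Definition measurable2 H := measurable_fun setT (fun z : T * T => H z.1 z.2).

Lemma measurable_quadrant H : measurable2 H -> measurable_fun setT (quadrant H).
Proof.
move=> mH; apply: measurable_funM => //; apply: measurable_funM.
- by apply: measurableT_comp => //; exact: measurable_indic measurable_hl.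
- by apply: measurableT_comp => //; exact: measurable_indic measurable_hl.
Qed.

Lemma measurable2_fst f : measurable_fun setT f -> measurable2 (fun x _ => f x).
Proof. by move=> mf; apply: (measurableT_comp (f := f : T -> R)). Qed.

Lemma measurable2_snd f : measurable_fun setT f -> measurable2 (fun _ y => f y).
Proof. by move=> mf; apply: (measurableT_comp (f := f : T -> R)). Qed.

Lemma measurable2_section H x : measurable2 H -> measurable_fun setT (H x).
Proof. by move=> mH; exact: (measurableT_comp mH (measurable_pair1 x)). Qed.

Lemma measurable2_swap H : measurable2 H -> measurable2 (fun x y => H y x).
Proof.
move=> mH.
have := measurableT_comp mH (@measurable_swap _ _ T T); exact.
Qed.

Lemma indic_hl x : 0 < x -> \1_hl x = 1 :> R.
Proof. by move=> x0; rewrite indicE mem_set // hlE. Qed.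

Lemma indic_hlN x : ~ 0 < x -> \1_hl x = 0 :> R.
Proof. by move=> x0; rewrite indicE memNset // hlE. Qed.

Lemma normr_indic_hl x : `|\1_hl x| = \1_hl x :> R.
Proof. by rewrite indicE ger0_norm. Qed.

Lemma integral_hl (f : R -> R) :
  (\int[mu]_x (\1_hl x * f x)%:E = \int[mu]_(x in hl) (f x)%:E)%E.
Proof.
rewrite [RHS]integral_mkcond; apply: eq_integral => x _.
rewrite patchE indicE; case: (x \in hl); rewrite ?mul1r ?mul0r //.
Qed.

Lemma integral_hlE (f : R -> \bar R) :
  (\int[mu]_x ((\1_hl x)%:E * f x) = \int[mu]_(x in hl) f x)%E.
Proof.
rewrite [RHS]integral_mkcond; apply: eq_integral => x _.
by rewrite patchE indicE; case: (x \in hl); rewrite ?mul1e ?mul0e.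
Qed.

Lemma quadrant_section H x :
  (\int[mu]_y (quadrant H (x, y))%:E =
   (\1_hl x)%:E * \int[mu]_(y in hl) (H x y)%:E)%E.
Proof.
have [x0|x0] := pselect (0 < x).
  rewrite indic_hl // mul1e -integral_hl; apply: eq_integral => y _.
  by rewrite /quadrant /= indic_hl // mul1r.
rewrite indic_hlN // mul0e; apply: integral0_eq => y _.
by rewrite /quadrant /= indic_hlN // !mul0r.
Qed.

Lemma quadrant_section' H y :
  (\int[mu]_x (quadrant H (x, y))%:E =
   (\1_hl y)%:E * \int[mu]_(x in hl) (H x y)%:E)%E.
Proof.
rewrite -(quadrant_section (fun x y => H y x)); apply: eq_integral => x _.
by rewrite /quadrant /= [\1_hl x * _]mulrC.
Qed.

Section tonelli.
Variable H : R -> R -> R.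
Hypothesis mH : measurable2 H.
Hypothesis H0 : forall x y, 0 < x -> 0 < y -> 0 <= H x y.

Lemma quadrant_ge0 z : 0 <= quadrant H z.
Proof.
case: z => x y; rewrite /quadrant /=.
have [x0|x0] := pselect (0 < x); last by rewrite indic_hlN // !mul0r.
have [y0|y0] := pselect (0 < y); last by rewrite (indic_hlN y0) mulr0 !mul0r.
by rewrite !indic_hl // !mul1r H0.
Qed.

Lemma tonelli_hl1 : (\int[mu \x mu]_z (quadrant H z)%:E =
  \int[mu]_(x in hl) \int[mu]_(y in hl) (H x y)%:E)%E.
Proof.
have m : measurable_fun setT (EFin \o quadrant H).
  apply/measurable_EFinP. exact: (measurable_quadrant mH).
have p z : (0 <= (EFin \o quadrant H) z)%E by rewrite lee_fin quadrant_ge0.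
apply: (etrans (fubini_tonelli1 _ m p)).
by under eq_integral do rewrite /fubini_F quadrant_section; rewrite integral_hlE.
Qed.

Lemma tonelli_hl2 : (\int[mu \x mu]_z (quadrant H z)%:E =
  \int[mu]_(y in hl) \int[mu]_(x in hl) (H x y)%:E)%E.
Proof.
have m : measurable_fun setT (EFin \o quadrant H).
  apply/measurable_EFinP. exact: (measurable_quadrant mH).
have p z : (0 <= (EFin \o quadrant H) z)%E by rewrite lee_fin quadrant_ge0.
apply: (etrans (fubini_tonelli2 _ m p)).
by under eq_integral do rewrite /fubini_G quadrant_section'; rewrite integral_hlE.
Qed.
End tonelli.

Section fubini.
Variables (H : R -> R -> R) (f g : R -> R).
Hypothesis mH : measurable2 H.
Hypothesis (intf : hlintegrable f) (intg : hlintegrable g).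
Hypothesis Hfg : forall x y, 0 < x -> 0 < y -> `|H x y| <= f x * g y.

Lemma fubini_hl_section x : 0 < x -> hlintegrable (H x).
Proof.
move=> x0; apply: (@le_hlintegrable _ _ (fun y => f x * g y)).
- by apply: measurable_funTS; exact: measurable2_section.
- by move=> y y0; exact: Hfg.
- exact: hlintegrableZ.
Qed.

Lemma integrable_quadrant :
  (mu \x mu)%E.-integrable setT (EFin \o quadrant H).
Proof.
have mq := measurable_quadrant mH.
apply/integrable12ltyP; first exact/measurable_EFinP.
have nE x y : `|quadrant H (x, y)| = quadrant (fun x y => `|H x y|) (x, y).
  by rewrite /quadrant /= !normrM !normr_indic_hl.
under eq_integral do under eq_integral do rewrite /= nE.
under eq_integral do rewrite quadrant_section.
rewrite integral_hlE.
have mnH : measurable2 (fun x y => `|H x y|) by exact: measurableT_comp.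
apply: (@le_lt_trans _ _ (\int[mu]_(x in hl) (f x * hlint g)%:E)%E); last first.
  rewrite (_ : (fun x => _) = EFin \o (fun x => hlint g * f x)).
    by rewrite hlint_fin ?ltry //; exact: hlintegrableZ.
  by apply/funext => x /=; rewrite mulrC.
apply: ge0_le_integral => //.
- exact: measurable_hl.
- by move=> x _; apply: integral_ge0.
(* The integral over [y] is measurable in [x] because it is a partial integral of a nonnegative
   function that is measurable on the plane. *)
- rewrite (_ : (fun x => _) = fubini_F mu (fun z => (\1_hl z.2 * `|H z.1 z.2|)%:E)).
    apply: measurable_funTS; apply: measurable_fun_fubini_tonelli_F.
      apply/measurable_EFinP; apply: measurable_funM => //.
      by apply: measurableT_comp => //; exact: measurable_indic measurable_hl.
    by move=> z; rewrite lee_fin mulr_ge0 // indicE.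
  by apply/funext => x; rewrite /fubini_F integral_hl.
- apply/measurable_EFinP; apply: measurable_funM => //.
  exact: hlintegrable_measurable.
- move=> x; rewrite hlE => x0.
  have intn : hlintegrable (fun y => `|H x y|).
    exact/integrable_norm/fubini_hl_section.
  rewrite hlint_fin // lee_fin -hlintZ //; apply: le_hlint => //.
    exact: hlintegrableZ.
  by move=> y y0; exact: Hfg.
Qed.

(** Domination by a product [f x * g y] makes [H] integrable on the quadrant. The integrability of
    the partial integral is stated too, since it is added to other integrable terms later. *)
Lemma fubini_hl : hlintegrable (fun x => hlint (H x)) /\
  hlint (fun x => hlint (H x)) = hlint (fun y => hlint (H^~ y)).
Proof.
have intq := integrable_quadrant.
have FE x : fubini_F mu (EFin \o quadrant H) x = (\1_hl x * hlint (H x))%:E.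
  rewrite /fubini_F quadrant_section EFinM.
  have [x0|x0] := pselect (0 < x); last by rewrite indic_hlN // !mul0e.
  by rewrite hlint_fin //; exact: fubini_hl_section.
have GE y : fubini_G mu (EFin \o quadrant H) y = (\1_hl y * hlint (H^~ y))%:E.
  rewrite /fubini_G quadrant_section' EFinM.
  have [y0|y0] := pselect (0 < y); last by rewrite indic_hlN // !mul0e.
  rewrite hlint_fin //; apply: (@le_hlintegrable _ _ (fun x => g y * f x)).
  - by apply: measurable_funTS; exact: measurable2_section (measurable2_swap mH).
  - by move=> x x0; rewrite mulrC; exact: Hfg.
  - exact: hlintegrableZ.
split.
  have h : mu.-integrable setT (fun x => (\1_hl x * hlint (H x))%:E).
    by apply: eq_integrable (integrable_fubini_F intq) => // x _; exact: FE.
  apply: (@eq_hlintegrable _ (fun x => \1_hl x * hlint (H x))).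
    by move=> x x0; rewrite indic_hl // mul1r.
  by apply: integrableS h => //; exact: measurable_hl.
rewrite /hlint /Rintegral -!integral_hl; congr fine.
transitivity (\int[mu]_x fubini_F mu (EFin \o quadrant H) x)%E.
  by apply: eq_integral => x _; rewrite FE.
transitivity (\int[mu]_x fubini_G mu (EFin \o quadrant H) x)%E.
  exact: Fubini intq.
by apply: eq_integral => x _; rewrite GE.
Qed.

End fubini.
End Fubini.

(** * Euler beta integrals on the half-line *)

Section Powers.
Context {R : realType}.
Notation mu := (@lebesgue_measure R).
Implicit Types (f g F : R -> R) (x y s t : R).

Lemma powRDp x a b : 0 < x -> x `^ (a + b) = x `^ a * x `^ b.
Proof. by move=> x0; rewrite powRD // (gt_eqF x0) implybT. Qed.

(** The integral of [f] over a compact interval is a difference of two values of [F], hence at most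
    [2 C], and monotone convergence carries this bound to the half-line. *)
Lemma ge0_hl_bounded f F C :
  (forall x, 0 < x -> is_derive x 1 F (f x)) ->
  (forall x, 0 < x -> {for x, continuous f}) ->
  (forall x, 0 < x -> 0 <= f x) -> (forall x, 0 < x -> `|F x| <= C) ->
  hlintegrable f.
Proof.
move=> dF cf f0 FC.
have mf := measurable_continuous_hl cf.
apply: ge0_hlintegrable => //.
apply: (@le_lt_trans _ _ (C + C)%:E); last exact: ltry.
apply: (cvge_to_le (ge0_hl_cvg mf f0)); near=> n.
have u0 := @uinv_gt0 R n; have uv := @uinv_vnat R n.
rewrite (FTC_itv u0 uv dF) // lee_fin.
have := FC _ u0; have := FC _ (lt_trans u0 uv); rewrite !ler_norml; lra.
Unshelve. all: by end_near. Qed.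

Lemma continuous_powR x a : 0 < x -> {for x, continuous (fun x => x `^ a)}.
Proof. by move=> x0; apply: is_derive_continuous (is_derive1_powR a x0). Qed.

Lemma is_derive1D x : is_derive x 1 (fun y => 1 + y) 1.
Proof.
by have := is_deriveD (is_derive_cst (1 : R) x 1) (is_derive_id x 1); rewrite add0r.
Qed.

Lemma is_derive_powR1D x a : 0 < x ->
  is_derive x 1 (fun x => (1 + x) `^ a) (a * (1 + x) `^ (a - 1)).
Proof.
move=> x0.
have x1 : 0 < 1 + x by lra.
have d1 := is_derive1D x.
have := @is_derive1_comp _ (fun x => x `^ a) _ _ _ _ (is_derive1_powR a x1) d1.
by rewrite mulr1.
Qed.

Lemma continuous_powR1D x a : 0 < x -> {for x, continuous (fun x => (1 + x) `^ a)}.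
Proof. by move=> x0; apply: is_derive_continuous (is_derive_powR1D a x0). Qed.

(** The integrand of Euler's beta function on the half-line: its integral [beta_int s t] is B(1 - s,
    s + t - 1). *)
Definition pw s t x := x `^ (- s) * (1 + x) `^ (- t).

Lemma pw_gt0 s t x : 0 < x -> 0 < pw s t x.
Proof. by move=> x0; rewrite mulr_gt0 ?powR_gt0 //; lra. Qed.

Lemma pw_ge0 s t x : 0 < x -> 0 <= pw s t x.
Proof. by move=> x0; exact/ltW/pw_gt0. Qed.

Lemma continuous_pw s t x : 0 < x -> {for x, continuous (pw s t)}.
Proof. by move=> x0; apply: cvgM; [exact: continuous_powR|exact: continuous_powR1D]. Qed.

Lemma is_derive_pw s t x : 0 < x -> is_derive x 1 (pw s t)
  (- s * pw (s + 1) t x - t * pw s (t + 1) x).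
Proof.
move=> x0.
have h := @is_deriveM _ _ (fun x => x `^ (- s)) (fun x => (1 + x) `^ (- t))
  _ _ _ _ (is_derive1_powR (- s) x0) (is_derive_powR1D (- t) x0).
by apply: (is_derive_eq h); rewrite /pw /= !opprD /GRing.scale /=; ring.
Qed.

Lemma le_pw2 (z r : R) : 1 <= z <= 2 -> z `^ r <= 2 `^ `|r|.
Proof.
move=> /andP[z1 z2].
apply: (@le_trans _ _ (z `^ `|r|)); first by apply: ler_powR => //; exact: ler_norm.
by apply: ge0_ler_powR; rewrite ?nnegrE //; lra.
Qed.

Lemma pw_mulx s t x : 0 < x -> pw (s - 1) t x = x * pw s t x.
Proof. by move=> x0; rewrite /pw opprB addrC powRDp // powRr1 ?(ltW x0) //; ring. Qed.

Lemma pw_mul1x s t x : 0 < x -> pw s (t - 1) x = (1 + x) * pw s t x.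
Proof.
move=> x0; have x1 : 0 < 1 + x by lra.
by rewrite /pw opprB powRDp // powRr1 ?(ltW x1) //; ring.
Qed.

Lemma pw_mul1xX s t r x : 0 < x -> pw s t x = pw s (t + r) x * (1 + x) `^ r.
Proof.
move=> x0; have x1 : 0 < 1 + x by lra.
by rewrite /pw -mulrA -powRDp // opprD subrK.
Qed.

(** Two cases have bounded primitives: x^-s (1 + x)^(s-2) comes from (x / (1 + x))^(1-s), and (1 +
    x)^-(s+t) from -(1 + x)^(1-s-t). The first dominates on ]0, 1], the second on [1, +oo[. *)
Lemma hlintegrable_pw s t : s < 1 -> 1 < s + t -> hlintegrable (pw s t).
Proof.
move=> s1 st.
have i1 : hlintegrable (pw s (2 - s)).
  apply: (@eq_hlintegrable _ (fun x => (1 - s)^-1 * ((1 - s) * pw s (2 - s) x))).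
    by move=> x _; rewrite mulrA mulVf ?mul1r // subr_eq0 gt_eqF.
  apply: hlintegrableZ.
  apply: (@ge0_hl_bounded _ (pw (s - 1) (1 - s)) 1).
  - move=> x x0; apply: (is_derive_eq (is_derive_pw _ _ x0)).
    have -> : 1 - s + 1 = 2 - s by lra.
    have := pw_mul1x s (2 - s) x0; rewrite (_ : 2 - s - 1 = 1 - s); last lra.
    by rewrite subrK pw_mulx // => ->; ring.
  - move=> x x0; apply: cvgM; [exact: cvg_cst|exact: continuous_pw].
  - by move=> x x0; rewrite mulr_ge0 ?pw_ge0 //; lra.
  - move=> x x0; rewrite ger0_norm ?pw_ge0 // /pw !opprB.
    have x1 : 0 < 1 + x by lra.
    rewrite -(opprB 1 s) powRN ler_pdivrMr ?powR_gt0 // mul1r.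
    by apply: ge0_ler_powR; rewrite ?nnegrE; lra.
have i2 : hlintegrable (pw 0 (s + t)).
  pose c := s + t - 1; have c0 : 0 < c by rewrite /c; lra.
  apply: (@eq_hlintegrable _ (fun x => c^-1 * (c * pw 0 (s + t) x))).
    by move=> x _; rewrite mulrA mulVf ?mul1r // gt_eqF.
  apply: hlintegrableZ.
  apply: (@ge0_hl_bounded _ (fun x => - pw 0 c x) 1).
  - move=> x x0; have h := is_deriveN (is_derive_pw 0 c x0).
    apply: (is_derive_eq h).
    have -> : c + 1 = s + t by rewrite /c subrK.
    by ring.
  - move=> x x0; apply: cvgM; [exact: cvg_cst|exact: continuous_pw].
  - by move=> x x0; rewrite mulr_ge0 ?pw_ge0 // ltW.
  - move=> x x0; rewrite normrN ger0_norm ?pw_ge0 // /pw oppr0 powRr0 mul1r.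
    rewrite -[leRHS](powRr0 (1 + x)); apply: ler_powR; lra.
apply: (@le_hlintegrable _ _ (fun x => (2 `^ `|2 - s - t| + 2 `^ `|s|) * (pw s (2 - s) x + pw 0 (s + t) x))).
- by apply: measurable_continuous_hl => x; exact: continuous_pw.
- move=> x x0; rewrite ger0_norm ?pw_ge0 //.
  have p1 := pw_gt0 s (2 - s) x0; have p2 := pw_gt0 0 (s + t) x0.
  have c1 : 0 <= 2 `^ `|2 - s - t| :> R by exact: powR_ge0.
  have c2 : 0 <= 2 `^ `|s| :> R by exact: powR_ge0.
  (* The quotient of [pw s t x] by the dominating function is a power of 1 + x in the first case and
     of (1 + x) / x in the second; both bases lie between 1 and 2. *)
  have [x1|x1] := leP x 1.
    apply: (@le_trans _ _ (2 `^ `|2 - s - t| * pw s (2 - s) x)); last by nra.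
    rewrite (pw_mul1xX s t (2 - s - t) x0) (_ : t + (2 - s - t) = 2 - s); last lra.
    by rewrite mulrC ler_pM2r // le_pw2 //; lra.
  apply: (@le_trans _ _ (2 `^ `|s| * pw 0 (s + t) x)); last by nra.
  rewrite (_ : pw s t x = ((1 + x) / x) `^ s * pw 0 (s + t) x).
    rewrite ler_pM2r // le_pw2 // ler_pdivlMr // ler_pdivrMr //; lra.
  rewrite /pw oppr0 powRr0 mul1r powRM ?invr_ge0 ?ltW //; last lra.
  rewrite -powR_inv1 ?ltW // -powRrM mulN1r mulrAC -powRDp; last lra.
  by rewrite mulrC; congr (_ `^ _ * _); lra.
- by apply: hlintegrableZ; exact: hlintegrableD.
Qed.

Lemma cvg_powR_pinfty e : 0 < e -> x `^ (- e) @[x --> +oo%R] --> (0 : R).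
Proof.
move=> e0; apply/cvgrPdist_lt => d d0; near=> x.
have x0 : 0 < x by near: x; exact: nbhs_pinfty_gt.
rewrite sub0r normrN ger0_norm ?powR_ge0 //.
have -> : d = (d `^ (- e^-1)) `^ (- e).
  by rewrite -powRrM mulrNN mulVf ?gt_eqF // powRr1 // ltW.
rewrite powRN [ltRHS]powRN ltf_pV2 ?posrE ?powR_gt0 //.
apply: gt0_ltr_powR => //; rewrite ?nnegrE ?powR_ge0 ?ltW //.
Unshelve. all: by end_near. Qed.

Lemma cvg_pw_at0 s t : s < 1 -> pw (s - 1) t x @[x --> 0^'+] --> (0 : R).
Proof.
move=> s1; rewrite -[X in _ --> X](mul0r ((1 + 0) `^ (- t) : R)) /pw opprB.
apply: cvgM; first by apply: powR_cvg0; lra.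
apply: cvg_at_right_filter.
have h : {for 1 + 0, continuous (fun x : R => x `^ (- t))}.
  by apply: continuous_powR; lra.
exact: (@continuous_comp _ _ _ (fun x => 1 + x) (fun x => x `^ (- t)) 0
  (is_derive_continuous (is_derive1D 0)) h).
Qed.

Lemma cvg_pw_pinfty s t : s < 1 -> 1 < s + t ->
  pw (s - 1) t x @[x --> +oo%R] --> (0 : R).
Proof.
move=> s1 st; have e0 : 0 < s + t - 1 by lra.
apply: (squeeze_cvgr _ (cvg_cst 0) (cvg_powR_pinfty e0)).
near=> x.
have x0 : 0 < x by near: x; exact: nbhs_pinfty_gt.
have x1 : 0 < 1 + x by lra.
rewrite pw_ge0 //=.
apply: (@le_trans _ _ ((1 + x) `^ (- (s + t - 1)))).
  rewrite (_ : - (s + t - 1) = - (s - 1) + - t); last lra.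
  rewrite powRDp // /pw ler_pM2r ?powR_gt0 // opprB.
  by apply: ge0_ler_powR; rewrite ?nnegrE; lra.
rewrite !powRN lef_pV2 ?posrE ?powR_gt0 //.
by apply: ge0_ler_powR; rewrite ?nnegrE; lra.
Unshelve. all: by end_near. Qed.

Definition beta_int s t := hlint (pw s t).

(** Integrate the derivative of x^(1-s) (1 + x)^-t, which vanishes at both ends. This recurrence
    produces the Pochhammer quotients. *)
Lemma beta_int_rec s t : s < 1 -> 1 < s + t ->
  t * beta_int s (t + 1) = (s + t - 1) * beta_int s t.
Proof.
move=> s1 st.
have i1 := hlintegrable_pw s1 st.
have i2 : hlintegrable (pw s (t + 1)) by apply: hlintegrable_pw => //; lra.
pose f x := t * pw s (t + 1) x - (s + t - 1) * pw s t x.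
have intf : hlintegrable f by apply: hlintegrableB; exact: hlintegrableZ.
have lim0 := cvg_pw_at0 t s1; have limy := cvg_pw_pinfty s1 st.
have dF x : 0 < x -> is_derive x 1 (pw (s - 1) t) (f x).
  move=> x0; apply: (is_derive_eq (is_derive_pw (s - 1) t x0)).
  have := pw_mul1x s (t + 1) x0; rewrite addrK => e.
  by rewrite /f subrK pw_mulx // e; ring.
have cf x : 0 < x -> {for x, continuous f}.
  by move=> x0; apply: cvgB; apply: cvgM;
    [exact: cvg_cst|exact: continuous_pw|exact: cvg_cst|exact: continuous_pw].
have := hl_FTC dF cf intf lim0 limy.
rewrite subrr /f hlintB; [|exact: hlintegrableZ..].
by rewrite (hlintZ t i2) (hlintZ (s + t - 1) i1) => /subr0_eq.
Qed.

(** The integral is at least the minimum of [f] on [1, 2], an interval of length 1. *)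
Lemma hlint_gt0 f : (forall x, 0 < x -> {for x, continuous f}) ->
  (forall x, 0 < x -> 0 < f x) -> hlintegrable f -> 0 < hlint f.
Proof.
move=> cf f0 intf.
have sub : `[1, 2] `<=` (@hl R).
  by move=> x /=; rewrite hlE in_itv /= => /andP[+ _]; lra.
have c12 : {within `[1, 2], continuous f}.
  apply: continuous_in_subspaceT => x; rewrite inE /= in_itv /= => /andP[x1 _].
  by apply: cf; lra.
have le12 : 1 <= 2 :> R by lra.
have [c c_in cmin] := EVT_min le12 c12.
have c0 : 0 < f c by apply: f0; move: c_in; rewrite in_itv /= => /andP[+ _]; lra.
apply: (lt_le_trans c0); rewrite -lee_fin -hlint_fin //.
have mf := hlintegrable_measurable intf.
apply: (@le_trans _ _ (\int[mu]_(x in `[1%R, 2%R]) (f x)%:E)%E); last first.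
  apply: ge0_subset_integral => //; [exact: measurable_hl|exact/measurable_EFinP|].
  by move=> x; rewrite hlE lee_fin => /f0 /ltW.
apply: (@le_trans _ _ (\int[mu]_(x in `[1%R, 2%R]) (f c)%:E)%E).
  rewrite integral_cst //= lebesgue_measure_itv /= lte_fin ltrDl ltr01 -EFinD.
  by rewrite addrK mule1.
apply: ge0_le_integral => //.
- by move=> x _; rewrite lee_fin ltW.
- by apply/measurable_EFinP; exact: (measurable_funS measurable_hl sub mf).
Qed.

Lemma beta_int_gt0 s t : s < 1 -> 1 < s + t -> 0 < beta_int s t.
Proof.
move=> s1 st; apply: hlint_gt0; last exact: hlintegrable_pw.
- by move=> x; exact: continuous_pw.
- by move=> x; exact: pw_gt0.
Qed.

(* x^a (1 + x)^-2 = x^(a-1) ((1 + x)^-1 - (1 + x)^-2) *)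
Lemma beta_int_shift (a : R) : 0 < a -> a < 1 ->
  beta_int (- a) 2 = a * beta_int (1 - a) 1.
Proof.
move=> a0 a1.
have i1 : hlintegrable (pw (1 - a) 1) by apply: hlintegrable_pw; lra.
have i2 : hlintegrable (pw (1 - a) (1 + 1)) by apply: hlintegrable_pw; lra.
have s1 : 1 - a < 1 by lra.
have st : 1 < 1 - a + 1 by lra.
have := beta_int_rec s1 st; rewrite mul1r addrK => e.
have -> : a * beta_int (1 - a) 1 = beta_int (1 - a) 1 - (1 - a) * beta_int (1 - a) 1.
  by ring.
rewrite -e -hlintB //; apply: eq_hlint => x x0.
have -> : pw (- a) 2 x = pw (1 - a - 1) (1 + 1) x by rewrite addrAC subrr add0r.
by have := pw_mul1x (1 - a) (1 + 1) x0; rewrite addrK pw_mulx // => ->; ring.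
Qed.

End Powers.

(** * Stieltjes transforms of powers *)

Section Under.
Context {R : realType}.
Notation mu := (@lebesgue_measure R).

Lemma is_derive_under_hlint (f f' : R -> R -> R) (G : R -> R) (a u v : R) :
  u < a < v ->
  (forall r, u < r < v -> hlintegrable (f r)) ->
  (forall r x, u < r < v -> 0 < x -> is_derive r 1 (f^~ x) (f' r x)) ->
  hlintegrable G ->
  (forall r x, u < r < v -> 0 < x -> `|f' r x| <= G x) ->
  is_derive a 1 (fun r => hlint (f r)) (hlint (f' a)).
Proof.
move=> uav intf df intG fG.
have I r : `]u, v[%classic r -> u < r < v by rewrite /= in_itv.
have dfE r x : u < r < v -> 0 < x -> partial1of2 f r x = f' r x.
  by move=> r_in x0; rewrite partial1of2E; have [_ ->] := df r x r_in x0.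
(* The dominating function must be nonnegative at every real, whereas [G] is controlled on the
   half-line only; hence its absolute value. *)
have h := @cvg_differentiation_under_integral R _ _ mu f hl (@measurable_hl R) a u v _ _ _
  (fun x => `|G x|) _ _ _.
have {}h : h^-1 *: (hlint (f (h + a)) - hlint (f a)) @[h --> 0^'] --> hlint (f' a).
  rewrite -(@eq_hlint _ (partial1of2 f a) (f' a)); last by move=> x x0; rewrite dfE.
  apply: h.
  - by rewrite /= in_itv.
  - by move=> r /I /intf.
  - by move=> r x /I r_in; rewrite hlE => x0; case: (df r x r_in x0).
  - by move=> x; exact: normr_ge0.
  - exact: integrable_norm.
  - move=> r x /I r_in; rewrite hlE => x0; rewrite dfE //.
    by apply: (le_trans (fG _ _ r_in x0)); exact: ler_norm.
split; first by apply/cvg_ex; exists (hlint (f' a)); under eq_fun do rewrite scaler1.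
apply/cvg_lim => //; rewrite /derive.
by under eq_fun do rewrite scaler1.
Qed.

Lemma squeeze_norm (T : Type) (F : set_system T) (FF : Filter F) (f g : T -> R) (C : R) :
  (\forall x \near F, `|f x| <= C * g x) -> g @ F --> (0 : R) -> f @ F --> (0 : R).
Proof.
move=> fg g0; apply: norm_cvg0.
have h : (fun x => C * g x) @ F --> (0 : R).
  by rewrite -[X in _ --> X](mulr0 C); exact: cvgM (cvg_cst C) g0.
apply: (squeeze_cvgr _ (cvg_cst 0) h); near=> x; rewrite /= normr_ge0 /=; by near: x.
Unshelve. all: by end_near. Qed.

End Under.

Section Resolvent.
Context {R : realType}.
Implicit Types (p b x : R).

(* With q = p + i b and v = v1 + i v2 these are |x + q|^2, Re (v / (x + q)) and
   Re (v / (x + q)^2). *)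
Definition den p b x : R := (x + p) ^+ 2 + b ^+ 2.
Definition res1 (v1 v2 : R) p b x : R := (v1 * (x + p) + v2 * b) / den p b x.
Definition res2 (v1 v2 : R) p b x : R :=
  (v1 * ((x + p) ^+ 2 - b ^+ 2) + v2 * (2 * (x + p) * b)) / den p b x ^+ 2.

Variables (p b d : R).
Hypothesis d0 : 0 < d.
Hypothesis den_lb : forall x, 0 < x -> d * (1 + x) ^+ 2 <= den p b x.

Lemma den_gt0 x : 0 < x -> 0 < den p b x.
Proof. by move=> x0; apply: lt_le_trans (den_lb x0); rewrite mulr_gt0 // exprn_gt0 //; lra. Qed.

Lemma is_derive_den x : is_derive x 1 (den p b) (2 * (x + p)).
Proof.
have h : is_derive x 1 (id + cst p) 1 by apply: is_derive_eq; rewrite addr0.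
have h2 := @is_deriveD _ _ _ _ _ _ _ _ _ (@is_deriveX _ _ _ 2 _ _ _ h) (is_derive_cst (b ^+ 2) x 1).
by apply: (is_derive_eq h2); rewrite /GRing.scale !fctE /=; ring.
Qed.

Lemma is_derive_res1 (v1 v2 : R) x : 0 < x ->
  is_derive x 1 (res1 v1 v2 p b) (- res2 v1 v2 p b x).
Proof.
move=> x0; have D0 := den_gt0 x0.
have h1 : is_derive x 1 (cst v1 * (id + cst p) + cst (v2 * b)) v1.
  by apply: is_derive_eq; rewrite /GRing.scale /=; ring.
have h2 := @is_deriveV _ (den p b) x _ _ (lt0r_neq0 D0) (is_derive_den x).
have h := is_deriveM h1 h2.
apply: (is_derive_eq h); rewrite /res2 /GRing.scale !fctE /=.
have : den p b x != 0 by rewrite gt_eqF.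
rewrite /den => D; field.
by rewrite D.
Qed.

Lemma norm_res1 (v1 v2 : R) x : 0 < x ->
  `|res1 v1 v2 p b x| <= (`|v1| + `|v2|) * (1 + d^-1) * (1 + x) `^ (-1).
Proof.
move=> x0; have D0 := den_gt0 x0; have x1 : 0 < 1 + x by lra.
rewrite powR_inv1 ?(ltW x1) // /res1 normf_div [`|den _ _ _|]gtr0_norm //.
rewrite ler_pdivrMr // mulrAC ler_pdivlMr //.
have lb := den_lb x0.
(* By the inequality of the means |y| (1 + x) is at most y^2 + (1 + x)^2, and [den_lb] bounds the
   second square. It is used with y = x + p and y = b. *)
have key y : y ^+ 2 <= den p b x -> `|y| * (1 + x) <= (1 + d^-1) * den p b x.
  move=> yD.
  have h : (1 + x) ^+ 2 <= d^-1 * den p b x by rewrite mulrC ler_pdivlMr // mulrC.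
  have : `|y| ^+ 2 <= den p b x by rewrite real_normK ?num_real.
  by have := sqr_ge0 (`|y| - (1 + x)); nra.
have hA : (x + p) ^+ 2 <= den p b x by rewrite lerDl sqr_ge0.
have hb : b ^+ 2 <= den p b x by rewrite lerDr sqr_ge0.
apply: (@le_trans _ _ ((`|v1| * `|x + p| + `|v2| * `|b|) * (1 + x))).
  by rewrite ler_pM2r // (le_trans (ler_normD _ _)) // !normrM.
have kA := key _ hA; have kb := key _ hb.
have n1 := normr_ge0 v1; have n2 := normr_ge0 v2.
rewrite mulrDl -!mulrA mulrDl.
by apply: lerD; apply: ler_wpM2l.
Qed.

Lemma norm_res2 (v1 v2 : R) x : 0 < x ->
  `|res2 v1 v2 p b x| <= (`|v1| + `|v2|) * d^-1 * (1 + x) `^ (- 2).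
Proof.
move=> x0; have D0 := den_gt0 x0; have x1 : 0 < 1 + x by lra.
rewrite (powR_invn 2 (ltW x1)) /res2 normf_div [`|den _ _ _ ^+ 2|]gtr0_norm ?exprn_gt0 //.
have lb := den_lb x0.
apply: (@le_trans _ _ ((`|v1| + `|v2|) / den p b x)).
  rewrite ler_pdivrMr ?exprn_gt0 // [leRHS](_ : _ = (`|v1| + `|v2|) * den p b x); last first.
    by field; rewrite gt_eqF.
  rewrite [leRHS]mulrDl; apply: (le_trans (ler_normD _ _)).
  have h1 : `|(x + p) ^+ 2 - b ^+ 2| <= den p b x.
    by rewrite ler_norml /den; have := sqr_ge0 (x + p); have := sqr_ge0 b; lra.
  have h2 : `|2 * (x + p) * b| <= den p b x.
    rewrite ler_norml /den; have := sqr_ge0 (x + p + b); have := sqr_ge0 (x + p - b).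
    by rewrite !sqrrD sqrrN; nra.
  by apply: lerD; rewrite normrM; apply: ler_wpM2l.
rewrite -mulrA ler_wpM2l ?addr_ge0 // -invfM lef_pV2 ?posrE // mulr_gt0 //.
by rewrite exprn_gt0.
Qed.

Variable s : R.
Hypotheses (s0 : 0 < s) (s1 : s < 1).

Lemma continuous_res1 (v1 v2 : R) x : 0 < x -> {for x, continuous (res1 v1 v2 p b)}.
Proof. by move=> x0; apply: is_derive_continuous (is_derive_res1 v1 v2 x0). Qed.

Lemma continuous_res2 (v1 v2 : R) x : 0 < x -> {for x, continuous (res2 v1 v2 p b)}.
Proof.
move=> x0; have cX : {for x, continuous (fun x => x + p)}.
  by apply: cvgD; [exact: cvg_id|exact: cvg_cst].
have cD := is_derive_continuous (is_derive_den x).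
apply: cvgM.
  apply: cvgD; apply: cvgM; try exact: cvg_cst.
    by apply: cvgB; [apply: cvgM; exact: cX|exact: cvg_cst].
  by apply: cvgM; [apply: cvgM; [exact: cvg_cst|exact: cX]|exact: cvg_cst].
apply: cvgV; first by rewrite gt_eqF // exprn_gt0 // den_gt0.
exact: cvgM.
Qed.

Lemma hlintegrable_res1 (v1 v2 : R) : hlintegrable (fun x => x `^ (- s) * res1 v1 v2 p b x).
Proof.
have i1 : hlintegrable (pw s 1) by apply: hlintegrable_pw; rewrite ?ltrDr.
apply: (le_hlintegrable _ _ (hlintegrableZ ((`|v1| + `|v2|) * (1 + d^-1)) i1)).
  apply: measurable_continuous_hl => x x0; apply: cvgM.
    exact: continuous_powR.
  exact: continuous_res1.
move=> x x0; rewrite normrM ger0_norm ?powR_ge0 // /pw mulrCA.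
by rewrite ler_wpM2l ?powR_ge0 // norm_res1.
Qed.

Lemma hlintegrable_res2 (v1 v2 : R) : hlintegrable (fun x => x `^ (- s) * res2 v1 v2 p b x).
Proof.
have i1 : hlintegrable (pw s 2).
  by apply: hlintegrable_pw => //; apply: ltr_pwDl => //; rewrite ler1n.
apply: (le_hlintegrable _ _ (hlintegrableZ ((`|v1| + `|v2|) * d^-1) i1)).
  apply: measurable_continuous_hl => x x0; apply: cvgM.
    exact: continuous_powR.
  exact: continuous_res2.
move=> x x0; rewrite normrM ger0_norm ?powR_ge0 // /pw mulrCA.
by rewrite ler_wpM2l ?powR_ge0 // norm_res2.
Qed.

(* Integrate the derivative of x^(1-s) Re (v / (x + q)), where v = v1 + i v2. *)
Lemma resolvent_by_parts (v1 v2 : R) :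
  hlint (fun x => x `^ (- s) * res2 (p * v1 - b * v2) (p * v2 + b * v1) p b x) =
  s * hlint (fun x => x `^ (- s) * res1 v1 v2 p b x).
Proof.
set t1 := p * v1 - _; set t2 := p * v2 + _.
pose F x := x `^ (1 - s) * res1 v1 v2 p b x.
pose f x := x `^ (- s) * res2 t1 t2 p b x - s * (x `^ (- s) * res1 v1 v2 p b x).
have i2 := hlintegrable_res2 t1 t2; have i1 := hlintegrable_res1 v1 v2.
have intf : hlintegrable f by apply: hlintegrableB => //; exact: hlintegrableZ.
have dF x : 0 < x -> is_derive x 1 F (f x).
  move=> x0.
  have h := is_deriveM (is_derive1_powR (1 - s) x0) (is_derive_res1 v1 v2 x0).
  apply: (is_derive_eq h); rewrite /GRing.scale /= /f.
  have -> : 1 - s - 1 = - s by lra.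
  rewrite powRDp // powRr1 ?ltW //.
  have D : den p b x != 0 by rewrite gt_eqF // den_gt0.
  (* The real part of v / (x + q) = x v / (x + q)^2 + q v / (x + q)^2, where [t1] and [t2] are the
     components of q v. *)
  have key : res1 v1 v2 p b x = x * res2 v1 v2 p b x + res2 t1 t2 p b x.
    rewrite /res1 /res2 /t1 /t2; move: D; rewrite /den => D; field.
    by rewrite D.
  have -> : res2 t1 t2 p b x = res1 v1 v2 p b x - x * res2 v1 v2 p b x.
    by rewrite key; ring.
  by ring.
have cf x : 0 < x -> {for x, continuous f}.
  move=> x0; apply: cvgB; first by apply: cvgM; [exact: continuous_powR|exact: continuous_res2].
  by apply: cvgM; [exact: cvg_cst|apply: cvgM; [exact: continuous_powR|exact: continuous_res1]].
have bF x : 0 < x -> `|F x| <= ((`|v1| + `|v2|) * (1 + d^-1)) * pw (s - 1) 1 x.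
  move=> x0; rewrite normrM ger0_norm ?powR_ge0 // /pw opprB mulrCA.
  by rewrite ler_wpM2l ?powR_ge0 // norm_res1.
have F0 : F x @[x --> 0^'+] --> (0 : R).
  apply: squeeze_norm (cvg_pw_at0 1 s1); near=> x; apply: bF.
  by near: x; exact: nbhs_right_gt.
have s2 : 1 < s + 1 by rewrite ltrDr.
have Fy : F x @[x --> +oo%R] --> (0 : R).
  apply: squeeze_norm (cvg_pw_pinfty s1 s2); near=> x; apply: bF.
  by near: x; exact: nbhs_pinfty_gt.
have := hl_FTC dF cf intf F0 Fy.
rewrite subrr /f hlintB //; last exact: hlintegrableZ.
by rewrite (hlintZ s i1) => /subr0_eq.
Unshelve. all: by end_near. Qed.

End Resolvent.

Section Modulus.
Context {R : realType}.
Variables (c g s : R).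
Hypotheses (cg : c ^+ 2 + g ^+ 2 = 1) (c1 : c < 1) (s0 : 0 < s) (s1 : s < 1).
Implicit Types (r x : R).

Let cN1 : -1 <= c.
Proof.
rewrite leNgt; apply/negP => h.
have : 0 < (- 1 - c) * (1 - c) by rewrite mulr_gt0 //; lra.
by have := sqr_ge0 g; have := cg; lra.
Qed.

Let d := (1 - c) / 8.
Let d0 : 0 < d. Proof. by rewrite /d; have := c1; lra. Qed.

Let p r := 1 - r * c.
Let b r := - (r * g).

Lemma den_lower r x : - 2^-1 < r -> 0 <= x -> d * (1 + x) ^+ 2 <= den (p r) (b r) x.
Proof.
have := cN1; have := c1 => c1' cN1' r2 x0.
rewrite /den /p /b sqrrN exprMn (_ : g ^+ 2 = 1 - c ^+ 2); last by rewrite -cg; ring.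
set X := 1 + x; have X1 : 1 <= X by rewrite /X; lra.
have -> : (x + (1 - r * c)) ^+ 2 + r ^+ 2 * (1 - c ^+ 2) = X ^+ 2 - 2 * r * c * X + r ^+ 2.
  by rewrite /X; ring.
have [r0|r0] := leP 0 r.
  have h1 : 0 <= (1 + c) / 2 * (X - r) ^+ 2 by rewrite mulr_ge0 ?sqr_ge0 //; lra.
  have h2 : 0 <= (1 - c) * (r * X) by rewrite mulr_ge0 ?mulr_ge0 //; lra.
  have h3 : 0 <= (1 - c) * X ^+ 2 by rewrite mulr_ge0 ?sqr_ge0 //; lra.
  have h4 : 0 <= (1 - c) * r ^+ 2 by rewrite mulr_ge0 ?sqr_ge0 //; lra.
  have e : X ^+ 2 - 2 * r * c * X + r ^+ 2 =
    (1 + c) / 2 * (X - r) ^+ 2 + (1 - c) * (r * X) + (1 - c) * X ^+ 2 / 2 + (1 - c) * r ^+ 2 / 2.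
    by field.
  rewrite e /d; lra.
have h1 : 0 <= (1 + c) * (- r * X) by rewrite mulr_ge0 ?mulr_ge0 //; lra.
have h2 : X ^+ 2 / 4 <= (X + r) ^+ 2.
  have : 0 <= (X / 2 + r) * (3 / 2 * X + r) by rewrite mulr_ge0 //; lra.
  lra.
have h3 : d * X ^+ 2 <= X ^+ 2 / 4.
  have := sqr_ge0 X; rewrite /d; nra.
apply: (le_trans h3); apply: (le_trans h2).
have -> : X ^+ 2 - 2 * r * c * X + r ^+ 2 = (X + r) ^+ 2 + 2 * ((1 + c) * (- r * X)) by ring.
lra.
Qed.

Let den_lb r x : - 2^-1 < r -> 0 < x -> d * (1 + x) ^+ 2 <= den (p r) (b r) x.
Proof. by move=> r2 x0; apply: den_lower => //; exact: ltW. Qed.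

Definition sqdist r := 1 - 2 * r * c + r ^+ 2.

Lemma sqdistE r : sqdist r = den (p r) (b r) 0.
Proof.
rewrite /den /p /b /sqdist sqrrN exprMn (_ : g ^+ 2 = 1 - c ^+ 2); last by rewrite -cg; ring.
by ring.
Qed.

Lemma sqdist_gt0 r : - 2^-1 < r -> 0 < sqdist r.
Proof.
move=> r2; rewrite sqdistE; apply: lt_le_trans (den_lower r2 (lexx 0)).
by rewrite addr0 expr1n mulr1.
Qed.

Let f (v1 v2 : R) r x := x `^ (- s) * res1 v1 v2 (p r) (b r) x.

Let is_derive_p r : is_derive r 1 p (- c).
Proof.
have h : is_derive r 1 (cst 1 + - (id * cst c)) (- c).
  by apply: is_derive_eq; rewrite /GRing.scale /=; ring.
exact: h.
Qed.

Let is_derive_b r : is_derive r 1 b (- g).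
Proof.
have h : is_derive r 1 (- (id * cst g)) (- g).
  by apply: is_derive_eq; rewrite /GRing.scale /=; ring.
exact: h.
Qed.

(** The [r]-derivative of v / (x + 1 - r z) is v z / (x + 1 - r z)^2, and the first two arguments of
    [res2] are the components of v z. *)
Let is_derive_f (v1 v2 : R) r x : - 2^-1 < r -> 0 < x ->
  is_derive r 1 (fun r => f v1 v2 r x)
   (x `^ (- s) * res2 (v1 * c - v2 * g) (v2 * c + v1 * g) (p r) (b r) x).
Proof.
move=> r2 x0; have dp := is_derive_p r; have db := is_derive_b r.
have D0 : den (p r) (b r) x != 0 by rewrite gt_eqF // (den_gt0 d0 (fun x => @den_lb r x r2)).
have hA : is_derive r 1 (cst x + p) (- c).
  by apply: (is_derive_eq (is_deriveD (is_derive_cst x r 1) dp)); rewrite add0r.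
have hD : is_derive r 1 ((cst x + p) ^+ 2 + b ^+ 2) (- 2 * c * (x + p r) - 2 * g * b r).
  apply: (is_derive_eq (is_deriveD (is_deriveX 2 hA) (is_deriveX 2 db))).
  by rewrite /GRing.scale !fctE /=; ring.
have hN : is_derive r 1 (cst v1 * (cst x + p) + cst v2 * b) (- (v1 * c + v2 * g)).
  apply: (is_derive_eq (is_deriveD (is_deriveM (is_derive_cst v1 r 1) hA)
    (is_deriveM (is_derive_cst v2 r 1) db))); rewrite /GRing.scale !fctE /=; ring.
have hV := @is_deriveV _ (fun r => den (p r) (b r) x) r _ _ D0 hD.
have hM := is_deriveM hN hV.
have h := is_deriveM (is_derive_cst (x `^ (- s)) r 1) hM.
apply: (is_derive_eq h); rewrite /GRing.scale !fctE /= mulr0 addr0; congr (_ * _).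
rewrite /res2; move: D0; rewrite /den => D0; field.
by rewrite D0.
Qed.

(* The real part of the integral of x^-s v / (x + 1 - r z), where v = v1 + i v2 and
   z = c + i g; [sqdist r] is |1 - r z|^2. *)
Definition resint v1 v2 r := hlint (fun x => x `^ (- s) * res1 v1 v2 (1 - r * c) (- (r * g)) x).

Lemma resint_linear v1 v2 r : - 2^-1 < r ->
  resint v1 v2 r = v1 * resint 1 0 r + v2 * resint 0 1 r.
Proof.
move=> r2; have lb x := @den_lb r x r2.
have i1 := hlintegrable_res1 d0 lb s0 s1 1 0.
have i2 := hlintegrable_res1 d0 lb s0 s1 0 1.
rewrite /resint -(hlintZ v1 i1) -(hlintZ v2 i2) -hlintD; [|exact: hlintegrableZ..].
by apply: eq_hlint => x x0 /=; rewrite /res1 /p /b; ring.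
Qed.

Let is_derive_resint_res2 (v1 v2 : R) r : - 2^-1 < r ->
  is_derive r 1 (resint v1 v2)
   (hlint (fun x => x `^ (- s) * res2 (v1 * c - v2 * g) (v2 * c + v1 * g) (p r) (b r) x)).
Proof.
move=> r2.
have r_in : - 2^-1 < r < r + 1 by rewrite r2 ltrDl ltr01.
have i2 : hlintegrable (pw s 2).
  by apply: hlintegrable_pw => //; apply: ltr_pwDl => //; rewrite ler1n.
set t1 := v1 * c - v2 * g; set t2 := v2 * c + v1 * g.
have i1 q : - 2^-1 < q < r + 1 -> hlintegrable (f v1 v2 q).
  by move=> /andP[q2 _]; exact: (hlintegrable_res1 d0 (fun x => @den_lb q x q2) s0 s1).
have df q x : - 2^-1 < q < r + 1 -> 0 < x ->
    is_derive q 1 (fun q => f v1 v2 q x) (x `^ (- s) * res2 t1 t2 (p q) (b q) x).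
  by move=> /andP[q2 _]; exact: is_derive_f.
have bd q x : - 2^-1 < q < r + 1 -> 0 < x ->
    `|x `^ (- s) * res2 t1 t2 (p q) (b q) x| <= (`|t1| + `|t2|) * d^-1 * pw s 2 x.
  move=> /andP[q2 _] x0; rewrite normrM ger0_norm ?powR_ge0 // /pw mulrCA.
  rewrite ler_wpM2l ?powR_ge0 //.
  exact: (norm_res2 d0 (fun x => @den_lb q x q2)).
exact: (is_derive_under_hlint r_in i1 df (hlintegrableZ ((`|t1| + `|t2|) * d^-1) i2) bd).
Qed.

(** Put q = 1 - r z. Then m + i n = z / q, so the derivative, the integral of x^-s v q (m + i n) /
    (x + q)^2, is by [resolvent_by_parts] equal to [s] times that of x^-s v (m + i n) / (x + q). The
    two claims are v = 1 and v = i. *)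
Lemma is_derive_resint r : - 2^-1 < r ->
  is_derive r 1 (resint 1 0)
    (s * ((c - r) / sqdist r * resint 1 0 r + g / sqdist r * resint 0 1 r)) /\
  is_derive r 1 (resint 0 1)
    (s * (- (g / sqdist r) * resint 1 0 r + (c - r) / sqdist r * resint 0 1 r)).
Proof.
set m := (c - r) / _; set n := g / _.
move=> r2; have lb x := @den_lb r x r2.
have Q0 := sqdist_gt0 r2.
have Qn : sqdist r != 0 by rewrite gt_eqF.
have e1 : p r * m - b r * n = c.
  have h : p r * (c - r) - b r * g = c * sqdist r.
    have g2 : g ^+ 2 = 1 - c ^+ 2 by rewrite -cg; ring.
    have -> : p r * (c - r) - b r * g = (1 - r * c) * (c - r) + r * g ^+ 2.
      by rewrite /p /b; ring.
    by rewrite g2 /sqdist; ring.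
  have -> : p r * m - b r * n = (p r * (c - r) - b r * g) / sqdist r.
    by rewrite /m /n; field.
  by rewrite h mulfK.
have e2 : p r * n + b r * m = g.
  have h : p r * g + b r * (c - r) = g * sqdist r.
    by rewrite /p /b /sqdist; ring.
  have -> : p r * n + b r * m = (p r * g + b r * (c - r)) / sqdist r.
    by rewrite /m /n; field.
  by rewrite h mulfK.
split; rewrite -resint_linear // /resint -(resolvent_by_parts d0 lb s0 s1).
- rewrite e1 e2; have := is_derive_resint_res2 1 0 r2.
  by rewrite !mul1r !mul0r subr0 add0r.
- rewrite (_ : p r * - n - b r * m = - g); last by rewrite -e2; ring.
  rewrite (_ : p r * m + b r * - n = c); last by rewrite -e1; ring.
  have := is_derive_resint_res2 0 1 r2.
  by rewrite !mul1r !mul0r sub0r addr0.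
Qed.

(* I(r) = resint 1 0 r - i resint 0 1 r solves I' = s z / (1 - r z) I, so |I|^2 |1 - r z|^(2s)
   is constant; its value is read off at r = 0. *)
Lemma resint_modulus r : 0 <= r ->
  (resint 1 0 r ^+ 2 + resint 0 1 r ^+ 2) * sqdist r `^ s = beta_int s 1 ^+ 2.
Proof.
pose N t := resint 1 0 t ^+ 2 + resint 0 1 t ^+ 2.
pose G t := N t * sqdist t `^ s.
have E0 : G 0 = beta_int s 1 ^+ 2.
  have C0 : resint 1 0 0 = beta_int s 1.
    apply: eq_hlint => x x0; rewrite /res1 /den /pw !mul0r subr0 oppr0 addr0.
    rewrite expr0n addr0 powR_inv1; last by lra.
    have : 1 + x != 0 by rewrite gt_eqF //; lra.
    by move=> x1; rewrite mul1r addrC; congr (_ * _); field.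
  have S0 : resint 0 1 0 = 0.
    rewrite -[RHS](mul0r (hlint (pw s 1))) -hlintZ; last first.
      by apply: hlintegrable_pw; rewrite ?ltrDr.
    by apply: eq_hlint => x x0; rewrite /res1 !mul0r oppr0 mulr0 addr0 mul0r mulr0.
  by rewrite /G /N C0 S0 /sqdist expr0n !mulr0 !mul0r subr0 !addr0 powR1 mulr1.
have dG (t : R) : - 2^-1 < t -> is_derive t (1 : R) G (0 : R).
  move=> t2; have [dC dS] := is_derive_resint t2.
  have Q0 := sqdist_gt0 t2.
  have dQ : is_derive t (1 : R) sqdist (2 * t - 2 * c).
    have h := is_deriveD (is_deriveD (is_derive_cst (1 : R) t 1)
      (is_deriveN (is_deriveM (is_deriveM (is_derive_cst (2 : R) t 1) (is_derive_id t 1))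
         (is_derive_cst c t 1)))) (is_deriveX 2 (is_derive_id t 1)).
    by apply: (is_derive_eq h); rewrite /GRing.scale !fctE /=; ring.
  have dP := @is_derive1_comp _ (fun x => x `^ s) sqdist t _ _ (is_derive1_powR s Q0) dQ.
  have dN := is_deriveD (is_deriveX 2 dC) (is_deriveX 2 dS).
  have h := is_deriveM dN dP.
  apply: (is_derive_eq h); rewrite /GRing.scale !fctE /=.
  have -> : sqdist t `^ s = sqdist t * sqdist t `^ (s - 1).
    rewrite -{2}(powRr1 (ltW Q0)) -powRDp //; congr (_ `^ _); ring.
  by field; rewrite gt_eqF.
rewrite le_eqVlt => /predU1P[<-|r0]; first exact: E0.
have dG0 t : t \in `]0, r[ -> is_derive t 1 G (cst 0 t).
  by rewrite in_itv /= => /andP[t0 _]; apply: dG; lra.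
have cG : {within `[0, r], continuous G}.
  apply: continuous_in_subspaceT => t; rewrite inE /= in_itv /= => /andP[t0 _].
  have t2 : - 2^-1 < t by lra.
  exact: is_derive_continuous (dG t t2).
have [t _ /=] := MVT r0 dG0 cG.
by rewrite mul0r => /subr0_eq; rewrite E0.
Qed.

End Modulus.

(** * The maximum of the majorant *)

Section Unimodal.
Context {R : realType}.
Variables (a b S T : R).
Hypotheses (a0 : 0 < a) (b0 : 0 < b) (S0 : 0 < S) (T0 : 0 < T).

(** The majorant in the variable t = D / x, once the power x^(a-b) has been taken out. *)
Definition bipow t : R := S * t `^ a + T * t `^ (- b).

Lemma powR_ge_ln (x r : R) : 0 < x -> 1 + r * ln x <= x `^ r.
Proof. by move=> x0; rewrite /powR gt_eqF // expR_ge1Dx. Qed.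

(* [bipow] is convex as a function of [ln t]. *)
Lemma bipow_quasiconvex (u v t : R) : 0 < u -> u <= v -> v <= t ->
  bipow v <= bipow u \/ bipow v <= bipow t.
Proof.
move=> u0 uv vt; have v0 : 0 < v by lra. have t0 : 0 < t by lra.
(* The derivative of [bipow] with respect to ln t at [v]. [key] is the tangent inequality there, and
   the sign of [k] tells which endpoint lies above. *)
pose k := S * a * v `^ a - T * b * v `^ (- b).
have key x : 0 < x -> bipow v + k * ln (x / v) <= bipow x.
  move=> x0; have q0 : 0 < x / v by rewrite divr_gt0.
  have xE : x = v * (x / v) by field; rewrite gt_eqF.
  have E r : x `^ r = v `^ r * (x / v) `^ r.
    by rewrite {1}xE powRM // ltW.
  rewrite /bipow !E.
  have ha := powR_ge_ln a q0; have hb := powR_ge_ln (- b) q0.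
  have va : 0 < S * v `^ a by rewrite mulr_gt0 // powR_gt0.
  have vb : 0 < T * v `^ (- b) by rewrite mulr_gt0 // powR_gt0.
  set L := ln (x / v) in ha hb *.
  have h1 : S * v `^ a * (1 + a * L) <= S * v `^ a * (x / v) `^ a by rewrite ler_pM2l.
  have h2 : T * v `^ (- b) * (1 + (- b) * L) <= T * v `^ (- b) * (x / v) `^ (- b) by rewrite ler_pM2l.
  rewrite !mulrA /k; lra.
have [k0|k0] := leP 0 k.
  right; apply: le_trans (key _ t0); rewrite lerDl mulr_ge0 //.
  by apply: ln_ge0; rewrite ler_pdivlMr // mul1r.
left; apply: le_trans (key _ u0); rewrite lerDl; apply: mulr_le0; first exact: ltW.
by apply: ln_le0; rewrite ler_pdivrMr // mul1r.
Qed.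

(** If [bipow] is lower at [v] than at [u], it cannot rise from [u'] to [u], so its values at [u]
    and at [v] are at most that at [u']; on the segment from [u'] to [v] it is bounded by its larger
    end value. *)
Lemma bipow_single_crossing (u v u' v' : R) : 0 < u' -> u' <= u -> u <= v ->
  u' <= v' -> v' <= v -> bipow v < bipow u -> bipow v' <= bipow u'.
Proof.
move=> u'0 u'u uv u'v' v'v vu.
have h1 : bipow u <= bipow u'.
  by have [//|] := bipow_quasiconvex u'0 u'u uv; lra.
have [//|] := bipow_quasiconvex u'0 u'v' v'v; lra.
Qed.
End Unimodal.

Section Crossing.
Context {R : realType}.
Implicit Types (f W : R -> R).

(* [f] changes sign once, from + to -; compare [W] with its value at the crossing. *)
Lemma hlint_crossing f W C : hlintegrable f -> hlintegrable (fun x => W x * f x) ->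
  (forall x y, 0 < x -> x <= y -> W y <= W x) -> (forall x, 0 < x -> 0 <= W x <= C) ->
  (forall x y, 0 < x -> x < y -> f x < 0 -> f y <= 0) ->
  0 <= hlint f -> 0 <= hlint (fun x => W x * f x).
Proof.
move=> intf intWf Wni W0 cross f0.
suff [K K0 HK] : exists2 K, 0 <= K & forall x, 0 < x -> K * f x <= W x * f x.
  apply: (@le_trans _ _ (K * hlint f)); first by rewrite mulr_ge0.
  by rewrite -hlintZ //; apply: le_hlint => //; exact: hlintegrableZ.
pose N := [set x | 0 < x /\ f x < 0].
(* Where [f] is never negative, [K = 0] serves. *)
have [[x0 [x00 fx0]]|N0] := pselect (N !=set0); last first.
  exists 0 => // x x_gt0; rewrite mul0r mulr_ge0 //; first by case/andP: (W0 _ x_gt0).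
  by rewrite leNgt; apply/negP => fx; apply: N0; exists x.
have hi : has_inf N.
  by split; [exists x0|exists 0 => x [/ltW]].
have after x : inf N < x -> f x <= 0.
  move=> Nx; have [|y [y0 fy] /= yx] := @inf_adherent _ N (x - inf N) _ hi; first by rewrite subr_gt0.
  by apply: cross fy => //; rewrite addrC subrK in yx.
have before x : 0 < x -> x < inf N -> 0 <= f x.
  move=> x_gt0 xN; rewrite leNgt; apply/negP => fx.
  by have := ge_inf (proj2 hi) (conj x_gt0 fx : N x); rewrite leNgt xN.
(* If the crossing is at 0, [f] is nonpositive on the whole half-line and [W] is not controlled at
   the crossing; the upper bound [C] replaces its value. *)
have [i0|i0] := leP (inf N) 0.
  exists C; first by have /andP[h1 h2] := W0 _ x00; lra.
  move=> x x_gt0; rewrite -subr_ge0 -mulrBl mulr_le0 ?after ?(le_lt_trans i0) //.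
  by rewrite subr_le0; case/andP: (W0 _ x_gt0).
exists (W (inf N)); first by case/andP: (W0 _ i0).
move=> x x_gt0; rewrite -subr_ge0 -mulrBl.
have [xi|ix|->] := ltgtP x (inf N); last by rewrite subrr mul0r.
  by rewrite mulr_ge0 ?before // subr_ge0 Wni // ltW.
by rewrite mulr_le0 ?after // subr_le0 Wni // ltW.
Qed.
End Crossing.

(** * Scaling and the Stieltjes transform at a positive point *)

Section Stieltjes.
Context {R : realType}.
Notation mu := (@lebesgue_measure R).
Implicit Types (x y q : R).

Lemma hl_scale q (f : R -> R) : 0 < q ->
  (forall x, 0 < x -> {for x, continuous f}) -> hlintegrable f ->
  hlintegrable (fun x => f (q * x)) /\ hlint f = q * hlint (fun x => f (q * x)).
Proof.
move=> q0 cf intf.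
have dq x : 0 < x -> is_derive x (1 : R) (fun x => q * x) q.
  move=> _; have h := is_deriveM (is_derive_cst q x 1) (is_derive_id x 1).
  by apply: (is_derive_eq h); rewrite /GRing.scale /= mulr0 addr0 mulr1.
have cq x : 0 < x -> {for x, continuous (fun _ : R => q)} by move=> _; exact: cvg_cst.
have q00 : q * x @[x --> 0^'+] --> (0 : R).
  rewrite -[X in _ --> X](mulr0 q); apply: cvgM; first exact: cvg_cst.
  exact: cvg_at_right_filter cvg_id.
have qy : q * x @[x --> +oo%R] --> (+oo : set_system R).
  apply/cvgryPge => A; near=> x.
  rewrite mulrC -ler_pdivrMr //; near: x; exact: nbhs_pinfty_ge.
have [i e] := hl_subst dq (fun _ _ => q0) cq q00 qy cf intf.
have i' : hlintegrable (fun x => f (q * x)).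
  apply: (@eq_hlintegrable _ (fun x => q^-1 * (f (q * x) * q))).
    by move=> x _; field; rewrite gt_eqF.
  exact: hlintegrableZ.
split=> //; rewrite e -hlintZ //; apply: eq_hlint => x _; exact: mulrC.
Unshelve. all: by end_near. Qed.

Variable s : R.
Hypotheses (s0 : 0 < s) (s1 : s < 1).

Lemma stieltjes_continuous q x : 0 < q -> 0 < x ->
  {for x, continuous (fun x => x `^ (- s) / (x + q))}.
Proof.
move=> q0 x0; apply: cvgM; first exact: continuous_powR.
apply: cvgV; first by rewrite gt_eqF // addr_gt0.
by apply: cvgD; [exact: cvg_id|exact: cvg_cst].
Qed.

Lemma stieltjes q : 0 < q ->
  hlintegrable (fun x => x `^ (- s) / (x + q)) /\
  hlint (fun x => x `^ (- s) / (x + q)) = q `^ (- s) * beta_int s 1.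
Proof.
move=> q0.
have i : hlintegrable (pw s 1) by apply: hlintegrable_pw; rewrite ?ltrDr.
pose f x := x `^ (- s) / (x + q).
have cf x : 0 < x -> {for x, continuous f} by exact: stieltjes_continuous.
have fE x : 0 < x -> q `^ (- s - 1) * pw s 1 x = f (q * x).
  move=> x0; have x1 : 0 < 1 + x by lra.
  rewrite /f powRM ?(ltW q0) ?(ltW x0) // /pw powR_inv1 ?(ltW x1) // powRDp //.
  rewrite powR_inv1 ?(ltW q0) //; field.
  by rewrite !gt_eqF //; nra.
have intf : hlintegrable f.
  have qV : 0 < q^-1 by rewrite invr_gt0.
  have cg x : 0 < x -> {for x, continuous (fun x => q `^ (- s - 1) * pw s 1 x)}.
    by move=> x0; apply: cvgM; [exact: cvg_cst|exact: continuous_pw].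
  have [h _] := hl_scale qV cg (hlintegrableZ _ i).
  apply: eq_hlintegrable h => x x0; rewrite fE; last by rewrite mulr_gt0.
  by congr f; field; rewrite gt_eqF.
split=> //; have [_ ->] := hl_scale q0 cf intf.
rewrite -(eq_hlint fE) hlintZ // mulrA; congr (_ * _).
by rewrite -{1}(powRr1 (ltW q0)) -powRDp //; congr (_ `^ _); ring.
Qed.
End Stieltjes.

Section Measurability2.
Context {R : realType}.
Notation T := (measurableTypeR R).

(** Writing f^-1 as f (f^2)^-1 reduces the claim to real powers of nonnegative numbers; where [f]
    vanishes both sides are 0. *)
Lemma measurable_inv_fun d (X : measurableType d) (D : set X) (f : X -> R) :
  measurable_fun D f -> measurable_fun D (fun x => (f x)^-1).
Proof.
move=> mf.
rewrite (_ : (fun x => (f x)^-1) = fun x => f x * ((f x) ^+ 2) `^ (-1)).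
  apply: measurable_funM => //.
  exact: (measurableT_comp (f := fun y => y `^ (- 1)) (measurable_powR (- 1)) (measurable_funX 2 mf)).
apply/funext => x; rewrite powR_inv1 ?sqr_ge0 //.
have [->|fx] := eqVneq (f x) 0; first by rewrite invr0 mul0r.
by field.
Qed.

Lemma measurable_powR_fun d (X : measurableType d) (D : set X) (f : X -> R) r :
  measurable_fun D f -> measurable_fun D (fun x => f x `^ r).
Proof. by move=> mf; exact: (measurableT_comp (f := fun y => y `^ r) (measurable_powR r) mf). Qed.

End Measurability2.

(** * Comparison of double integrals by symmetrisation *)

Section Rearrangement.
Context {R : realType}.
Notation mu := (@lebesgue_measure R).
Implicit Types (A B : R -> R -> R) (x y : R).

Definition dbl A : \bar R := (\int[mu \x mu]_z (quadrant A z)%:E)%E.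

Lemma quadrantD A B z : quadrant (fun x y => A x y + B x y) z = quadrant A z + quadrant B z.
Proof. by rewrite /quadrant mulrDr. Qed.

Lemma dbl_sym A : measurable2 A -> (forall x y, 0 < x -> 0 < y -> 0 <= A x y) ->
  dbl (fun x y => A x y + A y x) = (dbl A + dbl A)%E.
Proof.
move=> mA A0.
have mA' := measurable2_swap mA.
have A0' x y : 0 < x -> 0 < y -> 0 <= A y x by move=> x0 y0; exact: A0.
have e : dbl (fun x y => A y x) = dbl A.
  by rewrite /dbl (tonelli_hl2 mA' A0') (tonelli_hl1 mA A0).
rewrite -{2}e /dbl -ge0_integralD //.
- by apply: eq_integral => z _; rewrite quadrantD EFinD.
- by move=> z _; rewrite lee_fin quadrant_ge0.
- by apply/measurable_EFinP; exact: measurable_quadrant.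
- by move=> z _; rewrite lee_fin quadrant_ge0.
- by apply/measurable_EFinP; exact: measurable_quadrant.
Qed.

(* A function and its transpose have the same double integral, so it is enough to
   compare the symmetrisations. *)
Lemma rearrangement A B (f g : R -> R) : measurable2 A -> measurable2 B ->
  (forall x y, 0 < x -> 0 < y -> 0 <= A x y) ->
  (forall x y, 0 < x -> 0 < y -> 0 <= B x y) ->
  (forall x y, 0 < x -> 0 < y -> B x y + B y x <= A x y + A y x) ->
  hlintegrable f -> hlintegrable g ->
  (forall x, 0 < x -> (\int[mu]_(y in hl) (A x y)%:E = (f x)%:E)%E) ->
  (forall x, 0 < x -> (\int[mu]_(y in hl) (B x y)%:E = (g x)%:E)%E) ->
  hlint g <= hlint f.
Proof.
move=> mA mB A0 B0 BA intf intg Af Bg.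
have dA : dbl A = (hlint f)%:E.
  rewrite /dbl tonelli_hl1 // -hlint_fin //; apply: eq_integral => x /mem_hl x0.
  exact: Af.
have dB : dbl B = (hlint g)%:E.
  rewrite /dbl tonelli_hl1 // -hlint_fin //; apply: eq_integral => x /mem_hl x0.
  exact: Bg.
pose sym C x y : R := C x y + C y x.
have : (dbl (sym B) <= dbl (sym A))%E.
  have mS C : measurable2 C -> measurable2 (sym C).
    by move=> mC; apply: measurable_funD => //; exact: measurable2_swap.
  apply: ge0_le_integral => //.
  - by move=> z _; rewrite lee_fin quadrant_ge0 // => x y x0 y0; rewrite addr_ge0 ?B0.
  - by apply/measurable_EFinP; apply: measurable_quadrant; exact: mS.
  - by apply/measurable_EFinP; apply: measurable_quadrant; exact: mS.
  - move=> [x y] _; rewrite lee_fin /quadrant /=.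
    have [x0|x0] := pselect (0 < x); last by rewrite indic_hlN // !mul0r.
    have [y0|y0] := pselect (0 < y); last by rewrite (indic_hlN y0) mulr0 !mul0r.
    by rewrite !indic_hl // !mul1r BA.
rewrite (dbl_sym mA A0) (dbl_sym mB B0) dA dB -!EFinD lee_fin; lra.
Qed.
End Rearrangement.

Section PowRMono.
Context {R : realType}.
Lemma powR_le (x y r : R) : 0 < x -> x <= y -> 0 <= r -> x `^ r <= y `^ r.
Proof. by move=> x0 xy r0; apply: ge0_ler_powR; rewrite ?nnegrE //; lra. Qed.

Lemma powRN_le (x y r : R) : 0 < x -> x <= y -> 0 <= r -> y `^ (- r) <= x `^ (- r).
Proof.
move=> x0 xy r0; have y0 : 0 < y by lra.
by rewrite !powRN lef_pV2 ?posrE ?powR_gt0 // powR_le.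
Qed.
End PowRMono.

(** * The homogeneous inequality, normalised to P = 1 *)

Section Homogeneous.
Context {R : realType}.
Implicit Types (x y z P : R).

Definition rt P y : R := (y ^+ 2 + P) `^ (2^-1).

Lemma rt_sq P y : 0 <= P -> rt P y ^+ 2 = y ^+ 2 + P.
Proof.
move=> P0; have h : 0 <= y ^+ 2 + P by rewrite addr_ge0 ?sqr_ge0.
by rewrite -powR_mulrn ?powR_ge0 // -powRrM mulVf // powRr1.
Qed.

Lemma rt_ge P y : 0 <= P -> 0 < y -> y <= rt P y.
Proof.
move=> P0 y0; rewrite -(@ler_pXn2r _ 2) ?nnegrE ?powR_ge0 ?(ltW y0) //.
by rewrite rt_sq // lerDl.
Qed.

Lemma rt_gt0 P y : 0 <= P -> 0 < y -> 0 < rt P y.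
Proof. by move=> P0 y0; apply: lt_le_trans (rt_ge P0 y0). Qed.

Variables (a b : R).
Hypotheses (a0 : 0 < a) (a1 : a < 1) (b0 : 0 < b) (b1 : b < 1).

(** By the reflection formula [cS] is sin(pi b) / pi and [cT] is sin(pi a) / pi. With these factors
    the Stieltjes transforms of x^-b and x^(a-1) at q become q^-b and q^(a-1). *)
Definition cS : R := (beta_int b 1)^-1.
Definition cT : R := (beta_int (1 - a) 1)^-1.

Lemma cS_gt0 : 0 < cS.
Proof. by rewrite invr_gt0 beta_int_gt0 // ltrDr. Qed.

Lemma cT_gt0 : 0 < cT.
Proof. by have a0' := a0; have a1' := a1; rewrite invr_gt0 beta_int_gt0 //; lra. Qed.

(** Neither y^-b [rt P y]^a nor y^a [rt P y]^-b is integrable at infinity, where both behave like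
    y^(a-b). Their common value y^(a-b) at P = 0 is subtracted; the order of the differences makes
    both gaps nonnegative. *)
Definition gap1 P y := y `^ (- b) * (rt P y `^ a - y `^ a).
Definition gap2 P y := y `^ a * (y `^ (- b) - rt P y `^ (- b)).

Lemma continuous_rt P y : 0 <= P -> 0 < y -> {for y, continuous (rt P)}.
Proof.
move=> P0 y0; apply: (@continuous_comp _ _ _ (fun y => y ^+ 2 + P) (fun x => x `^ (2^-1))).
  by apply: cvgD; [exact: exprn_continuous|exact: cvg_cst].
by apply: continuous_powR; rewrite ltr_pwDl // exprn_gt0.
Qed.

Lemma continuous_rt_powR P r y : 0 <= P -> 0 < y -> {for y, continuous (fun y => rt P y `^ r)}.
Proof.
move=> P0 y0; apply: (@continuous_comp _ _ _ (rt P) (fun x => x `^ r)).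
  exact: continuous_rt.
by apply: continuous_powR; exact: rt_gt0.
Qed.

Lemma continuous_gap1 P y : 0 <= P -> 0 < y -> {for y, continuous (gap1 P)}.
Proof.
move=> P0 y0; apply: cvgM; first exact: continuous_powR.
by apply: cvgB; [exact: continuous_rt_powR|exact: continuous_powR].
Qed.

Lemma continuous_gap2 P y : 0 <= P -> 0 < y -> {for y, continuous (gap2 P)}.
Proof.
move=> P0 y0; apply: cvgM; first exact: continuous_powR.
by apply: cvgB; [exact: continuous_powR|exact: continuous_rt_powR].
Qed.

Lemma gap1_ge0 P y : 0 <= P -> 0 < y -> 0 <= gap1 P y.
Proof.
move=> P0 y0; rewrite mulr_ge0 ?powR_ge0 // subr_ge0.
by apply: powR_le => //; [exact: rt_ge|exact: ltW].
Qed.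

Lemma gap2_ge0 P y : 0 <= P -> 0 < y -> 0 <= gap2 P y.
Proof.
move=> P0 y0; rewrite mulr_ge0 ?powR_ge0 // subr_ge0.
by apply: powRN_le => //; [exact: rt_ge|exact: ltW].
Qed.

Let two_powR : 2 `^ (2 - a) <= 4 :> R.
Proof.
have <- : 2 `^ 2 = 4 :> R by rewrite (powR_mulrn 2) // -natrX.
by apply: ler_powR; [lra|have := a0; lra].
Qed.

Let weight_small y : 0 < y -> y <= 1 -> 1 / 4 <= (1 + y) `^ (- (2 - a)).
Proof.
move=> y0 y1; rewrite powRN mul1r lef_pV2 ?posrE ?powR_gt0 //; last lra.
apply: le_trans two_powR; apply: powR_le; first lra.
  by lra.
by have := a1; lra.
Qed.

Let weight_large y : 1 <= y -> y `^ a <= 4 * (1 + y) `^ (- (2 - a)) * y ^+ 2.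
Proof.
move=> y1; have y0 : 0 < y by lra.
rewrite powRN mulrAC ler_pdivlMr ?powR_gt0 //; last lra.
apply: (@le_trans _ _ (y `^ a * (2 * y) `^ (2 - a))).
  rewrite ler_wpM2l ?powR_ge0 //; apply: powR_le; [lra|lra|have := a1; lra].
rewrite powRM ?(ltW y0) // mulrCA -powRDp // (_ : a + (2 - a) = 2); last by ring.
by rewrite (powR_mulrn 2 (ltW y0)) ler_pM2r ?two_powR // exprn_gt0.
Qed.

Let rt1_gap y : 0 < y -> (rt 1 y - y) * y <= 1.
Proof.
move=> y0; have sq := @rt_sq 1 y ler01; have g := @rt_ge 1 y ler01 y0; nra.
Qed.

(** The gap is O(y^-b) at 0 and, since rt - y <= 1/y, it is O(y^(a-b-2)) at infinity, as is the
    comparison function. The factor 8 is the product of [rt 1 y]^a <= 2 for y <= 1 and of 4 >=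
    2^(2-a). *)
Lemma hlintegrable_gap1 : hlintegrable (gap1 1).
Proof.
have i : hlintegrable (pw b (2 - a)).
  by apply: hlintegrable_pw => //; have := a1; have := b0; lra.
apply: (le_hlintegrable _ _ (hlintegrableZ 8 i)).
  by apply: measurable_continuous_hl => y; exact: continuous_gap1 ler01.
move=> y y0; rewrite ger0_norm ?gap1_ge0 // /gap1 /pw mulrCA ler_wpM2l ?powR_ge0 //.
have a0' := a0; have a1' := a1.
have r0 := @rt_gt0 1 y ler01 y0; have ry := @rt_ge 1 y ler01 y0.
have [y1|y1] := leP y 1.
  have w := weight_small y0 y1.
  have r2 : rt 1 y <= 2.
    have sq := @rt_sq 1 y ler01; rewrite leNgt; apply/negP => h; nra.
  have h : rt 1 y `^ a <= 2.
    apply: (@le_trans _ _ (2 `^ a)); first by apply: powR_le => //; lra.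
    by apply: ler1_powR; lra.
  have := powR_ge0 y a; lra.
have w := weight_large (ltW y1).
have gap := rt1_gap y0.
have q1 : 1 <= rt 1 y / y by rewrite ler_pdivlMr // mul1r.
(* The base [rt 1 y / y] is at least 1 and a < 1, so its power [a] is at most the base itself. *)
have h : rt 1 y `^ a <= y `^ a * (rt 1 y / y).
  have {1}-> : rt 1 y = y * (rt 1 y / y) by field; rewrite gt_eqF.
  rewrite powRM ?ler_wpM2l ?powR_ge0 ?(ltW y0) //; last by lra.
  by apply: ler1_powR; lra.
have E : y `^ a * (rt 1 y / y) - y `^ a = y `^ a * ((rt 1 y - y) * y) / y ^+ 2.
  by field; rewrite gt_eqF.
apply: (@le_trans _ _ (y `^ a * (rt 1 y / y) - y `^ a)); first by rewrite lerD2r.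
rewrite E ler_pdivrMr ?exprn_gt0 //.
apply: (@le_trans _ _ (y `^ a * 1)); first by rewrite ler_wpM2l ?powR_ge0.
have := powR_ge0 (1 + y) (- (2 - a)); have := sqr_ge0 y.
by rewrite mulr1; set u := (1 + y) `^ _ in w *; set v := y ^+ 2 in w *; nra.
Qed.

Lemma hlintegrable_gap2 : hlintegrable (gap2 1).
Proof.
have i : hlintegrable (pw b (2 - a)).
  by apply: hlintegrable_pw => //; have := a1; have := b0; lra.
apply: (le_hlintegrable _ _ (hlintegrableZ 8 i)).
  by apply: measurable_continuous_hl => y; exact: continuous_gap2 ler01.
move=> y y0; rewrite ger0_norm ?gap2_ge0 //.
have a0' := a0; have a1' := a1; have b0' := b0; have b1' := b1.
have r0 := @rt_gt0 1 y ler01 y0; have ry := @rt_ge 1 y ler01 y0.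
have q0 : 0 < y / rt 1 y by rewrite divr_gt0.
have q1 : y / rt 1 y <= 1 by rewrite ler_pdivrMr // mul1r.
have -> : gap2 1 y = y `^ (- b) * (y `^ a * (1 - (y / rt 1 y) `^ b)).
  rewrite /gap2 powRM ?(ltW y0) ?invr_ge0 ?(ltW r0) // -powR_inv1 ?(ltW r0) //.
  rewrite -powRrM mulN1r.
  have e : y `^ (- b) * y `^ b = 1 by rewrite -powRDp // addNr powRr0.
  by rewrite [RHS]mulrCA; congr (_ * _); rewrite mulrBr mulr1 mulrA e mul1r.
rewrite /pw [leRHS]mulrCA ler_wpM2l ?powR_ge0 //.
have qb0 := powR_ge0 (y / rt 1 y) b.
have [y1|y1] := leP y 1.
  have w := weight_small y0 y1.
  have h : y `^ a <= 1 by rewrite -(powRr0 y); apply: ger_powR; rewrite ?y0 // (ltW a0').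
  have := powR_ge0 y a; nra.
have w := weight_large (ltW y1).
have gap := rt1_gap y0.
have qb : y / rt 1 y <= (y / rt 1 y) `^ b.
  by apply: ger1_powR; [rewrite q0|lra].
have h : 1 - (y / rt 1 y) `^ b <= (y ^+ 2)^-1.
  apply: (@le_trans _ _ (1 - y / rt 1 y)); first by lra.
  rewrite -[leRHS]mul1r ler_pdivlMr ?exprn_gt0 //.
  have -> : (1 - y / rt 1 y) * y ^+ 2 = (rt 1 y - y) * y * (y / rt 1 y).
    by field; rewrite gt_eqF.
  have g0 : 0 <= (rt 1 y - y) * y by rewrite mulr_ge0 ?subr_ge0 // ltW.
  by rewrite -[leRHS](mulr1 1); apply: ler_pM => //; exact: ltW.
apply: (@le_trans _ _ (y `^ a * (y ^+ 2)^-1)); first by rewrite ler_wpM2l ?powR_ge0.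
rewrite ler_pdivrMr ?exprn_gt0 //.
have := powR_ge0 (1 + y) (- (2 - a)); have := sqr_ge0 y.
by set u := (1 + y) `^ _ in w *; set v := y ^+ 2 in w *; nra.
Qed.

(** One kernel yields both gaps: up to beta constants, its integral in [z] against z^a is rt^a -
    y^a, and against z^-b it is y^-b - rt^-b. *)
Let Pk y z := (z + y)^-1 - (z + rt 1 y)^-1.

Let Pk_ge0 y z : 0 < y -> 0 < z -> 0 <= Pk y z.
Proof.
move=> y0 z0; rewrite subr_ge0 lef_pV2 ?posrE ?addr_gt0 ?rt_gt0 //.
by rewrite lerD2l rt_ge.
Qed.

(** After the common fraction is removed, this says that [rt 1] is 1-Lipschitz: its square increases
    exactly as y^2 does, and [rt 1 y >= y]. *)
Let Pk_le y z : 0 < y -> y <= z -> Pk z y <= Pk y z.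
Proof.
move=> y0 yz; have z0 : 0 < z by exact: lt_le_trans yz.
have ry := @rt_gt0 1 y ler01 y0; have rz := @rt_gt0 1 z ler01 z0.
rewrite /Pk [y + z]addrC lerD2l lerN2 lef_pV2 ?posrE ?addr_gt0 //.
have sy := @rt_sq 1 y ler01; have sz := @rt_sq 1 z ler01.
have gy := @rt_ge 1 y ler01 y0; have gz := @rt_ge 1 z ler01 z0.
rewrite leNgt; apply/negP => h; have h' : z - y < rt 1 z - rt 1 y by lra.
have : (z - y) * (z + y) < (rt 1 z - rt 1 y) * (rt 1 z + rt 1 y).
  apply: (@le_lt_trans _ _ ((z - y) * (rt 1 z + rt 1 y))).
    by rewrite ler_wpM2l ?subr_ge0 //; lra.
  by rewrite ltr_pM2r // addr_gt0.
lra.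
Qed.

Lemma half_line_comparison : cT * hlint (gap2 1) <= cS * hlint (gap1 1).
Proof.
have eL := hlintZ cT hlintegrable_gap2; have eR := hlintZ cS hlintegrable_gap1.
suff : hlint (fun y => cT * gap2 1 y) <= hlint (fun y => cS * gap1 1 y) by rewrite eL eR.
move=> {eL eR}; pose A y z := cS * cT * (y `^ (- b) * z `^ a * Pk y z).
pose B y z := cS * cT * (z `^ (- b) * y `^ a * Pk y z).
have ST0 : 0 < cS * cT by exact: mulr_gt0 cS_gt0 cT_gt0.
have mPk : measurable2 Pk.
  have mr : measurable2 (fun y _ => rt 1 y).
    apply: measurable2_fst; apply: measurable_powR_fun.
    by apply: measurable_funD => //; exact: measurable_funX.
  have m1 : measurable2 (fun y _ : R => y) by apply: (@measurable2_fst _ id).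
  have m2 : measurable2 (fun _ z : R => z) by apply: (@measurable2_snd _ id).
  by apply: measurable_funB; apply: measurable_inv_fun; apply: measurable_funD.
have mp1 r : measurable2 (fun y _ : R => y `^ r).
  by apply: measurable2_fst; exact: measurable_powR.
have mp2 r : measurable2 (fun _ z : R => z `^ r).
  by apply: measurable2_snd; exact: measurable_powR.
have mA : measurable2 A.
  apply: measurable_funM => //; apply: measurable_funM => //; apply: measurable_funM.
    exact: mp1.
  exact: mp2.
have mB : measurable2 B.
  apply: measurable_funM => //; apply: measurable_funM => //; apply: measurable_funM.
    exact: mp2.
  exact: mp1.
apply: (rearrangement mA mB).
- by move=> y z y0 z0; rewrite mulr_ge0 ?(ltW ST0) // mulr_ge0 ?Pk_ge0 // mulr_ge0 ?powR_ge0.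
- by move=> y z y0 z0; rewrite mulr_ge0 ?(ltW ST0) // mulr_ge0 ?Pk_ge0 // mulr_ge0 ?powR_ge0.
- move=> y z y0 z0; rewrite /A /B -!mulrDr ler_pM2l //.
  wlog yz : y z y0 z0 / y <= z.
    move=> H; have [yz|zy] := leP y z; first exact: H.
    by have := H z y z0 y0 (ltW zy); lra.
  have hP := Pk_le y0 yz.
  have hb := powRN_le y0 yz (ltW b0); have ha := powR_le y0 yz (ltW a0).
  (* This product is the difference of the two symmetrisations, up to the constant. For y <= z the
     first factor is nonnegative since y^-b decreases and y^a increases, the second by [Pk_le]. *)
  have : 0 <= (y `^ (- b) * z `^ a - z `^ (- b) * y `^ a) * (Pk y z - Pk z y).
    rewrite mulr_ge0 ?subr_ge0 //.
    by rewrite ler_pM ?powR_ge0.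
  lra.
- exact: hlintegrableZ hlintegrable_gap1.
- exact: hlintegrableZ hlintegrable_gap2.
- move=> y y0; have r0 := @rt_gt0 1 y ler01 y0.
  have a1' : 1 - a < 1 by have := a0; lra.
  have a0' : 0 < 1 - a by have := a1; lra.
  have [i1 e1] := stieltjes a0' a1' y0; have [i2 e2] := stieltjes a0' a1' r0.
  (* From z^a = z z^(a-1) and z/(z + y) - z/(z + r) = r/(z + r) - y/(z + y): two convergent
     Stieltjes transforms of exponent 1 - a. *)
  have E z : 0 < z -> A y z = cS * cT * y `^ (- b) *
    (rt 1 y * (z `^ (- (1 - a)) / (z + rt 1 y)) - y * (z `^ (- (1 - a)) / (z + y))).
    move=> z0; rewrite /A /Pk (_ : z `^ a = z * z `^ (- (1 - a))).
      by field; rewrite !gt_eqF ?addr_gt0.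
    by rewrite -{2}(powRr1 (ltW z0)) -powRDp //; congr (_ `^ _); ring.
  have iA : hlintegrable (A y).
    have h := hlintegrableZ (cS * cT * y `^ (- b))
      (hlintegrableB (hlintegrableZ (rt 1 y) i2) (hlintegrableZ y i1)).
    by apply: eq_hlintegrable h => z z0; rewrite E.
  rewrite hlint_fin // (eq_hlint E) hlintZ; last by apply: hlintegrableB; exact: hlintegrableZ.
  rewrite hlintB; [|exact: hlintegrableZ..]; rewrite (hlintZ _ i1) (hlintZ _ i2) e1 e2.
  have pE x : 0 < x -> x * x `^ (- (1 - a)) = x `^ a.
    by move=> x0; rewrite -{1}(powRr1 (ltW x0)) -powRDp //; congr (_ `^ _); ring.
  rewrite !mulrA !pE // -mulrBl /gap1 /cT; congr (_%:E); field.
  by rewrite gt_eqF // beta_int_gt0 // ltrDr.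
- move=> y y0; have r0 := @rt_gt0 1 y ler01 y0.
  have [i1 e1] := stieltjes b0 b1 y0; have [i2 e2] := stieltjes b0 b1 r0.
  have E z : 0 < z -> B y z = cS * cT * y `^ a *
    (z `^ (- b) / (z + y) - z `^ (- b) / (z + rt 1 y)).
    by move=> z0; rewrite /B /Pk; ring.
  have iB : hlintegrable (B y).
    have h := hlintegrableZ (cS * cT * y `^ a) (hlintegrableB i1 i2).
    by apply: eq_hlintegrable h => z z0; rewrite E.
  rewrite hlint_fin // (eq_hlint E) hlintZ; last exact: hlintegrableB.
  rewrite hlintB // e1 e2 /gap2 /cS; congr (_%:E); field.
  by rewrite gt_eqF // beta_int_gt0 // ltrDr.
Qed.

End Homogeneous.

(** * Continuity of Gamma *)

Section GammaContinuity.
Context {R : realType}.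
Implicit Types (s t : R).

Let gamma_integrand s t : R := t `^ (s - 1) * expR (- t).

Lemma Gamma_hlint s : Gamma s = hlint (gamma_integrand s).
Proof. exact: erefl. Qed.

Lemma Gamma_ge0 s : 0 <= Gamma s.
Proof.
by rewrite Gamma_hlint; apply: hlint_ge0 => t _; rewrite mulr_ge0 ?powR_ge0 ?expR_ge0.
Qed.

Let dominated_by N : R := expR 1 * N.+2`!%:R.

(** One integrable bound for all [s] between 1 and N + 1: t^(s-1) <= (1 + t)^N, while the
    exponential series at 1 + t gives exp(-t) <= e (N+2)! (1 + t)^-(N+2). *)
Let gamma_dominated N s t : 1 < s -> s < N.+1%:R -> 0 < t ->
  `|gamma_integrand s t| <= dominated_by N * pw 0 2 t.
Proof.
move=> s1 sN t0; have t1 : 0 <= 1 + t by lra.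
have t1' : 0 < 1 + t by lra.
rewrite ger0_norm; last by rewrite mulr_ge0 ?powR_ge0 ?expR_ge0.
rewrite /pw oppr0 powRr0 mul1r.
have h1 : t `^ (s - 1) <= (1 + t) `^ N%:R.
  apply: (@le_trans _ _ ((1 + t) `^ (s - 1))).
    by apply: ge0_ler_powR; rewrite ?nnegrE; lra.
  by apply: ler_powR; move: sN; rewrite -natr1; lra.
have h2 : expR (- t) <= dominated_by N * (1 + t) `^ (- N.+2%:R).
  have e := expR_ge1Dxn N.+1 t1; rewrite expRD in e.
  have f0 : 0 < N.+2`!%:R :> R by rewrite ltr0n fact_gt0.
  have {}e : (1 + t) ^+ N.+2 <= dominated_by N * expR t.
    rewrite /dominated_by mulrAC -ler_pdivrMr //; apply: le_trans e.
    by rewrite lerDr.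
  rewrite expRN powRN powR_mulrn // -[leLHS]mul1r ler_pdivrMr ?expR_gt0 //.
  by rewrite mulrAC ler_pdivlMr ?exprn_gt0 // mul1r.
apply: le_trans (ler_pM (powR_ge0 _ _) (expR_ge0 _) h1 h2) _.
rewrite mulrCA -powRDp // (_ : N%:R - N.+2%:R = - 2) // -addn2 natrD; ring.
Qed.

Lemma continuous_Gamma s : 1 < s -> {for s, continuous (@Gamma R)}.
Proof.
move=> s1; pose N := Num.truncn s.
have sN : s < N.+1%:R by exact: truncnS_gt.
have i2 : hlintegrable (fun t => dominated_by N * pw 0 2 t).
  by apply: hlintegrableZ; apply: hlintegrable_pw; lra.
pose I := `]1, N.+1%:R[%classic : set R.
have IE r : I r -> 1 < r /\ r < N.+1%:R by rewrite /I /= in_itv /= => /andP.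
have measg r : measurable_fun hl (gamma_integrand r).
  apply: measurable_funM; first exact: measurable_powR_fun.
  by apply: measurableT_comp => //; exact: measurable_expR.
have bd r t : I r -> 0 < t -> `|gamma_integrand r t| <= dominated_by N * pw 0 2 t.
  by move=> /IE[? ?]; exact: gamma_dominated.
have sI : s \in I by rewrite inE /I /= in_itv /= s1 sN.
apply: (continuity_under_integral (mu := lebesgue_measure) (f := gamma_integrand)
  (measurable_itv _) _ _ i2 _ sI).
- by move=> r Ir; apply: le_hlintegrable i2 => // t; exact: bd.
- apply: aeW => t; rewrite /= in_itv /= andbT => t0 r _.
  apply: cvgM; last exact: cvg_cst.
  have h : {for r, continuous (expR \o (fun r : R => (r - 1) * ln t))}.
    apply: continuous_comp; last exact: continuous_expR.
    apply: cvgM; last exact: cvg_cst.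
    by apply: cvgB; [exact: cvg_id|exact: cvg_cst].
  have e : expR \o (fun r => (r - 1) * ln t) = (fun r => t `^ (r - 1)).
    by apply/funext => q /=; rewrite /powR gt_eqF.
  by move: h; rewrite e.
- by move=> r Ir; apply: aeW => t; rewrite /= in_itv /= andbT => t0; exact: bd.
Qed.

End GammaContinuity.

#[local] Opaque powR hlint.

Section Lincomb.
Context {R : realType}.
Lemma hlintegrable_lincomb (f g : R -> R) (S T : R) : hlintegrable f -> hlintegrable g ->
  hlintegrable (fun x => S * f x + T * g x).
Proof. by move=> intf intg; apply: hlintegrableD; exact: hlintegrableZ. Qed.

Lemma hlint_lincomb (f g : R -> R) (S T : R) : hlintegrable f -> hlintegrable g ->
  hlint (fun x => S * f x + T * g x) = S * hlint f + T * hlint g.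
Proof.
move=> intf intg; rewrite -(hlintZ S intf) -(hlintZ T intg).
by apply: hlintD; exact: hlintegrableZ.
Qed.
End Lincomb.

(** * From the homogeneous inequality to the majorant *)

Section MaxAtMinusOne.
Context {R : realType}.
Variables (a b : R).
Hypotheses (a0 : 0 < a) (a1 : a < 1) (b0 : 0 < b) (b1 : b < 1).
Implicit Types (x y z P : R).
Variables (S T : R).
Hypotheses (S0 : 0 < S) (T0 : 0 < T).
Hypothesis ST : T * hlint (gap2 a b 1) <= S * hlint (gap1 a b 1).
Local Notation h1 := (gap1 a b).
Local Notation h2 := (gap2 a b).

Let sq P : R := P `^ (2^-1).
Let sq_gt0 P : 0 < P -> 0 < sq P. Proof. by move=> P0; rewrite powR_gt0. Qed.
Let sq_sq P : 0 <= P -> sq P ^+ 2 = P.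
Proof. by move=> P0; rewrite -powR_mulrn ?powR_ge0 // -powRrM mulVf // powRr1. Qed.

Lemma rt_scale P y : 0 < P -> 0 < y -> rt P (sq P * y) = sq P * rt 1 y.
Proof.
move=> P0 y0; rewrite /rt exprMn sq_sq ?(ltW P0) // -{2}[P]mulr1 -mulrDr powRM ?(ltW P0) //.
by rewrite addr_ge0 ?sqr_ge0.
Qed.

Lemma h_scale P y : 0 < P -> 0 < y ->
  h1 P (sq P * y) = sq P `^ (a - b) * h1 1 y /\
  h2 P (sq P * y) = sq P `^ (a - b) * h2 1 y.
Proof.
move=> P0 y0; have s0 := sq_gt0 P0; have r0 := @rt_gt0 R 1 y ler01 y0.
rewrite /gap1 /gap2 rt_scale // !powRM ?(ltW s0) ?(ltW y0) ?(ltW r0) //.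
rewrite (powRDp a (- b) s0).
move: (sq P `^ a) (sq P `^ (- b)) (y `^ a) (y `^ (- b)) (rt 1 y `^ a) (rt 1 y `^ (- b)).
by move=> *; split; ring.
Qed.

(** Rescaling by the square root of [P] gives the degree a - b of the gaps, plus 1 from the measure.
    Both integrals thus carry the same power of [P], and its exponent 1 + a - b is positive. *)
Lemma hlint_h P : 0 < P ->
  [/\ hlintegrable (h1 P), hlint (h1 P) = sq P `^ (1 + a - b) * hlint (h1 1),
      hlintegrable (h2 P) & hlint (h2 P) = sq P `^ (1 + a - b) * hlint (h2 1)].
Proof.
move=> P0; have s0 := sq_gt0 P0; have sV0 : 0 < (sq P)^-1 by rewrite invr_gt0.
have i1 := hlintegrable_gap1 a0 a1 b0 b1; have i2 := hlintegrable_gap2 a0 a1 b0 b1.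
have P0' := ltW P0.
have gen (h : R -> R -> R) : (forall P y, 0 <= P -> 0 < y -> {for y, continuous (h P)}) ->
    hlintegrable (h 1) ->
    (forall y, 0 < y -> h P (sq P * y) = sq P `^ (a - b) * h 1 y) ->
    hlintegrable (h P) /\ hlint (h P) = sq P `^ (1 + a - b) * hlint (h 1).
  move=> ch ih sh.
  have c1 y : 0 < y -> {for y, continuous (h 1)} by move=> y0; exact: ch.
  have cP y : 0 < y -> {for y, continuous (h P)} by move=> y0; exact: ch.
  have [iV _] := hl_scale sV0 c1 ih.
  have iP : hlintegrable (h P).
    apply: eq_hlintegrable (hlintegrableZ (sq P `^ (a - b)) iV) => y y0.
    rewrite -sh; last by rewrite mulr_gt0.
    by congr h; field; rewrite gt_eqF.
  split=> //; have [_ ->] := hl_scale s0 cP iP.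
  rewrite (eq_hlint sh) (hlintZ _ ih) mulrA; congr (_ * _).
  by rewrite -{1}(powRr1 (ltW s0)) -(powRDp 1 (a - b) s0) addrA.
have sc1 y : 0 < y -> h1 P (sq P * y) = sq P `^ (a - b) * h1 1 y.
  by move=> y0; have [] := h_scale P0 y0.
have sc2 y : 0 < y -> h2 P (sq P * y) = sq P `^ (a - b) * h2 1 y.
  by move=> y0; have [] := h_scale P0 y0.
have [j1 e1] := gen h1 (@continuous_gap1 R a b) i1 sc1.
have [j2 e2] := gen h2 (@continuous_gap2 R a b) i2 sc2.
by [].
Qed.

Variable P : R.
Hypotheses (P0 : 0 < P) (P4 : P <= 4).

(** The unweighted difference between P = 4, that is z = -1, and the given [P], in the variable t =
    x / sqrt (1 + x). *)
Let G z : R := z `^ (a - b) * (bipow a b S T (rt 4 z / z) - bipow a b S T (rt P z / z)).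

Let Gkey Q z : 0 <= Q -> 0 < z -> z `^ (a - b) * bipow a b S T (rt Q z / z) =
  S * (z `^ (- b) * rt Q z `^ a) + T * (z `^ a * rt Q z `^ (- b)).
Proof.
move=> Q0 z0; have r0 := rt_gt0 Q0 z0.
rewrite /bipow !powRM ?(ltW r0) ?invr_ge0 ?(ltW z0) //.
have zV r : z^-1 `^ r = z `^ (- r) by rewrite -(powR_inv1 (ltW z0)) -powRrM mulN1r.
rewrite !zV opprK (powRDp a (- b) z0).
have e1 : z `^ a * z `^ (- a) = 1 by rewrite -powRDp // subrr powRr0.
have e2 : z `^ (- b) * z `^ b = 1 by rewrite -powRDp // addNr powRr0.
move: (z `^ a) (z `^ (- a)) (z `^ b) (z `^ (- b)) e1 e2 => A A' B B' e1 e2.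
move: (rt Q z `^ a) (rt Q z `^ (- b)) => X Y.
have -> : A * B' * (S * (X * A') + T * (Y * B)) = S * (B' * X) * (A * A') + T * (A * Y) * (B' * B) by ring.
by rewrite e1 e2 !mulr1.
Qed.

Let GE0 z : 0 < z ->
  G z = S * (z `^ (- b) * rt 4 z `^ a) + T * (z `^ a * rt 4 z `^ (- b)) -
  (S * (z `^ (- b) * rt P z `^ a) + T * (z `^ a * rt P z `^ (- b))).
Proof.
move=> z0; rewrite /G mulrBr; congr (_ - _); apply: Gkey => //.
exact: ltW.
Qed.

Let GE z : 0 < z -> G z = (S * h1 4 z - T * h2 4 z) - (S * h1 P z - T * h2 P z).
Proof.
move=> /GE0 ->; rewrite /gap1 /gap2.
move: (rt 4 z `^ a) (rt 4 z `^ (- b)) (rt P z `^ a) (rt P z `^ (- b)) => X Y X' Y'.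
move: (z `^ a) (z `^ (- b)) => A B; ring.
Qed.

Let Gp Q z : R := S * h1 Q z + (- T) * h2 Q z.

Let int_gaps Q : 0 < Q -> hlintegrable (Gp Q) /\
  hlint (Gp Q) = sq Q `^ (1 + a - b) * (S * hlint (h1 1) - T * hlint (h2 1)).
Proof.
move=> Q0; have [i1 e1 i2 e2] := hlint_h Q0.
split; first exact: hlintegrable_lincomb.
apply: (etrans (hlint_lincomb S (- T) i1 i2)).
apply: (etrans (congr2 (fun u v => S * u + - T * v) e1 e2)).
by move: (hlint (h1 1)) (hlint (h2 1)) (sq Q `^ _) => u v w; ring.
Qed.

Let GE' z : 0 < z -> G z = 1 * Gp 4 z + (- 1) * Gp P z.
Proof.
move=> /GE ->; rewrite /Gp.
by move: (h1 4 z) (h2 4 z) (h1 P z) (h2 P z) => u v u' v'; ring.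
Qed.

Let int_G : hlintegrable G.
Proof.
have [i4 _] := int_gaps (ltr0n R 4); have [iP _] := int_gaps P0.
apply: eq_hlintegrable (hlintegrable_lincomb 1 (- 1) i4 iP) => z z0.
exact: (esym (GE' z0)).
Qed.

Let ab1 : 0 <= 1 + a - b.
Proof. by have a0' := a0; have b1' := b1; lra. Qed.

Let hlint_G : 0 <= hlint G.
Proof.
have [i4 e4] := int_gaps (ltr0n R 4); have [iP eP] := int_gaps P0.
have -> : hlint G = (sq 4 `^ (1 + a - b) - sq P `^ (1 + a - b)) *
    (S * hlint (h1 1) - T * hlint (h2 1)).
  apply: (etrans (eq_hlint GE')); apply: (etrans (hlint_lincomb 1 (- 1) i4 iP)).
  apply: (etrans (congr2 (fun u v => 1 * u + - 1 * v) e4 eP)).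
  by move: (S * _ - _) (sq 4 `^ _) (sq P `^ _) => u v w; ring.
apply: mulr_ge0; last by rewrite subr_ge0; exact: ST.
by rewrite subr_ge0; apply: powR_le; [exact: sq_gt0|exact: powR_le|exact: ab1].
Qed.

Let cG z : 0 < z -> {for z, continuous G}.
Proof.
move=> z0; have P0' := ltW P0.
have cb Q : 0 <= Q -> {for z, continuous (fun z => bipow a b S T (rt Q z / z))}.
  move=> Q0; have cr : {for z, continuous (fun z => rt Q z / z)}.
    apply: cvgM; first exact: continuous_rt.
    by apply: cvgV; [rewrite gt_eqF|exact: cvg_id].
  have r0 : 0 < rt Q z / z by rewrite divr_gt0 // rt_gt0.
  have cp r : {for z, continuous (fun z => (rt Q z / z) `^ r)}.
    apply: (@continuous_comp _ _ _ (fun z => rt Q z / z) (fun x => x `^ r)) => //.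
    exact: continuous_powR.
  by apply: cvgD; (apply: cvgM; [exact: cvg_cst|exact: cp]).
apply: cvgM; first exact: continuous_powR.
by apply: cvgB; exact: cb.
Qed.

(* The substitution t = x / sqrt (1 + x) turns sqrt (dist2 P x) into
   sqrt (1 + x) * rt P t. *)
Let F := @pw R (- 1) (2^-1).
Let F' x : R := (1 + x / 2) * pw 0 (3 / 2) x.

Let dF x : 0 < x -> is_derive x 1 F (F' x).
Proof.
move=> x0; apply: (is_derive_eq (is_derive_pw (- 1) (2^-1) x0)).
rewrite /F' opprK addNr mul1r (_ : 2^-1 + 1 = 3 / 2); last by field.
have := @pw_mulx R 0 (3 / 2) x x0; rewrite sub0r => ->.
have := @pw_mul1x R 0 (3 / 2) x x0; rewrite (_ : 3 / 2 - 1 = 2^-1); last by field.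
by move=> ->; move: (pw 0 (3 / 2) x) => z; field.
Qed.

Let F'_gt0 x : 0 < x -> 0 < F' x.
Proof. by move=> x0; rewrite mulr_gt0 ?pw_gt0 //; lra. Qed.

Let cF' x : 0 < x -> {for x, continuous F'}.
Proof.
move=> x0; apply: cvgM; last exact: continuous_pw.
by apply: cvgD; [exact: cvg_cst|apply: cvgM; [exact: cvg_id|exact: cvg_cst]].
Qed.

Let F_at0 : F x @[x --> 0^'+] --> (0 : R).
Proof.
have := @cvg_pw_at0 R 0 (2^-1) ltr01; rewrite sub0r; exact.
Qed.

Let F2 t : 0 < t -> F t ^+ 2 = t * (t / (1 + t)).
Proof.
move=> t0; have t1 : 0 <= 1 + t by lra.
rewrite /F /pw exprMn opprK powRr1 ?(ltW t0) // mulrA -expr2; congr (_ * _).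
by rewrite -powR_mulrn ?powR_ge0 // -powRrM mulNr mulVf // powR_inv1.
Qed.

Let F_pinfty : F x @[x --> +oo%R] --> (+oo : set_system R).
Proof.
apply/cvgryPge => A; near=> x.
have x1 : 1 <= x by near: x; exact: nbhs_pinfty_ge.
have xA : 2 * A ^+ 2 <= x by near: x; apply: nbhs_pinfty_ge; exact: num_real.
have x0 : 0 < x by lra. have x10 : 0 < 1 + x by lra.
have F0 : 0 <= F x by exact: pw_ge0.
rewrite leNgt; apply/negP => FA.
have : F x ^+ 2 < A ^+ 2 by rewrite ltr_pXn2r ?nnegrE //; lra.
rewrite F2 // mulrA -expr2 ltr_pdivrMr //; set B := A ^+ 2 in xA *.
have B0 : 0 <= B by exact: sqr_ge0.
nra.
Unshelve. all: by end_near. Qed.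

Let f x : R := G (F x) * F' x.

(** The square of the ratio is 1 + Q / z^2. *)
Let rt_ratio Q z z' : 0 <= Q -> 0 < z -> z <= z' -> rt Q z' / z' <= rt Q z / z.
Proof.
move=> Q0 z0 zz; have z'0 : 0 < z' by exact: lt_le_trans zz.
have r0 := rt_gt0 Q0 z0; have r'0 := rt_gt0 Q0 z'0.
have q0 : 0 <= rt Q z / z by rewrite divr_ge0 // ltW.
have q'0 : 0 <= rt Q z' / z' by rewrite divr_ge0 // ltW.
rewrite -(@ler_pXn2r _ 2) ?nnegrE //.
have e t : 0 < t -> (rt Q t / t) ^+ 2 = 1 + Q / t ^+ 2.
  by move=> t0; rewrite expr_div_n rt_sq //; field; rewrite gt_eqF.
rewrite (e _ z0) (e _ z'0) lerD2l ler_wpM2l // lef_pV2 ?posrE ?exprn_gt0 //.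
by rewrite ler_pXn2r ?nnegrE // ltW.
Qed.

(** The sign of [G] compares [bipow] at the ratios [rt 4 z / z] and [rt P z / z]. Both ratios
    decrease as [z] grows and the first stays the larger, which is the configuration of
    [bipow_single_crossing]. *)
Let G_crossing z z' : 0 < z -> z <= z' -> G z < 0 -> G z' <= 0.
Proof.
move=> z0 zz; have z'0 : 0 < z' by exact: lt_le_trans zz.
have p0 : 0 < z `^ (a - b) by exact: powR_gt0.
have p'0 : 0 < z' `^ (a - b) by exact: powR_gt0.
have P0' := ltW P0; have le04 := ler0n R 4.
have rt_le t : 0 < t -> rt P t / t <= rt 4 t / t.
  move=> t0; rewrite ler_wpM2r ?invr_ge0 ?(ltW t0) //; apply: powR_le.
  - by rewrite ltr_wpDl ?sqr_ge0.
  - by rewrite lerD2l.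
  - by rewrite invr_ge0 ler0n.
have r0 : 0 < rt P z' / z' by rewrite divr_gt0 // rt_gt0.
have cr := bipow_single_crossing S0 T0 r0 (rt_ratio P0' z0 zz) (rt_le z z0)
  (rt_le z' z'0) (rt_ratio le04 z0 zz).
rewrite /G (pmulr_rlt0 _ p0) (pmulr_rle0 _ p'0) subr_lt0 subr_le0.
exact: cr.
Qed.

Let f_crossing x y : 0 < x -> x < y -> f x < 0 -> f y <= 0.
Proof.
move=> x0 xy; have y0 : 0 < y by exact: lt_trans xy.
have [x10 y10] : 0 < 1 + x /\ 0 < 1 + y by split; lra.
have h : x / (1 + x) <= y / (1 + y).
  by rewrite ler_pdivrMr // mulrAC ler_pdivlMr //; lra.
have hx : 0 <= x / (1 + x) by rewrite divr_ge0 // ltW.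
have P0' := ltW P0.
have Fx0 : 0 < F x by exact: pw_gt0.
have Fy0 : 0 < F y by exact: pw_gt0.
have Fxy : F x <= F y.
  rewrite -(@ler_pXn2r _ 2) ?nnegrE ?(ltW Fx0) ?(ltW Fy0) //.
  by rewrite !F2 //; apply: ler_pM => //; exact: ltW.
move=> fx; have Gx : G (F x) < 0.
  by move: fx; rewrite /f (pmulr_llt0 (G (F x)) (F'_gt0 x0)).
rewrite /f (pmulr_lle0 (G (F y)) (F'_gt0 y0)).
exact: G_crossing Fx0 Fxy Gx.
Qed.

Variable n : nat.
Hypothesis n0 : (0 < n)%N.

(* |1 - (1 + x) z|^2 for |z| = 1 and P = |1 - z|^2 *)
Definition dist2 P x : R := x ^+ 2 + (1 + x) * P.

(** The integrand of U; [dist2 P x] is the square of D, whence the halved exponents. *)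
Definition umaj P x : R :=
  S * (pw b n.+1%:R x * dist2 P x `^ (a / 2)) +
  T * (pw (- a) n.+1%:R x * dist2 P x `^ (- (b / 2))).

Lemma dist2_gt0 Q x : 0 < Q -> 0 < x -> 0 < dist2 Q x.
Proof. by move=> Q0 x0; rewrite addr_gt0 ?exprn_gt0 // mulr_gt0 //; lra. Qed.

Lemma continuous_dist2 Q r x : 0 < Q -> 0 < x -> {for x, continuous (fun x => dist2 Q x `^ r)}.
Proof.
move=> Q0 x0; apply: (@continuous_comp _ _ _ (dist2 Q) (fun x => x `^ r)).
  apply: cvgD; first exact: exprn_continuous.
  by apply: cvgM; [apply: cvgD; [exact: cvg_cst|exact: cvg_id]|exact: cvg_cst].
by apply: continuous_powR; exact: dist2_gt0.
Qed.

Let n1 : 1 <= n%:R :> R. Proof. by rewrite ler1n. Qed.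

Lemma hlintegrable_umaj1 Q : 0 < Q -> Q <= 4 ->
  hlintegrable (fun x => pw b n.+1%:R x * dist2 Q x `^ (a / 2)).
Proof.
move=> Q0 Q4; have a20 : 0 <= a / 2 by rewrite divr_ge0 // ltW.
have i : hlintegrable (pw b (n.+1%:R - a)).
  have [a1' b0' n1'] := And3 a1 b0 n1.
  by apply: hlintegrable_pw => //; rewrite -natr1; lra.
apply: (le_hlintegrable _ _ (hlintegrableZ (4 `^ (a / 2)) i)).
  by apply: measurable_continuous_hl => x x0; apply: cvgM; [exact: continuous_pw|exact: continuous_dist2].
move=> x x0; have x1 : 0 <= 1 + x by lra.
have x10 : 0 < 1 + x by lra.
have D0 := dist2_gt0 Q0 x0.
have DX : dist2 Q x `^ (a / 2) <= 4 `^ (a / 2) * (1 + x) `^ a.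
  have -> : (1 + x) `^ a = ((1 + x) ^+ 2) `^ (a / 2).
    by rewrite -(powR_mulrn 2 x1) -powRrM; congr (_ `^ _); field.
  rewrite -(powRM (a / 2) (ler0n R 4) (sqr_ge0 (1 + x))); apply: powR_le => //.
  rewrite /dist2; have : 0 <= (4 - Q) * (1 + x) by rewrite mulr_ge0 ?subr_ge0.
  by rewrite mulrBl; have := sqr_ge0 x; nra.
rewrite ger0_norm ?mulr_ge0 ?powR_ge0 ?pw_ge0 // (pw_mul1xX b n.+1%:R (- a) x0).
rewrite -mulrA [leRHS]mulrC ler_wpM2l ?pw_ge0 //.
by rewrite powRN mulrC ler_pdivrMr ?powR_gt0.
Qed.

Lemma hlintegrable_umaj2 Q : 0 < Q ->
  hlintegrable (fun x => pw (- a) n.+1%:R x * dist2 Q x `^ (- (b / 2))).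
Proof.
move=> Q0; have b20 : 0 <= b / 2 by rewrite divr_ge0 // ltW.
have i : hlintegrable (pw (b - a) n.+1%:R).
  have [a1' [a0' [b1' [b0' n1']]]] := conj a1 (conj a0 (conj b1 (conj b0 n1))).
  by apply: hlintegrable_pw => //; rewrite -?natr1; lra.
apply: (le_hlintegrable _ _ i).
  by apply: measurable_continuous_hl => x x0; apply: cvgM; [exact: continuous_pw|exact: continuous_dist2].
move=> x x0; rewrite ger0_norm ?mulr_ge0 ?powR_ge0 ?pw_ge0 //.
have -> : pw (b - a) n.+1%:R x = pw (- a) n.+1%:R x * (x ^+ 2) `^ (- (b / 2)).
  rewrite -(powR_mulrn 2 (ltW x0)) -powRrM /pw mulrAC -powRDp //.
  by congr (_ `^ _ * _); field.
rewrite ler_wpM2l ?pw_ge0 //; apply: powRN_le => //; first exact: exprn_gt0.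
by rewrite /dist2 lerDl mulr_ge0 //; [lra|exact: ltW].
Qed.

Lemma hlintegrable_umaj Q : 0 < Q -> Q <= 4 -> hlintegrable (umaj Q).
Proof.
move=> Q0 Q4; apply: hlintegrable_lincomb; first exact: hlintegrable_umaj1.
exact: hlintegrable_umaj2.
Qed.

(** The exponent for which [W], the Jacobian [F'] and the factor (1 + x)^((b-a)/2) released by the
    substitution multiply to (1 + x)^-(n+1). It is nonnegative since n >= 1 and a - b < 1, so [W]
    decreases. *)
Let k : R := n%:R - 2^-1 - (a - b) / 2.
Let W x : R := (1 + x) `^ (- k) / (1 + x / 2).

Let k0 : 0 <= k.
Proof.
have [a1' [b0' n1']] := conj a1 (conj b0 n1).
by rewrite /k; lra.
Qed.

Let F_powR x r : 0 < x -> F x `^ r = x `^ r * (1 + x) `^ (- (r / 2)).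
Proof.
move=> x0; have x1 : 0 <= 1 + x by lra.
rewrite /F /pw opprK powRr1 ?(ltW x0) // powRM ?powR_ge0 ?(ltW x0) // -powRrM.
by congr (_ * _ `^ _); field.
Qed.

Let rtF_powR Q x r : 0 < Q -> 0 < x ->
  rt Q (F x) `^ r = dist2 Q x `^ (r / 2) * (1 + x) `^ (- (r / 2)).
Proof.
move=> Q0 x0; have x1 : 0 < 1 + x by lra.
have D0 := dist2_gt0 Q0 x0.
have e : F x ^+ 2 + Q = dist2 Q x * (1 + x) `^ (- 1).
  by rewrite F2 // powR_inv1 ?(ltW x1) // /dist2; field; rewrite gt_eqF.
rewrite /rt e powRM ?powR_ge0 ?(ltW D0) // powRM ?powR_ge0 // -!powRrM.
by congr (_ `^ _ * _ `^ _); field.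
Qed.

Let Fterms Q x : 0 < Q -> 0 < x ->
  S * (F x `^ (- b) * rt Q (F x) `^ a) + T * (F x `^ a * rt Q (F x) `^ (- b)) =
  (1 + x) `^ ((b - a) / 2) * (S * (x `^ (- b) * dist2 Q x `^ (a / 2)) +
     T * (x `^ a * dist2 Q x `^ (- (b / 2)))).
Proof.
move=> Q0 x0; have x1 : 0 < 1 + x by lra.
rewrite !F_powR // !rtF_powR //.
have -> : (1 + x) `^ ((b - a) / 2) = (1 + x) `^ (- (- b / 2)) * (1 + x) `^ (- (a / 2)).
  by rewrite -powRDp //; congr (_ `^ _); field.
rewrite [- b / 2]mulNr.
set u := (1 + x) `^ (- - (b / 2)); set v := (1 + x) `^ (- (a / 2)).
set X := dist2 Q x `^ (a / 2); set Y := dist2 Q x `^ (- (b / 2)).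
move: u v X Y (x `^ (- b)) (x `^ a) => u v X Y A B.
by ring.
Qed.

Let WfE x : 0 < x -> W x * f x = umaj 4 x - umaj P x.
Proof.
move=> x0; have x1 : 0 < 1 + x by lra.
have Fx0 : 0 < F x by exact: pw_gt0.
have W' : W x * F' x * (1 + x) `^ ((b - a) / 2) = (1 + x) `^ (- n.+1%:R).
  rewrite /W /F' /pw oppr0 powRr0 mul1r.
  have -> : (1 + x) `^ (- n.+1%:R) =
     (1 + x) `^ (- k) * (1 + x) `^ (- (3 / 2)) * (1 + x) `^ ((b - a) / 2).
    by rewrite -!powRDp //; congr (_ `^ _); rewrite /k -natr1; field.
  move: ((1 + x) `^ (- k)) ((1 + x) `^ (- (3 / 2))) ((1 + x) `^ ((b - a) / 2)) => u v w; field.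
  by rewrite gt_eqF //; lra.
pose V Q := S * (x `^ (- b) * dist2 Q x `^ (a / 2)) + T * (x `^ a * dist2 Q x `^ (- (b / 2))).
pose w := (1 + x) `^ ((b - a) / 2).
have e : G (F x) = w * V 4 - w * V P :=
  etrans (GE0 Fx0) (congr2 (fun u v => u - v) (Fterms (ltr0n R 4) x0) (Fterms P0 x0)).
have -> : W x * f x = W x * F' x * w * (V 4 - V P).
  have -> : W x * f x = W x * (G (F x) * F' x) by [].
  by rewrite {}e; move: (W x) (F' x) w (V 4) (V P) => u v w' u' v'; ring.
rewrite /w W' /V /umaj /pw opprK.
set X := dist2 4 x `^ (a / 2); set Y := dist2 4 x `^ _.
set X' := dist2 P x `^ (a / 2); set Y' := dist2 P x `^ _.
move: ((1 + x) `^ _) (x `^ (- b)) (x `^ a) X Y X' Y' => w' A B X Y X' Y'.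
by ring.
Qed.

Lemma hlint_umaj_le : hlint (umaj P) <= hlint (umaj 4).
Proof.
have i4 : hlintegrable (umaj 4) by exact: hlintegrable_umaj.
have iP : hlintegrable (umaj P) by exact: hlintegrable_umaj.
have [if_ ef] := hl_subst dF F'_gt0 cF' F_at0 F_pinfty cG int_G.
have iWf : hlintegrable (fun x => W x * f x).
  by apply: eq_hlintegrable (hlintegrableB i4 iP) => x x0; rewrite WfE.
rewrite -subr_ge0 -(hlintB i4 iP) -(eq_hlint WfE).
apply: (hlint_crossing (C := 1) if_ iWf).
- move=> x y x0 xy; have y0 : 0 < y by lra.
  have [x1 y1] : 0 < 1 + x /\ 1 + x <= 1 + y by split; lra.
  have [x2 y2] : 0 < 1 + x / 2 /\ 1 + x / 2 <= 1 + y / 2 by split; lra.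
  apply: ler_pM; rewrite ?powR_ge0 ?invr_ge0 //.
  + by lra.
  + exact: powRN_le.
  + by rewrite lef_pV2 ?posrE //; lra.
- move=> x x0; have [x1 x2] : 1 <= 1 + x /\ 1 <= 1 + x / 2 by split; lra.
  have x2' : 0 < 1 + x / 2 by lra.
  rewrite /W divr_ge0 ?powR_ge0 ?(ltW x2') //= ler_pdivrMr // mul1r.
  apply: le_trans x2; rewrite -[leRHS](powRr0 (1 + x)); apply: ler_powR => //.
  by rewrite oppr_le0; exact: k0.
- exact: f_crossing.
- by rewrite -ef; exact: hlint_G.
Qed.

End MaxAtMinusOne.

Local Open Scope complex_scope.
Local Notation Re := complex.Re.
Local Notation Im := complex.Im.

(** * The integral representation *)

Section ComplexKernel.
Context {R : realType}.
Local Notation C := R[i].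
Implicit Types (z u w : C) (x y r : R).

Lemma ReD z u : Re (z + u) = Re z + Re u. Proof. by move: z u => [a b] [c d]; exact: erefl. Qed.
Lemma ReN z : Re (- z) = - Re z. Proof. by move: z => [a b]; exact: erefl. Qed.
Lemma ReB z u : Re (z - u) = Re z - Re u. Proof. by rewrite ReD ReN. Qed.
Lemma ReM r z : Re (r%:C * z) = r * Re z.
Proof. by case: z => a b; change (r * a - 0 * b = r * a); rewrite mul0r subr0. Qed.
Lemma Re_sum (I : finType) (F : I -> C) : Re (\sum_i F i) = \sum_i Re (F i).
Proof. exact: (big_morph _ ReD (erefl : Re (0 : C) = 0)). Qed.

Definition kre z u r x : R := Re (u / ((1 + x)%:C - r%:C * z)).

Lemma kre_res1 (c g : R) u r x :
  kre (c +i* g) u r x = res1 (Re u) (Im u) (1 - r * c) (- (r * g)) x.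
Proof.
rewrite /kre (_ : (1 + x)%:C - r%:C * (c +i* g) = (x + (1 - r * c)) +i* (- (r * g))); last first.
  by apply/eqP; rewrite eq_complex /=; apply/andP; split; apply/eqP; ring.
case: u => u1 u2; rewrite /res1 /den.
set p := x + _; set q := - (r * g).
change (u1 * (p / (p ^+ 2 + q ^+ 2)) - u2 * (- (q / (p ^+ 2 + q ^+ 2))) =
  (u1 * p + u2 * q) / (p ^+ 2 + q ^+ 2)).
by move: (_ ^+ 2 + _ ^+ 2) => D; ring.
Qed.

Lemma kre_neq0 (c g : R) r x : c ^+ 2 + g ^+ 2 = 1 -> c < 1 -> 0 <= r -> 0 < x ->
  (1 + x)%:C - r%:C * (c +i* g) != 0.
Proof.
move=> cg c1 r0 x0.
have r2 : - 2^-1 < r by lra.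
have d0 : 0 < (1 - c) / 8 by rewrite divr_gt0 ?subr_gt0.
have lb := den_lower cg c1 r2 (ltW x0).
have D0 : 0 < den (1 - r * c) (- (r * g)) x.
  by apply: lt_le_trans lb; rewrite mulr_gt0 // exprn_gt0 //; lra.
apply/negP => /eqP h.
have e1 : x + (1 - r * c) = 0.
  by move: (congr1 (@Re R) h) => /= <-; ring.
have e2 : r * g = 0.
  by move: (congr1 (@Im R) h) => /=; lra.
by move: D0; rewrite /den e1 e2 oppr0 !expr0n addr0 ltxx.
Qed.

(** For X = 1 + x and Y = 1 + y, the powers on the left are those whose integrals against x^-b y^a
    are the beta integrals of the coefficients. The sum stops at k = n - 1, as k = n would bring in
    the divergent integral of y^a / Y. *)
Lemma geometric_kernel (n : nat) z u (X Y : R) : X != 0 -> Y != 0 ->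
  X%:C - Y%:C * z != 0 ->
  \sum_(k < n) Re (u * z ^+ k) * (X^-1 ^+ k.+1 * Y^-1 ^+ (n - k).+1) =
  Y^-1 ^+ n.+1 * Re (u / (X%:C - Y%:C * z)) -
  X^-1 ^+ n * (Y^-1 * Re (u * z ^+ n / (X%:C - Y%:C * z))).
Proof.
move=> X0 Y0 D0.
have XC : X%:C != 0 by rewrite (inj_eq (@complexI R)).
have YC : Y%:C != 0 by rewrite (inj_eq (@complexI R)).
(* Without the factor X^-1 Y^-2 there remains the homogeneous sum of degree n - 1 in Y^-1 and X^-1
   z, to which [subrXX] applies. *)
have -> : \sum_(k < n) Re (u * z ^+ k) * (X^-1 ^+ k.+1 * Y^-1 ^+ (n - k).+1) =
  Re (u * (X%:C^-1 * Y%:C^-1 ^+ 2) * \sum_(k < n) Y%:C^-1 ^+ (n.-1 - k) * (X%:C^-1 * z) ^+ k).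
  rewrite big_distrr Re_sum; apply: eq_bigr => k _.
  rewrite mulrC -ReM; congr Re.
  rewrite rmorphM !rmorphXn !fmorphV /= exprMn.
  have -> : (n - k).+1 = ((n.-1 - k) + 2)%N by rewrite -subn1 -subnDA add1n subnS addn2 prednK // subn_gt0.
  rewrite exprD [X%:C^-1 ^+ k.+1]exprS.
  move: (X%:C^-1 ^+ k) (Y%:C^-1 ^+ (n.-1 - k)) (z ^+ k) (X%:C^-1) (Y%:C^-1 ^+ 2).
  by move=> p q s t v; ring.
have E : \sum_(k < n) Y%:C^-1 ^+ (n.-1 - k) * (X%:C^-1 * z) ^+ k =
   X%:C * Y%:C * (Y%:C^-1 ^+ n - X%:C^-1 ^+ n * z ^+ n) / (X%:C - Y%:C * z).
  apply: (mulfI D0); rewrite mulrCA divff // mulr1.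
  have -> : X%:C - Y%:C * z = X%:C * Y%:C * (Y%:C^-1 - X%:C^-1 * z).
    by field; rewrite XC YC.
  by rewrite -(mulrA (X%:C * Y%:C)) -subrXX exprMn.
rewrite E -!ReM -ReB; congr Re.
rewrite !rmorphXn !fmorphV /= [Y%:C^-1 ^+ n.+1]exprS.
move: (Y%:C^-1 ^+ n) (X%:C^-1 ^+ n) (z ^+ n) => p q s; field.
by rewrite D0 XC YC.
Qed.

End ComplexKernel.

Section HlintSum.
Context {R : realType}.

Lemma hlint_sum n (r : nat -> R) (f : nat -> R -> R) :
  (forall k, (k < n)%N -> hlintegrable (f k)) ->
  hlintegrable (fun x => \sum_(k < n) r k * f k x) /\
  hlint (fun x => \sum_(k < n) r k * f k x) = \sum_(k < n) r k * hlint (f k).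
Proof.
elim: n => [|n IHn] intf.
  have i0 : hlintegrable (fun _ : R => 0) by exact: integrable0.
  split; first by apply: eq_hlintegrable i0 => x _; rewrite big_ord0.
  rewrite big_ord0 -[RHS](mul0r (hlint (fun _ => 0))) -(hlintZ 0 i0).
  by apply: eq_hlint => x _; rewrite big_ord0 mul0r.
have [|i e] := IHn; first by move=> k kn; apply: intf; exact: ltnW.
have iz := hlintegrableZ (r n) (intf n (leqnn _)).
have E x : 0 < x -> \sum_(k < n.+1) r k * f k x = \sum_(k < n) r k * f k x + r n * f n x.
  by move=> _; rewrite big_ord_recr.
split; first by apply: eq_hlintegrable (hlintegrableD i iz) => x x0; rewrite E.
by rewrite (eq_hlint E) (hlintD i iz) e (hlintZ _ (intf n (leqnn _))) big_ord_recr.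
Qed.

End HlintSum.

Section Identity.
Context {R : realType}.
Local Notation C := R[i].
Variables (a b c g : R).
Hypotheses (a0 : 0 < a) (a1 : a < 1) (b0 : 0 < b) (b1 : b < 1).
Hypotheses (cg : c ^+ 2 + g ^+ 2 = 1) (c1 : c < 1).
Variables (n : nat) (w : C).
Hypothesis n0 : (0 < n)%N.
Implicit Types (x y : R) (k : nat).

Let z : C := c +i* g.
Let z' : C := c +i* (- g).
Let cg' : c ^+ 2 + (- g) ^+ 2 = 1. Proof. by rewrite sqrrN. Qed.
Let zz' : z * z' = 1.
Proof. by apply/eqP; rewrite eq_complex /=; apply/andP; split; apply/eqP; have := cg; lra. Qed.

Let u : C := w * z ^+ n.
Let q' x : C := 1 - (1 + x)%:C * z'.

(** [K] is the integrand of the geometric sum; [Ka] and [Kb] are its two end terms. Integration in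
    [x] evaluates [Ka], integration in [y] evaluates [Kb], so the order has to be exchanged for [Kb]
    alone. *)
Let Ka x y : R := pw (- a) n.+1%:R y * (x `^ (- b) * kre z w (1 + y) x).
Let Kb x y : R := pw b n%:R x * (pw (- a) 1 y * kre z u (1 + y) x).
Let K x y : R := \sum_(k < n) Re (w * z ^+ k) * (pw b k.+1%:R x * pw (- a) (n - k).+1%:R y).

Let pw_nat (s : R) k x : 0 < x -> pw s k%:R x = x `^ (- s) * (1 + x)^-1 ^+ k.
Proof. by move=> x0; rewrite /pw powR_invn ?exprVn //; lra. Qed.

Let pw_1 (s : R) x : 0 < x -> pw s 1 x = x `^ (- s) * (1 + x)^-1.
Proof. by move=> x0; rewrite (pw_nat s 1) // expr1. Qed.

Let KE x y : 0 < x -> 0 < y -> K x y = Ka x y - Kb x y.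
Proof.
move=> x0 y0; have X0 : 1 + x != 0 by rewrite gt_eqF //; lra.
have Y0 : 1 + y != 0 by rewrite gt_eqF //; lra.
have Y0' : 0 <= 1 + y by lra.
have D0 := kre_neq0 cg c1 Y0' x0.
have := geometric_kernel n w X0 Y0 D0.
rewrite -/z -/u -/(kre z w (1 + y) x) -/(kre z u (1 + y) x) => G.
have -> : K x y = x `^ (- b) * y `^ a *
   (\sum_(k < n) Re (w * z ^+ k) * ((1 + x)^-1 ^+ k.+1 * (1 + y)^-1 ^+ (n - k).+1)).
  rewrite mulr_sumr; apply: eq_bigr => k _.
  rewrite !pw_nat // opprK.
  move: (x `^ (- b)) (y `^ a) (Re _) (_ ^+ k.+1) (_ ^+ (n - k).+1) => A B r s t.
  by ring.
rewrite G /Ka /Kb pw_1 // !pw_nat // opprK.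
move: (x `^ (- b)) (y `^ a) (kre z w _ _) (kre z u _ _) => A B r s.
by ring.
Qed.

(** As z conj z = 1, X - Y z = -z (Y - X conj z): the kernel in [x] becomes a kernel in [y] at the
    conjugate point. *)
Let kre_swap v x y : 0 < x -> 0 < y -> kre z v (1 + y) x = - kre z' (v * z') (1 + x) y.
Proof.
move=> x0 y0; have Y0' : 0 <= 1 + y by lra. have X0' : 0 <= 1 + x by lra.
have D0 := kre_neq0 cg c1 Y0' x0; have D0' := kre_neq0 cg' c1 X0' y0.
rewrite /kre -ReN; congr Re.
move: D0 D0'; rewrite -/z -/z'; move: ((1 + x)%:C) ((1 + y)%:C) => X Y D0 D0'.
have -> : X - Y * z = - z * (Y - X * z').
  by transitivity (X * (z * z') - Y * z); [rewrite zz' mulr1|ring].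
have z0 : z != 0 by apply/eqP => z0; move/eqP: zz'; rewrite z0 mul0r eq_sym oner_eq0.
have -> : v / (- z * (Y - X * z')) = - (v * z^-1 / (Y - X * z')).
  by field; rewrite D0' z0.
by congr (- (v * _ / _)); apply: (mulfI z0); rewrite divff // zz'.
Qed.

(** With q = [q' x] and Y - X conj z = y + q, this is y (1 - q) / ((1 + y) (y + q)) = 1 / (1 + y) -
    q / (y + q). Against y^(a-1) both fractions are integrable; the first accounts for the
    coefficient k = n, the second has a transform of modulus proportional to |q|^a. *)
Let kre_partial_fraction x y : 0 < x -> 0 < y ->
  pw (- a) 1 y * kre z u (1 + y) x =
  - (1 + x)^-1 * (Re u * pw (1 - a) 1 y - y `^ (- (1 - a)) * kre z' (u * q' x) (1 + x) y).
Proof.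
move=> x0 y0; have X0' : 0 <= 1 + x by lra.
have X0 : 1 + x != 0 by rewrite gt_eqF //; lra.
have Y0 : 1 + y != 0 by rewrite gt_eqF //; lra.
have D0' := kre_neq0 cg' c1 X0' y0.
rewrite kre_swap // !pw_1 // opprK.
have -> : y `^ a = y * y `^ (- (1 - a)).
  by rewrite -{2}(powRr1 (ltW y0)) -powRDp //; congr (_ `^ _); ring.
move: (y `^ _) => A.
have E : (y / (1 + y)) * ((1 + x) * kre z' (u * z') (1 + x) y) =
    Re u * (1 + y)^-1 - kre z' (u * q' x) (1 + x) y.
  rewrite [Re u * _]mulrC -!ReM -ReB; congr Re; rewrite /q' -/z'.
  move: D0'; rewrite -/z' !rmorphM !fmorphV /= rmorphD /=.
  have YC : 1 + y%:C != 0 by rewrite -(rmorphD (real_complex R) 1 y) (inj_eq (@complexI R)).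
  move: ((1 + x)%:C) (y%:C) YC => X Y YC D0'.
  by field; rewrite YC D0'.
have -> : kre z' (u * z') (1 + x) y =
    (1 + x)^-1 * ((1 + y) / y * (Re u * (1 + y)^-1 - kre z' (u * q' x) (1 + x) y)).
  by rewrite -E; field; rewrite X0 Y0 gt_eqF.
move: (kre z' (u * q' x) (1 + x) y) => r; field.
by rewrite X0 Y0 gt_eqF.
Qed.

Let kre_resint v x y : kre z v (1 + y) x = res1 (Re v) (Im v) (1 - (1 + y) * c) (- ((1 + y) * g)) x.
Proof. exact: kre_res1. Qed.

Let kre_resint' v x y : kre z' v (1 + x) y = res1 (Re v) (Im v) (1 - (1 + x) * c) (- ((1 + x) * - g)) y.
Proof. exact: kre_res1. Qed.

Let d : R := (1 - c) / 8.
Let d0 : 0 < d. Proof. by rewrite divr_gt0 // subr_gt0. Qed.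

Let lb r x : 0 <= r -> 0 < x -> d * (1 + x) ^+ 2 <= den (1 - r * c) (- (r * g)) x.
Proof.
by move=> r0 x0; apply: (den_lower cg c1 _ (ltW x0)); apply: lt_le_trans r0; rewrite oppr_lt0 invr_gt0.
Qed.

Let lb' r x : 0 <= r -> 0 < x -> d * (1 + x) ^+ 2 <= den (1 - r * c) (- (r * - g)) x.
Proof.
by move=> r0 x0; apply: (den_lower cg' c1 _ (ltW x0)); apply: lt_le_trans r0; rewrite oppr_lt0 invr_gt0.
Qed.

Let V : R := (`|Re (u * z')| + `|Im (u * z')|) * (1 + d^-1).

(** The kernel is estimated in its swapped form, where it decays like 1 / (1 + y) uniformly in [x];
    without this decay y^a / (1 + y) would not be integrable. *)
Let Kb_bound x y : 0 < x -> 0 < y -> `|Kb x y| <= pw b n%:R x * (V * pw (- a) 2 y).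
Proof.
move=> x0 y0; have X0' : 0 <= 1 + x by lra. have y10 : 0 <= 1 + y by lra.
rewrite normrM [`|pw _ _ _|]ger0_norm ?pw_ge0 // ler_wpM2l ?pw_ge0 //.
rewrite normrM [`|pw _ _ _|]ger0_norm ?pw_ge0 // kre_swap // normrN kre_resint'.
have h := norm_res1 d0 (fun y => lb' X0') (Re (u * z')) (Im (u * z')) y0.
apply: (@le_trans _ _ (pw (- a) 1 y * (V * (1 + y) `^ (- 1)))).
  by rewrite ler_wpM2l ?pw_ge0.
have -> : pw (- a) 2 y = pw (- a) 1 y * (1 + y) `^ (- 1).
  rewrite /pw -mulrA -powRDp; last by lra.
  by congr (_ * _ `^ _); ring.
by rewrite mulrCA.
Qed.

Let pw_b k : hlintegrable (pw b k.+1%:R).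
Proof.
have k0 : 0 <= k%:R :> R by exact: ler0n.
have b0' := b0; apply: hlintegrable_pw => //; rewrite -natr1; lra.
Qed.

Let pw_a k : (0 < k)%N -> hlintegrable (pw (- a) k.+1%:R).
Proof.
move=> k0; have k1 : 1 <= k%:R :> R by rewrite ler1n.
have [a0' a1'] := conj a0 a1.
by apply: hlintegrable_pw; rewrite -?natr1; lra.
Qed.

Let measurable_pw s t : measurable_fun setT (@pw R s t).
Proof.
apply: measurable_funM; apply: measurable_powR_fun => //.
exact: measurable_funD.
Qed.

Let mKb : measurable2 Kb.
Proof.
have m1 : measurable2 (fun y _ : R => y) by apply: (@measurable2_fst _ id).
have m2 : measurable2 (fun _ y : R => y) by apply: (@measurable2_snd _ id).
apply: measurable_funM; first exact: (measurable2_fst (measurable_pw b n%:R)).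
apply: measurable_funM; first exact: (measurable2_snd (measurable_pw (- a) 1)).
rewrite (_ : (fun t => kre z u (1 + t.2) t.1) = fun t : measurableTypeR R * measurableTypeR R =>
    res1 (Re u) (Im u) (1 - (1 + t.2) * c) (- ((1 + t.2) * g)) t.1); last first.
  by apply/funext => t; exact: kre_resint.
have mA : measurable2 (fun x y => x + (1 - (1 + y) * c)).
  apply: measurable_funD => //; apply: measurable_funB => //.
  by apply: measurable_funM => //; exact: measurable_funD.
have mB : measurable2 (fun _ y => - ((1 + y) * g)).
  apply: measurable_funN; apply: measurable_funM => //.
  exact: measurable_funD.
have mN : measurable2 (fun x y => Re u * (x + (1 - (1 + y) * c)) + Im u * (- ((1 + y) * g))).
  apply: measurable_funD.
    by apply: (measurable_funM (f := fun=> Re u)) => //; exact: mA.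
  by apply: (measurable_funM (f := fun=> Im u)) => //; exact: mB.
apply: (measurable_funM mN).
apply: measurable_inv_fun; apply: measurable_funD.
  exact: (measurable_funX 2 mA).
exact: (measurable_funX 2 mB).
Qed.

Let V_pw2 : hlintegrable (fun y => V * pw (- a) 2 y).
Proof. by apply: hlintegrableZ; exact: (pw_a (ltn0Sn 0)). Qed.

Let pw_bn : hlintegrable (pw b n%:R).
Proof. by rewrite -(prednK n0); exact: pw_b. Qed.

Let fub := fubini_hl mKb pw_bn V_pw2 Kb_bound.
Let Kb_bound_sw y x : 0 < y -> 0 < x -> `|Kb x y| <= (V * pw (- a) 2 y) * pw b n%:R x.
Proof. by move=> y0 x0; rewrite mulrC; exact: Kb_bound. Qed.
Let fub' := fubini_hl (measurable2_swap mKb) V_pw2 pw_bn Kb_bound_sw.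

Let IA y : R := pw (- a) n.+1%:R y * resint c g b (Re w) (Im w) (1 + y).
Let IB x : R := pw b n.+1%:R x *
  resint c (- g) (1 - a) (Re (u * q' x)) (Im (u * q' x)) (1 + x).

Let KaE y : 0 < y -> hlintegrable (Ka^~ y) /\ hlint (Ka^~ y) = IA y.
Proof.
move=> y0; have Y0 : 0 <= 1 + y by lra.
have i := hlintegrable_res1 d0 (fun x => lb Y0) b0 b1 (Re w) (Im w).
have E x : 0 < x -> pw (- a) n.+1%:R y * (x `^ (- b) * res1 (Re w) (Im w)
    (1 - (1 + y) * c) (- ((1 + y) * g)) x) = Ka x y.
  by move=> _; rewrite /Ka kre_resint.
split; first exact: eq_hlintegrable E (hlintegrableZ _ i).
by rewrite -(eq_hlint E) (hlintZ _ i).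
Qed.

Let bt : R := beta_int (1 - a) 1.

Let a1_gt0 : 0 < 1 - a. Proof. by rewrite subr_gt0. Qed.
Let a1_lt1 : 1 - a < 1. Proof. by rewrite ltrBlDr ltrDl. Qed.

Let KbE x : 0 < x -> hlint (Kb x) = IB x - Re u * bt * pw b n.+1%:R x.
Proof.
move=> x0; have X0 : 0 <= 1 + x by lra.
have i := hlintegrable_res1 d0 (fun y => lb' X0) a1_gt0 a1_lt1 (Re (u * q' x)) (Im (u * q' x)).
have i1 : hlintegrable (pw (1 - a) 1) by apply: hlintegrable_pw; rewrite // ltrDr.
have E y : 0 < y -> Kb x y = (- (pw b n%:R x * (1 + x)^-1)) * (Re u * pw (1 - a) 1 y +
    (-1) * (y `^ (- (1 - a)) * res1 (Re (u * q' x)) (Im (u * q' x))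
       (1 - (1 + x) * c) (- ((1 + x) * - g)) y)).
  move=> y0; rewrite /Kb (kre_partial_fraction x0 y0) kre_resint'.
  by move: (pw b n%:R x) (pw (1 - a) 1 y) (y `^ _) (res1 _ _ _ _ _) => r s t v; ring.
have j := hlintegrable_lincomb (Re u) (-1) i1 i.
apply: (etrans (eq_hlint E)); apply: (etrans (hlintZ _ j)).
apply: (etrans (congr1 (fun t => _ * t) (hlint_lincomb (Re u) (-1) i1 i))).
have -> : pw b n%:R x * (1 + x)^-1 = pw b n.+1%:R x.
  by rewrite (pw_nat b n x0) (pw_nat b n.+1 x0) exprSr mulrA.
rewrite /IB /resint -/(beta_int (1 - a) 1) -/bt.
by move: (pw b _ _) (hlint _) bt (Re u) => r s t v; ring.
Qed.

Let coef k : R := Re (w * z ^+ k) * beta_int b k.+1%:R.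

Let KE2 y : 0 < y -> hlintegrable (K^~ y) /\
  hlint (K^~ y) = \sum_(k < n) coef k * pw (- a) (n - k).+1%:R y.
Proof.
move=> y0.
have [i e] := @hlint_sum R n (fun k => Re (w * z ^+ k) * pw (- a) (n - k).+1%:R y)
  (fun k => pw b k.+1%:R) (fun k _ => pw_b k).
have E x : 0 < x -> \sum_(k < n) Re (w * z ^+ k) * pw (- a) (n - k).+1%:R y * pw b k.+1%:R x = K x y.
  move=> _; apply: eq_bigr => k _.
  by move: (Re _) (pw (- a) _ _) (pw b _ _) => r s t; ring.
split; first exact: eq_hlintegrable E i.
rewrite -(eq_hlint E) e; apply: eq_bigr => k _.
by rewrite /coef /beta_int; move: (Re _) (pw (- a) _ _) (hlint _) => r s t; ring.
Qed.

Let total := @hlint_sum R n coef (fun k => pw (- a) (n - k).+1%:R)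
  (fun k kn => pw_a (etrans (subn_gt0 k n) kn)).

Let Kb_y : hlintegrable (fun y => hlint (fun x => Kb x y)).
Proof. by case: fub'. Qed.

Let IA_split y : 0 < y ->
  (\sum_(k < n) coef k * pw (- a) (n - k).+1%:R y) + hlint (fun x => Kb x y) = IA y.
Proof.
move=> y0; have [iK <-] := KE2 y0; have [iKa <-] := KaE y0.
have iKb : hlintegrable (fun x => Kb x y).
  exact: (fubini_hl_section (measurable2_swap mKb) pw_bn Kb_bound_sw).
by rewrite -(hlintD iK iKb); apply: eq_hlint => x x0; rewrite KE // subrK.
Qed.

(** K = Ka - Kb is integrated in [x] and then in [y], and the order is exchanged in the double
    integral of [Kb]. The fraction 1 / (1 + y) split off from [Kb] becomes the subtracted term with
    z^n. *)
Lemma kernel_identity :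
  [/\ hlintegrable IA, hlintegrable IB &
    \sum_(k < n) Re (w * z ^+ k) * (beta_int b k.+1%:R * beta_int (- a) (n - k).+1%:R)
      - Re (w * z ^+ n) * (beta_int (1 - a) 1 * beta_int b n.+1%:R) = hlint IA - hlint IB].
Proof.
have [iS eS] := total; have [ix exy] := fub.
have iIA : hlintegrable IA by exact: eq_hlintegrable IA_split (hlintegrableD iS Kb_y).
have E x : 0 < x -> hlint (Kb x) + Re u * bt * pw b n.+1%:R x = IB x.
  by move=> x0; apply: (etrans (congr1 (fun t => t + _) (KbE x0))); exact: subrK.
have iz := hlintegrableZ (Re u * bt) (pw_b n).
have iIB : hlintegrable IB by exact: eq_hlintegrable E (hlintegrableD ix iz).
split; [exact: iIA|exact: iIB|].
have eA : hlint IA = \sum_(k < n) coef k * beta_int (- a) (n - k).+1%:R + hlint (fun x => hlint (Kb x)).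
  by rewrite -(eq_hlint IA_split) (hlintD iS Kb_y) eS exy.
have eB : hlint IB = hlint (fun x => hlint (Kb x)) + Re u * bt * beta_int b n.+1%:R.
  by rewrite -(eq_hlint E) (hlintD ix iz) (hlintZ _ (pw_b n)).
rewrite eA eB -/u -/bt.
have -> : \sum_(k < n) Re (w * z ^+ k) * (beta_int b k.+1%:R * beta_int (- a) (n - k).+1%:R) =
   \sum_(k < n) coef k * beta_int (- a) (n - k).+1%:R.
  by apply: eq_bigr => k _; rewrite /coef mulrA.
by move: (\sum_(k < n) _) (hlint _) (Re u) bt (beta_int b _) => r s t v p; ring.
Qed.

End Identity.

(** * The modulus bound *)

Section ResolventBound.
Context {R : realType}.
Implicit Types c g s r v m : R.

Lemma ler_of_sqr (r m : R) : 0 <= m -> r ^+ 2 <= m ^+ 2 -> `|r| <= m.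
Proof. by move=> m0 h; rewrite -(ler_pXn2r (ltn0Sn 1)) ?nnegrE //= -normrX ger0_norm // sqr_ge0. Qed.

Lemma powR_half_sqr (r s : R) : (r `^ (s / 2)) ^+ 2 = r `^ s.
Proof. by rewrite -powR_mulrn ?powR_ge0 // -powRrM; congr (_ `^ _); field. Qed.

Lemma resint_sqr c g s r : c ^+ 2 + g ^+ 2 = 1 -> c < 1 -> 0 < s -> s < 1 -> 0 <= r ->
  resint c g s 1 0 r ^+ 2 + resint c g s 0 1 r ^+ 2 =
    (beta_int s 1 * sqdist c r `^ (- s / 2)) ^+ 2.
Proof.
move=> cg c1 s0 s1 r0; have r2 : - 2^-1 < r by apply: lt_le_trans r0; rewrite oppr_lt0 invr_gt0.
have Q0 := sqdist_gt0 cg c1 r2.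
rewrite exprMn powR_half_sqr powRN -(resint_modulus cg c1 s0 s1 r0) mulfK //.
by rewrite gt_eqF // powR_gt0.
Qed.

(** Cauchy-Schwarz for the real and imaginary parts; the exponent is halved because [sqdist] is a
    squared modulus. *)
Lemma resint_bound c g s v1 v2 m r : c ^+ 2 + g ^+ 2 = 1 -> c < 1 -> 0 < s -> s < 1 ->
  0 <= r -> 0 <= m -> v1 ^+ 2 + v2 ^+ 2 = m ^+ 2 ->
  `|resint c g s v1 v2 r| <= m * (beta_int s 1 * sqdist c r `^ (- s / 2)).
Proof.
move=> cg c1 s0 s1 r0 m0 vm; have r2 : - 2^-1 < r by apply: lt_le_trans r0; rewrite oppr_lt0 invr_gt0.
have B0 := ltW (beta_int_gt0 s1 (ltr_pwDl s0 (lexx 1))).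
apply: ler_of_sqr; first by rewrite !mulr_ge0 ?powR_ge0.
rewrite exprMn -vm -(resint_sqr cg c1 s0 s1 r0) (resint_linear cg c1 s0 s1 _ _ r2).
move: (resint _ _ _ 1 0 r) (resint _ _ _ 0 1 r) => x y.
rewrite -subr_ge0.
have -> : (v1 ^+ 2 + v2 ^+ 2) * (x ^+ 2 + y ^+ 2) - (v1 * x + v2 * y) ^+ 2 = (v1 * y - v2 * x) ^+ 2 by ring.
exact: sqr_ge0.
Qed.

(* On the negative real axis the integrand is real and the bound is attained. *)
Lemma resint_negative_axis s v1 r : 0 < s -> s < 1 -> 0 <= r ->
  resint (- 1) 0 s v1 0 r = v1 * (beta_int s 1 * sqdist (- 1) r `^ (- s / 2)).
Proof.
move=> s0 s1 r0; have r2 : - 2^-1 < r by apply: lt_le_trans r0; rewrite oppr_lt0 invr_gt0.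
have cg : (- 1) ^+ 2 + 0 ^+ 2 = 1 :> R by ring.
have c1 : - 1 < 1 :> R by lra.
have B0 := ltW (beta_int_gt0 s1 (ltr_pwDl s0 (lexx 1))).
rewrite (resint_linear cg c1 s0 s1 _ _ r2) mul0r addr0; congr (_ * _).
have h := resint_sqr cg c1 s0 s1 r0.
have z0 : resint (- 1) 0 s 0 1 r = 0.
  have i0 : hlintegrable (fun _ : R => 0) by exact: integrable0.
  rewrite /resint -[RHS](mul0r (hlint (fun _ => 0))) -(hlintZ 0 i0).
  by apply: eq_hlint => x _; rewrite /res1 !mulr0 oppr0 mulr0 mul0r addr0 mul0r mulr0.
rewrite z0 expr0n addr0 in h.
have C0 : 0 <= resint (- 1) 0 s 1 0 r.
  apply: hlint_ge0 => x x0; rewrite mulr_ge0 ?powR_ge0 //= /res1 mul0r addr0 mul1r.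
  rewrite divr_ge0 ?addr_ge0 ?sqr_ge0 //; first exact: ltW.
  by lra.
by apply/eqP; rewrite -(@eqrXn2 _ 2) ?h // mulr_ge0 ?powR_ge0.
Qed.

End ResolventBound.

Section KernelSum.
Context {R : realType}.
Local Notation C := R[i].
Implicit Types (a b c g x y : R) (w z : C).

Definition normsq w : R := Re w ^+ 2 + Im w ^+ 2.

Lemma normsqM w z : normsq (w * z) = normsq w * normsq z.
Proof. by case: w z => [p q] [r s]; rewrite /normsq /=; ring. Qed.

Lemma normsqX w k : normsq w = 1 -> normsq (w ^+ k) = 1.
Proof.
move=> w1; elim: k => [|k IHk]; first by rewrite expr0 /normsq /= expr1n expr0n addr0.
by rewrite exprS normsqM w1 IHk mulr1.
Qed.

(** The last term stands apart because [beta_int (- a) 1] would diverge; the factor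
    [beta_int (1 - a) 1] is the inverse of [cT a] and stands for the coefficient (-a)_0 / 0! = 1,
    with the sign opposite to the other terms. *)
Definition kernel_sum a b n w z : R :=
  \sum_(k < n) Re (w * z ^+ k) * (beta_int b k.+1%:R * beta_int (- a) (n - k).+1%:R)
    - Re (w * z ^+ n) * (beta_int (1 - a) 1 * beta_int b n.+1%:R).

Variables (a b : R) (n : nat).
Hypotheses (a0 : 0 < a) (a1 : a < 1) (b0 : 0 < b) (b1 : b < 1) (n0 : (0 < n)%N).

Let a1_gt0 : 0 < 1 - a. Proof. by rewrite subr_gt0. Qed.
Let a1_lt1 : 1 - a < 1. Proof. by rewrite ltrBlDr ltrDl. Qed.

Let sqdist_dist2 c x : sqdist c (1 + x) = dist2 (2 - 2 * c) x.
Proof. by rewrite /sqdist /dist2; ring. Qed.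

Let Bb : R := beta_int b 1.
Let Ba : R := beta_int (1 - a) 1.
Let Bb0 : 0 < Bb. Proof. by apply: beta_int_gt0 => //; rewrite ltrDr. Qed.
Let Ba0 : 0 < Ba. Proof. by apply: beta_int_gt0 => //; rewrite ltrDr. Qed.

Let dist2_gt0 c x : c < 1 -> 0 < x -> 0 < dist2 (2 - 2 * c) x.
Proof.
move=> c1 x0; rewrite /dist2 ltr_wpDl ?sqr_ge0 // mulr_gt0 //; last by lra.
by lra.
Qed.

Let dist_mul c x : c < 1 -> 0 < x ->
  dist2 (2 - 2 * c) x `^ (1 / 2) * dist2 (2 - 2 * c) x `^ (- (1 - a) / 2) =
  dist2 (2 - 2 * c) x `^ (a / 2).
Proof. by move=> c1 x0; rewrite -powRDp ?dist2_gt0 //; congr (_ `^ _); field. Qed.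

Let scaled (h1 h2 : R) : cS b * cT a * (Bb * h1 + Ba * h2) = cS b * h2 + cT a * h1.
Proof. have [u v] : Bb != 0 /\ Ba != 0 by split; apply: lt0r_neq0; [exact: Bb0|exact: Ba0].
rewrite /cS /cT -/Bb -/Ba; move: Bb Ba u v => p q u v; by field; rewrite u v. Qed.

Let normsq_unit c g x : c ^+ 2 + g ^+ 2 = 1 -> normsq (1 - (1 + x)%:C * (c +i* (- g))) = dist2 (2 - 2 * c) x.
Proof.
move=> cg; rewrite /normsq /dist2 /=.
transitivity (1 - 2 * (1 + x) * c + (1 + x) ^+ 2 * (c ^+ 2 + g ^+ 2)); first by ring.
by rewrite cg; ring.
Qed.

(** Both integrals of [kernel_identity] are bounded pointwise. In the second the vector w z^n q has
    modulus |q| = D and the transform contributes D^(a-1), together D^a. *)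
Lemma kernel_sum_le w c g : c ^+ 2 + g ^+ 2 = 1 -> c < 1 -> normsq w = 1 ->
  cS b * cT a * kernel_sum a b n w (c +i* g) <=
  hlint (umaj a b (cS b) (cT a) n (2 - 2 * c)).
Proof.
move=> cg c1 w1; have P0 : 0 < 2 - 2 * c by lra.
have P4 : 2 - 2 * c <= 4.
  have : c ^+ 2 <= 1 by rewrite -cg lerDl sqr_ge0.
  by move=> c2; have : - 1 <= c; [nra|lra].
have cg' : c ^+ 2 + (- g) ^+ 2 = 1 by rewrite sqrrN.
have [iA iB e] := kernel_identity a0 a1 b0 b1 cg c1 w n0.
rewrite /kernel_sum {}e.
have i1 := hlintegrable_umaj1 a0 a1 b0 b1 n0 P0 P4.
have i2 := hlintegrable_umaj2 a0 a1 b0 b1 n0 P0.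
rewrite /umaj (hlint_lincomb (cS b) (cT a) i1 i2) -scaled.
rewrite ler_wpM2l ?mulr_ge0 ?(ltW (cS_gt0 _ _)) ?(ltW (cT_gt0 _ _)) //.
rewrite -(hlintZ Bb i2) -(hlintZ Ba i1).
apply: lerD.
  apply: (le_hlint iA (hlintegrableZ Bb i2)) => y y0.
  have Y0 : 0 <= 1 + y by lra.
  have h := resint_bound cg c1 b0 b1 Y0 ler01 (etrans w1 (esym (expr1n _ _))).
  rewrite mul1r sqdist_dist2 mulNr in h.
  rewrite mulrCA ler_wpM2l ?pw_ge0 //.
  exact: le_trans (ler_norm _) h.
rewrite -[- hlint _]mulN1r -(hlintZ _ iB).
apply: (le_hlint (hlintegrableZ _ iB) (hlintegrableZ Ba i1)) => x x0.
have X0 : 0 <= 1 + x by lra.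
rewrite mulN1r -mulrN mulrCA ler_wpM2l ?pw_ge0 //.
set v := w * _ * _.
have D0 := dist2_gt0 c1 x0.
have nv : Re v ^+ 2 + Im v ^+ 2 = (dist2 (2 - 2 * c) x `^ (1 / 2)) ^+ 2.
  rewrite powR_half_sqr powRr1 ?(ltW D0) // -(normsq_unit x cg) -/(normsq v) /v.
  by rewrite 2!normsqM normsqX ?w1 ?mul1r.
have h := resint_bound cg' c1 a1_gt0 a1_lt1 X0 (powR_ge0 _ _) nv.
rewrite sqdist_dist2 mulrCA dist_mul // in h.
by apply: le_trans h; rewrite -normrN; exact: ler_norm.
Qed.

(** At z = -1 all kernels are real and q = 2 + x = D. Since (-1)^n = -1, the subtracted second
    integral is negative, so both bounds are attained with the right sign. *)
Lemma kernel_sum_minus1 : odd n ->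
  cS b * cT a * kernel_sum a b n 1 (- 1) = hlint (umaj a b (cS b) (cT a) n 4).
Proof.
move=> odd_n; have cg : (- 1) ^+ 2 + 0 ^+ 2 = 1 :> R by ring.
have c1 : - 1 < 1 :> R by lra.
have -> : - 1 = (- 1) +i* 0 :> C by rewrite -(oppr0 R).
have [iA iB e] := kernel_identity a0 a1 b0 b1 cg c1 1 n0.
rewrite /kernel_sum {}e.
have P0 : 0 < 4 :> R by lra.
have i1 := hlintegrable_umaj1 a0 a1 b0 b1 n0 P0 (lexx 4).
have i2 := hlintegrable_umaj2 a0 a1 b0 b1 n0 P0.
rewrite /umaj (hlint_lincomb (cS b) (cT a) i1 i2) -scaled.
congr (_ * _).
have P4 : 4 = 2 - 2 * (- 1) :> R by ring.
rewrite -(hlintZ Bb i2) -(hlintZ Ba i1).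
congr (_ + _).
  apply: eq_hlint => y y0; have Y0 : 0 <= 1 + y by lra.
  by rewrite resint_negative_axis // mul1r sqdist_dist2 -P4 mulNr mulrCA.
rewrite -[- hlint _]mulN1r -(hlintZ _ iB).
apply: eq_hlint => x x0; have X0 : 0 <= 1 + x by lra.
have -> : ((- 1) +i* 0 : C) ^+ n = (- 1) +i* 0.
  have -> : (- 1) +i* 0 = - 1 :> C by rewrite -(oppr0 R).
  by rewrite -signr_odd odd_n expr1.
rewrite /= oppr0; set v1 : R := (X in resint _ _ _ X); set v2 : R := (X in resint _ _ _ _ X).
have -> : v2 = 0 by rewrite /v2; ring.
have -> : v1 = - (2 + x) by rewrite /v1; ring.
rewrite resint_negative_axis // sqdist_dist2 -P4.
have D0 := dist2_gt0 c1 x0; have dm := dist_mul c1 x0; rewrite -P4 in D0 dm.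
have -> : 2 + x = dist2 4 x `^ (1 / 2).
  have -> : dist2 4 x = (2 + x) ^+ 2 by rewrite /dist2; ring.
  have X2 : 0 <= 2 + x by lra.
  by rewrite -powR_mulrn // -powRrM (_ : 2 * (1 / 2) = 1) ?powRr1 //; field.
rewrite -dm -/Ba.
move: (pw b _ _) (dist2 4 x `^ (1 / 2)) (dist2 4 x `^ (- (1 - a) / 2)) Ba => r s t u; ring.
Qed.

Lemma kernel_sum_max w c g : odd n -> c ^+ 2 + g ^+ 2 = 1 -> c < 1 -> normsq w = 1 ->
  kernel_sum a b n w (c +i* g) <= kernel_sum a b n 1 (- 1).
Proof.
move=> odd_n cg c1 w1.
have S0 := cS_gt0 b0 b1; have T0 := cT_gt0 a0 a1.
rewrite -(ler_pM2l (mulr_gt0 S0 T0)) kernel_sum_minus1 //.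
apply: le_trans (kernel_sum_le cg c1 w1) _.
apply: (hlint_umaj_le a0 a1 b0 b1 S0 T0 (half_line_comparison a0 a1 b0 b1) _ _ n0).
  by lra.
have : c ^+ 2 <= 1 by rewrite -cg lerDl sqr_ge0.
by move=> c2; have : - 1 <= c; [nra|lra].
Qed.
End KernelSum.

(** * Real parameters up to 1 *)

Section Poch.
Context {K : pzRingType}.
Implicit Types (s : K) (k : nat).

Lemma poch0 s : poch s 0 = 1.
Proof. by rewrite /poch big_ord0. Qed.

Lemma pochS s k : poch s k.+1 = poch s k * (s + k%:R).
Proof. by rewrite /poch big_ord_recr. Qed.

End Poch.

Lemma poch_rmorph (K L : pzRingType) (f : {rmorphism K -> L}) (s : K) k :
  f (poch s k) = poch (f s) k.
Proof. by rewrite /poch rmorph_prod; apply: eq_bigr => i _; rewrite rmorphD rmorph_nat. Qed.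

Section Conv.
Context {R : realType}.
Local Notation C := R[i].
Implicit Types (a b : R) (w z : C).

Definition conv_coef a b n k : R :=
  poch b k / k`!%:R * (poch (- a) (n - k) / (n - k)`!%:R).

(* The coefficient of t^n in (1 - t)^a (1 - z t)^(-b). *)
Definition conv a b n z : C := \sum_(k < n.+1) (conv_coef a b n k)%:C * z ^+ k.

Lemma fact_neq0 k : k`!%:R != 0 :> R.
Proof. by rewrite pnatr_eq0 -lt0n fact_gt0. Qed.

Let rec_step (S B B' p f t u : R) : t != 0 -> f != 0 -> t * B' = u * B ->
  S * B = p / f -> S * B' = p * u / (t * f).
Proof.
move=> t0 f0 tB SB; apply: (mulfI t0).
have -> : t * (S * B') = u * (S * B) by rewrite mulrCA tB; ring.
by rewrite SB; field; rewrite t0 f0.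
Qed.

(** By [beta_int_rec] both sides have the quotient (b + k) / (k + 1) of consecutive terms. *)
Lemma cS_beta_int b k : 0 < b -> b < 1 -> cS b * beta_int b k.+1%:R = poch b k / k`!%:R.
Proof.
move=> b0 b1; elim: k => [|k IHk].
  by rewrite poch0 fact0 divr1 /cS mulVf // gt_eqF // beta_int_gt0 // ltrDr.
have k0 : 0 <= k%:R :> R by exact: ler0n.
rewrite pochS factS natrM.
apply: (rec_step _ (fact_neq0 k) _ IHk); first by rewrite pnatr_eq0.
rewrite -[k.+2%:R]natr1 beta_int_rec // -[k.+1%:R]natr1; last by lra.
by congr (_ * _); ring.
Qed.

(** The induction starts from [beta_int (- a) 2], the first of these integrals to converge; the sign
    is there because (-a)_(k+1) is negative. *)
Lemma cT_beta_int a k : 0 < a -> a < 1 ->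
  cT a * beta_int (- a) k.+2%:R = - (poch (- a) k.+1 / k.+1`!%:R).
Proof.
move=> a0 a1; have B0 : 0 < beta_int (1 - a) 1 by apply: beta_int_gt0; lra.
elim: k => [|k IHk].
  rewrite beta_int_shift // pochS poch0 /cT divr1 addr0 mul1r opprK mulrCA mulVf ?mulr1 //.
  by rewrite gt_eqF.
have k0 : 0 <= k%:R :> R by exact: ler0n.
rewrite (pochS _ k.+1) (factS k.+1) natrM -mulNr -mulNr.
rewrite -mulNr in IHk.
apply: (rec_step _ (fact_neq0 _) _ IHk); first by rewrite pnatr_eq0.
have k2 : k.+2%:R = k%:R + 2 :> R by rewrite -addn2 natrD.
have k1 : k.+1%:R = k%:R + 1 :> R by rewrite natr1.
have na1 : - a < 1 by clear -a0; lra.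
have ka : 1 < - a + k.+2%:R by rewrite k2; clear -a1 k0; lra.
rewrite -[k.+3%:R]natr1 beta_int_rec; [|exact: na1|exact: ka].
by rewrite k2 k1; congr (_ * _); ring.
Qed.

Lemma kernel_sum_conv a b n w z : 0 < a -> a < 1 -> 0 < b -> b < 1 ->
  cS b * cT a * kernel_sum a b n w z = - Re (w * conv a b n z).
Proof.
move=> a0 a1 b0 b1; rewrite /conv mulr_sumr Re_sum big_ord_recr opprD /=.
rewrite /kernel_sum mulrBr; congr (_ + _).
  rewrite mulr_sumr -sumrN; apply: eq_bigr => k _.
  rewrite [w * (_ * _)]mulrCA ReM mulrC /conv_coef -cS_beta_int //.
  have -> : (n - k)%N = (n - k).-1.+1 by rewrite prednK // subn_gt0.
  rewrite -mulNr -mulrN -cT_beta_int //.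
  move: (cS b) (cT a) (beta_int _ _) (beta_int _ _) (Re _) => s t p q r.
  by ring.
rewrite [w * (_ * _)]mulrCA ReM /conv_coef subnn poch0 fact0 divr1 mulr1 -cS_beta_int //; congr (- _).
rewrite /cT.
have : beta_int (1 - a) 1 != 0 by rewrite gt_eqF // beta_int_gt0 //; lra.
move: (cS b) (beta_int _ _) (beta_int _ _) (Re _) => s t p q t0.
by field.
Qed.

Lemma continuous_poch k : continuous (fun s : R => poch s k).
Proof.
elim: k => [|k IHk].
  rewrite (_ : (fun s => poch s 0) = cst (1 : R)); first exact: cst_continuous.
  by apply/funext => s; rewrite poch0.
rewrite (_ : (fun s => poch s k.+1) = (fun s : R => poch s k * (s + k%:R))).
  by move=> s; apply: cvgM; [exact: IHk|apply: cvgD; [exact: cvg_id|exact: cvg_cst]].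
by apply/funext => s; rewrite pochS.
Qed.

Lemma continuous_conv_coef_l b n k : continuous (fun a => conv_coef a b n k).
Proof.
move=> a; apply: cvgM; first exact: cvg_cst.
apply: cvgM; last exact: cvg_cst.
by apply: (@continuous_comp _ _ _ (@GRing.opp R) (fun s => poch s (n - k)));
  [exact: opp_continuous|exact: continuous_poch].
Qed.

Lemma continuous_conv_coef_r a n k : continuous (fun b => conv_coef a b n k).
Proof.
move=> b; apply: cvgM; last exact: cvg_cst.
by apply: cvgM; [exact: continuous_poch|exact: cvg_cst].
Qed.

Lemma ge0_at1 (h : R -> R) : continuous h -> (forall t, 0 < t -> t < 1 -> 0 <= h t) -> 0 <= h 1.
Proof.
move=> ch h0; have h1 : h x @[x --> (1 : R)^'-] --> h 1.
  by apply: cvg_at_left_filter; exact: ch.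
have <- := cvg_lim (@Rhausdorff R) h1.
apply: limr_ge; first by apply/cvg_ex; exists (h 1).
near=> t; apply: h0; last by near: t; exact: nbhs_left_lt.
by near: t; exact: nbhs_left_gt.
Unshelve. all: by end_near.
Qed.

Let coef_gap (w z : C) k : R := Re (w * z ^+ k) - (- 1) ^+ k.

Let gap_sum a b n w z : R := \sum_(k < n.+1) conv_coef a b n k * coef_gap w z k.

Lemma conv_minus1 a b n : conv a b n (- 1) = (\sum_(k < n.+1) conv_coef a b n k * (- 1) ^+ k)%:C.
Proof.
by rewrite rmorph_sum; apply: eq_bigr => k _; rewrite [RHS]rmorphM rmorphXn rmorphN1.
Qed.

Let gap_sumE a b n w z : gap_sum a b n w z = Re (w * conv a b n z) - Re (conv a b n (- 1)).
Proof.
rewrite conv_minus1 /= /conv mulr_sumr Re_sum -sumrB; apply: eq_bigr => k _.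
by rewrite mulrCA ReM -mulrBr.
Qed.

(** For fixed [w] and [z] the sum is a polynomial in [a] and in [b], so the strict case extends by
    left limits: first b = 1 with a < 1, then a = 1. *)
Let gap_sum_ge0 a b n w c g : odd n -> 0 < a -> a <= 1 -> 0 < b -> b <= 1 ->
  c ^+ 2 + g ^+ 2 = 1 -> c < 1 -> normsq w = 1 -> 0 <= gap_sum a b n w (c +i* g).
Proof.
move=> n_odd a0 a1 b0 b1 cg c1 w1; set z := c +i* g.
have lt1 a' b' : 0 < a' -> a' < 1 -> 0 < b' -> b' < 1 -> 0 <= gap_sum a' b' n w z.
  move=> a'0 a'1 b'0 b'1.
  have h := kernel_sum_max a'0 a'1 b'0 b'1 (odd_gt0 n_odd) n_odd cg c1 w1.
  rewrite -(ler_pM2l (mulr_gt0 (cS_gt0 b'0 b'1) (cT_gt0 a'0 a'1))) in h.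
  rewrite !kernel_sum_conv // mul1r lerN2 in h.
  by rewrite gap_sumE subr_ge0.
have ltb a' : 0 < a' -> a' < 1 -> 0 <= gap_sum a' b n w z.
  move=> a'0 a'1; move: b1; rewrite le_eqVlt => /predU1P[->|b1]; last exact: lt1.
  apply: (@ge0_at1 (fun b => gap_sum a' b n w z)); last by move=> t; exact: lt1.
  apply: (continuous_big add_continuous) => k _ t; apply: cvgM; last exact: cvg_cst.
  exact: continuous_conv_coef_r.
move: a1; rewrite le_eqVlt => /predU1P[->|a1]; last exact: ltb.
apply: (@ge0_at1 (fun a => gap_sum a b n w z)); last by move=> t; exact: ltb.
apply: (continuous_big add_continuous) => k _ t; apply: cvgM; last exact: cvg_cst.
exact: continuous_conv_coef_l.
Qed.

Lemma norm_conv_le a b n c g : odd n -> 0 < a -> a <= 1 -> 0 < b -> b <= 1 ->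
  c ^+ 2 + g ^+ 2 = 1 -> c < 1 -> `|conv a b n (c +i* g)| <= - conv a b n (- 1).
Proof.
move=> n_odd a0 a1 b0 b1 cg c1.
have ge0 w := gap_sum_ge0 n_odd a0 a1 b0 b1 cg c1 (w := w).
rewrite [in leRHS]conv_minus1 -rmorphN /= normc_def lecR.
have <- : Re (conv a b n (- 1)) = \sum_(k < n.+1) conv_coef a b n k * (- 1) ^+ k by rewrite conv_minus1.
set Q := conv a b n (c +i* g) in ge0 *.
have {}ge0 w : normsq w = 1 -> Re (conv a b n (- 1)) <= Re (w * Q).
  by move=> /ge0; rewrite gap_sumE subr_ge0.
rewrite -/Q; set m := Num.sqrt _.
rewrite lerNr.
have mE : m ^+ 2 = Re Q ^+ 2 + Im Q ^+ 2 by rewrite sqr_sqrtr // addr_ge0 ?sqr_ge0.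
(* When Q = 0 there is no direction to normalise, and w = 1 already gives the bound. *)
have [m0|m0] := eqVneq m 0.
  have w1 : normsq (1 : C) = 1 by rewrite /normsq /= expr1n expr0n addr0.
  have := ge0 1 w1; rewrite mul1r m0 oppr0 => /le_trans; apply.
  have : Re Q ^+ 2 <= 0 by rewrite -[leRHS](expr0n R 2) -{1}m0 mE lerDl sqr_ge0.
  by move=> h; have := sqr_ge0 (Re Q); rewrite le_eqVlt ltNge h orbF eq_sym sqrf_eq0 => /eqP ->.
(* This is w = - conj Q / |Q|, for which w Q = -|Q|. *)
have w1 : normsq ((- (Re Q / m)) +i* (Im Q / m)) = 1.
  rewrite /normsq /= sqrrN !exprMn -mulrDl -mE -exprMn divff // expr1n //.
apply: le_trans (ge0 _ w1) _; rewrite le_eqVlt; apply/orP; left; apply/eqP.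
have -> r s : Re ((r +i* s) * Q) = r * Re Q - s * Im Q by case: (Q).
have -> : - (Re Q / m) * Re Q - Im Q / m * Im Q = - ((Re Q ^+ 2 + Im Q ^+ 2) / m) by ring.
by rewrite -mE expr2 mulfK.
Qed.

End Conv.

(** * The limit at alpha = 1 *)

Section Hypergeometric.
Context {R : realType}.
Local Notation C := R[i].
Implicit Types (a b : R) (x : C).

Lemma poch_opp_nat n k : (k <= n)%N ->
  poch (- n%:R : R) k * (n - k)`!%:R = (- 1) ^+ k * n`!%:R.
Proof.
elim: k => [|k IHk] kn; first by rewrite poch0 subn0.
have := IHk (ltnW kn).
have -> : (n - k)%N = (n - k.+1).+1 by rewrite subnS prednK // subn_gt0.
rewrite pochS exprSr factS natrM.
have -> : - n%:R + k%:R = - (n - k.+1).+1%:R :> R.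
  by rewrite -[in n%:R](subnK kn) -addSnnS natrD; ring.
move: (poch _ _) (_ ^+ k) (n`!%:R) ((n - k.+1)`!%:R) ((n - k.+1).+1%:R) => p s f g m IH.
transitivity (- (p * (m * g))); first by ring.
by rewrite IH; ring.
Qed.

(** The last [k] factors of (-a)_n, read backwards and with signs changed, are the factors of (a - n
    + 1)_k. *)
Lemma poch_split a n k : (k <= n)%N ->
  poch (- a) n = poch (- a) (n - k) * (- 1) ^+ k * poch (a - n%:R + 1) k.
Proof.
elim: k => [|k IHk] kn; first by rewrite poch0 subn0 !mulr1.
rewrite (IHk (ltnW kn)) exprSr (pochS (a - _ + _)).
have -> : (n - k)%N = (n - k.+1).+1 by rewrite subnS prednK // subn_gt0.
rewrite pochS.
have -> : n%:R = (n - k.+1)%:R + k%:R + 1 :> R.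
  by rewrite -[in LHS](subnK kn) natrD -natr1 addrA.
set p := poch (- a) _; set q := poch _ k; move: p q (_ ^+ k) ((n - k.+1)%:R) => p q s m.
by ring.
Qed.

Let regroup (u v t f g h s : R) : v != 0 -> t != 0 -> s != 0 -> g != 0 -> h != 0 ->
  s * s = 1 -> u * (s * f / h) / (t * g) = f / (v * s * t) * (u / g * (v / h)).
Proof.
move=> v0 t0 s0 g0 h0 s2.
rewrite (_ : s * f / h = s * s * f / (s * h)); last by field; rewrite s0 h0.
by rewrite s2; field; rewrite v0 t0 s0 g0 h0.
Qed.

Lemma hyp2F1_conv a b n x : poch (- a) n != 0 ->
  hyp2F1 b%:C (- n%:R) (a - n%:R + 1)%:C x = (n`!%:R / poch (- a) n)%:C * conv a b n x.
Proof.
move=> pa0; rewrite hyp2F1_poly mulr_sumr; apply: eq_bigr => k _.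
have kn : (k <= n)%N by rewrite -ltnS.
rewrite mulrA; congr (_ * _).
have -> : (- n%:R : C) = (- n%:R)%:C by rewrite rmorphN rmorph_nat.
rewrite -!poch_rmorph -[k`!%:R](rmorph_nat (real_complex R)) -!rmorphM -fmorphV -!rmorphM /=.
congr (_%:C); rewrite /conv_coef.
have h1 := poch_opp_nat kn; have h2 := poch_split a kn.
have : (- 1) ^+ k != 0 :> R by rewrite signr_eq0.
rewrite h2 in pa0 *; move: pa0; rewrite !mulf_eq0 !negb_or => /andP[/andP[p0 s0] q0] _.
have -> : poch (- n%:R) k = (- 1) ^+ k * n`!%:R / (n - k)`!%:R :> R.
  by rewrite -h1 mulfK // fact_neq0.
have f1 := @fact_neq0 R k; have f2 := @fact_neq0 R (n - k).
have s2 : (- 1) ^+ k * (- 1) ^+ k = 1 :> R by rewrite -exprMn mulN1r opprK expr1n.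
exact: regroup.
Qed.

End Hypergeometric.

Section ComplexLimit.
Context {R : realType}.
Local Notation C := R[i].

Lemma cvg_real_complex (T : Type) (F : set_system T) (f : T -> R) (l : R) : Filter F ->
  f @ F --> l -> ((f x)%:C : C^o) @[x --> F] --> (l%:C : C^o).
Proof.
move=> FF fl; apply/(@cvgrPdist_lt _ C^o) => e e0.
have [e1 e2] : 0 < Re e /\ e = (Re e)%:C.
  by case: e e0 => p q; rewrite ltcE /= => /andP[/eqP -> p0].
near=> x; rewrite -rmorphB normc_def /= expr0n addr0 sqrtr_sqr e2 ltcR.
by near: x; move/cvgrPdist_lt : fl; exact.
Unshelve. all: by end_near. Qed.

Lemma cvg_real_poly (T : Type) (F : set_system T) n (f : nat -> T -> R) (l : nat -> R) (x : C) :
  Filter F -> (forall k, f k @ F --> l k) ->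
  (\sum_(k < n) (f k t)%:C * x ^+ k : C^o) @[t --> F] --> (\sum_(k < n) (l k)%:C * x ^+ k : C^o).
Proof.
move=> FF fl; have h k : ((f k t)%:C * x ^+ k : C^o) @[t --> F] --> ((l k)%:C * x ^+ k : C^o).
  by apply: (@cvgM C _ F); [exact: cvg_real_complex|exact: cvg_cst].
elim: n => [|n IHn].
  rewrite big_ord0; apply: cvg_near_cst; apply: nearW => t.
  by rewrite big_ord0.
rewrite big_ord_recr.
rewrite (_ : (fun t => \sum_(k < n.+1) _) = (fun t =>
  (\sum_(k < n) (f k t)%:C * x ^+ k : C^o) + (f n t)%:C * x ^+ n)); last first.
  by apply/funext => t; rewrite big_ord_recr.
exact: (@cvgD C C^o T F FF _ _ _ _ IHn (h n)).
Qed.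

End ComplexLimit.

Section SineQuotient.
Context {R : realType}.

Let cvg_sub1 : a - 1 @[a --> (1 : R)^'] --> (0 : R)^'.
Proof.
move=> A [e /= e0 eA]; exists e => //= a ae an1; apply: eA => /=.
  by move: ae; rewrite /ball /= sub0r normrN distrC.
by rewrite subr_eq0.
Qed.

Lemma cvg_sin_quotient : sin (pi * a) / (a - 1) @[a --> (1 : R)^'] --> - (pi : R).
Proof.
have d : is_derive (1 : R) (1 : R) (fun a : R => sin (pi * a)) (- pi).
  have h := is_deriveM (is_derive_cst (pi : R) (1 : R) 1) (is_derive_id (1 : R) 1).
  have h2 := @is_derive1_comp _ sin (fun a => pi * a) 1 _ _ (is_derive_sin _) h.
  apply: (is_derive_eq h2); rewrite /GRing.scale /= mulr1 cospi; ring.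
have [dv dE] := d; rewrite -dE.
have := cvg_comp _ _ cvg_sub1 dv; apply: cvg_trans; apply: near_eq_cvg; apply: nearW => a /=.
have -> : (a - 1) *: (1 : R) + 1 = a by rewrite -[RHS](subrK 1); congr (_ + _); exact: mulr1.
by rewrite mulr1 sinpi subr0; exact: mulrC.
Qed.

End SineQuotient.

Section Prefactor.
Context {R : realType}.
Local Notation C := R[i].
Implicit Types (a b : R) (x : C).

Lemma poch_recl a k : poch a k.+1 = a * poch (a + 1) k.
Proof.
rewrite /poch big_ord_recl addr0; congr (_ * _); apply: eq_bigr => i _.
by rewrite -addrA nat1r.
Qed.

Lemma poch_gt0 a k : 0 < a -> 0 < poch a k.
Proof.
by move=> a0; apply: prodr_gt0 => i _; rewrite ltr_wpDr ?ler0n.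
Qed.

Lemma poch_opp_lt0 a k : 0 < a -> a < 1 -> poch (- a) k.+1 < 0.
Proof.
move=> a0 a1; rewrite poch_recl mulNr oppr_lt0 mulr_gt0 // poch_gt0 //.
by rewrite addrC subr_gt0.
Qed.

(** By the reflection formula this is the constant -pi wherever the quotient makes sense; its sign
    and its limit at a = 1 are what the proof uses. *)
Definition prefactor n a : R :=
  (n`!%:R)^-1 * Gamma (n%:R - a) * Gamma (1 + a) * sin (pi * a) * (n`!%:R / poch (- a) n).

Lemma w_formula_conv n a b x : poch (- a) n != 0 ->
  w_formula n a b x = (prefactor n a)%:C * conv a b n x.
Proof. by move=> pa0; rewrite /w_formula hyp2F1_conv // mulrA -rmorphM. Qed.

Lemma prefactor_le0 n a : 0 < a -> a < 1 -> prefactor n.+1 a <= 0.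
Proof.
move=> a0 a1; rewrite /prefactor mulr_ge0_le0 //.
  rewrite !mulr_ge0 ?Gamma_ge0 ?invr_ge0 //.
  have p0 := pi_gt0 R.
  apply: sin_ge0_pi; rewrite mulr_ge0 ?(ltW p0) ?(ltW a0) //=.
  by rewrite ler_piMr ?(ltW p0) ?(ltW a1).
by rewrite mulr_ge0_le0 // invr_le0 ltW // poch_opp_lt0.
Qed.

Lemma prefactorE n a : prefactor n.+2 a =
  Gamma (n.+2%:R - a) * Gamma (1 + a) * (sin (pi * a) / (a - 1)) / (a * poch (2 - a) n).
Proof.
rewrite /prefactor !poch_recl.
have -> : - a + 1 + 1 = 2 - a by ring.
have -> : - a * ((- a + 1) * poch (2 - a) n) = (a - 1) * (a * poch (2 - a) n) by ring.
rewrite invfM.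
move: (n.+2`!%:R : R) (fact_neq0 (R := R) n.+2) => f f0.
move: (Gamma _) (Gamma _) (sin _) (a - 1)^-1 (a * _)^-1 => u v s t p.
by field.
Qed.

(** The bound on [n] keeps both arguments of [Gamma] above 1 at the limit, where [continuous_Gamma]
    applies: they tend to n and to 2. *)
Lemma cvg_prefactor n : (1 < n)%N -> exists2 l : R, l <= 0 &
  prefactor n.+1 a @[a --> (1 : R)^'] --> l.
Proof.
case: n => // n n0.
exists (Gamma (n.+2%:R - 1) * Gamma (1 + 1) * (- pi) / (1 * poch (2 - 1) n)).
  rewrite mulr_le0_ge0 //; last by rewrite mul1r invr_ge0 ltW // poch_gt0 //; lra.
  by rewrite mulr_ge0_le0 ?mulr_ge0 ?Gamma_ge0 // oppr_le0 pi_ge0.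
have -> : prefactor n.+2 = (fun a => Gamma (n.+2%:R - a) * Gamma (1 + a) *
    (sin (pi * a) / (a - 1)) / (a * poch (2 - a) n)).
  by apply/funext => a; rewrite prefactorE.
have cB (c : R) : {for (1 : R), continuous (fun a : R => c - a)}.
  by apply: cvgB; [exact: cvg_cst|exact: cvg_id].
have cD : {for (1 : R), continuous (fun a : R => 1 + a)}.
  by apply: cvgD; [exact: cvg_cst|exact: cvg_id].
apply: cvgM; first apply: cvgM; first apply: cvgM.
- apply: cvg_within_filter.
  apply: (continuous_comp (cB n.+2%:R)); apply: continuous_Gamma.
  by rewrite ltrBrDr; apply: (etrans (ltr_nat R 2 n.+2)).
- apply: cvg_within_filter.
  by apply: (continuous_comp cD); apply: continuous_Gamma; lra.
- exact: cvg_sin_quotient.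
apply: cvgV.
  by rewrite mul1r gt_eqF // poch_gt0 //; lra.
apply: cvg_within_filter; apply: cvgM; first exact: cvg_id.
exact: (@continuous_comp _ _ _ (fun a : R => 2 - a) (fun s : R => poch s n) 1 (cB 2)
  (@continuous_poch R n _)).
Qed.

Lemma poch_opp_neq0 n a : 0 < a -> a < 2 -> a != 1 -> poch (- a) n != 0.
Proof.
move=> a0 a2 a1; apply/prodf_neq0 => -[[|[|i]] ?] _ /=.
- by rewrite addr0 oppr_eq0 gt_eqF.
- by rewrite addrC subr_eq0 eq_sym.
- by rewrite addrC gt_eqF // subr_gt0; apply: lt_le_trans a2 _; rewrite (ler_nat R 2).
Qed.

(** For a < 1 this is the finite hypergeometric sum. At a = 1 the limit is taken coefficientwise; in
    the punctured neighbourhood [s] stays between 0 and 2 and differs from 1, so no factor of (-s)_n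
    vanishes. *)
Lemma w_conv n a b : (2 < n)%N -> 0 < a -> a <= 1 ->
  exists2 l : R, l <= 0 & forall x, w n a b x = l%:C * conv a b n x.
Proof.
case: n => // n n2 a0; rewrite le_eqVlt => /predU1P[a1|a1]; last first.
  exists (prefactor n.+1 a); first exact: prefactor_le0.
  by move=> x; rewrite /w lt_eqF // w_formula_conv // lt_eqF // poch_opp_lt0.
have [l l0 cl] := cvg_prefactor n2; exists l => // x.
rewrite /w a1 eqxx.
have h : (\sum_(k < n.+2) (prefactor n.+1 s * conv_coef s b n.+1 k)%:C * x ^+ k : C^o) @[s --> (1 : R)^'] -->
    (\sum_(k < n.+2) (l * conv_coef 1 b n.+1 k)%:C * x ^+ k : C^o).
  apply: (cvg_real_poly (f := fun k s => prefactor n.+1 s * conv_coef s b n.+1 k)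
    (l := fun k => l * conv_coef 1 b n.+1 k)) => k.
  by apply: cvgM => //; apply: cvg_within_filter; exact: continuous_conv_coef_l.
have -> : l%:C * conv 1 b n.+1 x = \sum_(k < n.+2) (l * conv_coef 1 b n.+1 k)%:C * x ^+ k.
  by rewrite mulr_sumr; apply: eq_bigr => k _; rewrite (rmorphM _ l) mulrA.
apply: (cvg_lim (@norm_hausdorff C C^o)).
apply: cvg_trans h; apply: near_eq_cvg; near=> s.
rewrite w_formula_conv; last first.
  apply: poch_opp_neq0.
  - by near: s; apply: cvg_within; apply: lt_nbhsr; exact: ltr01.
  - by near: s; apply: cvg_within; apply: lt_nbhsl; rewrite ltr1n.
  - by near: s; exact: nbhs_dnbhs_neq.
by rewrite mulr_sumr; apply: eq_bigr => k _; rewrite (rmorphM _ (prefactor n.+1 s)) mulrA.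
Unshelve. all: by end_near. Qed.

End Prefactor.

(* The inequality is in R[i], where u <= v means that v - u is a nonnegative
   real; as a modulus is real, w n alpha beta (-1) is asserted to be real. *)
Theorem theorem2p1 (R : realType) (n : nat) (alpha beta phi : R)
    (n_odd : odd n) (n_ge5 : (5 <= n)%N)
    (alpha_gt0 : 0 < alpha) (alpha_le1 : alpha <= 1)
    (beta_gt0 : 0 < beta) (beta_le1 : beta <= 1)
    (phi_ge : phi0 <= phi) (phi_le : phi <= pi) :
  w n alpha beta (-1) >= `|w n alpha beta (cis phi)|.
Proof.
have n2 : (2 < n)%N by apply: leq_trans n_ge5.
have [l l0 wE] := w_conv beta n2 alpha_gt0 alpha_le1.
have phi_gt0 : 0 < phi.
  by apply: lt_le_trans phi_ge; apply: divr_gt0; rewrite ltr0n.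
have cos_lt1 : cos phi < 1.
  by rewrite -cos0 ltr_cos // in_itv /= ?lexx ?pi_ge0 ?phi_le ?(ltW phi_gt0).
rewrite !wE normrM.
have -> : `|l%:C| = - l%:C.
  by rewrite normc_def /= expr0n addr0 sqrtr_sqr ler0_norm // rmorphN.
rewrite -[leRHS]mulrNN ler_wpM2l //.
  by rewrite oppr_ge0 -(rmorph0 (real_complex R)) lecR.
exact: norm_conv_le (cos2Dsin2 phi) cos_lt1.
Qed.
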